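(* Let $\mathfrak D$ be an admissible domain with cover $\tilde{\mathfrak D}$, $\overset{\circ}{\Upsilon}$ an admissible $\Upsilon$-data on $\mathfrak D$, and $\bm\varphi$ an admissible flow on $[0,T]\times\mathfrak D$ associated with $\overset{\circ}{\Upsilon}$. Let $\mathfrak O,\mathfrak O_0,\mathfrak O_1$ be connected open subsets of $\mathbb R^3$ with $\mathfrak B_0\subset\mathfrak O_0\Subset\mathfrak O\Subset\mathfrak O_1\Subset\tilde{\mathfrak D}$ and $\mathfrak O_1$ convex. Then there are $T_1\in\,]0,T[$ and a mapping $\bm\psi:[0,T_1]\times\mathfrak O\to\mathfrak O_1$ with $\bm x=\bm\varphi(t,\bm\psi(t,\bm x))$ for all $(t,\bm x)\in[0,T_1]\times\mathfrak O$ (and $\mathfrak O_0\subset\bm\psi(t,\mathfrak O)$), such that, setting for $(t,\bm x)\in[0,T_1]\times\mathfrak O$ $$\Upsilon(t,\bm x)=\overset{\circ}{\Upsilon}(\bm\psi(t,\bm x))\Big(\det D\bm\varphi(t,\bar{\bm x})\big|_{\bar{\bm x}=\bm\psi(t,\bm x)}\Big)^{-(\gamma-1)},\qquad \bm v(t,\bm x)=\partial_t\bm\varphi(t,\bar{\bm x})\big|_{\bar{\bm x}=\bm\psi(t,\bm x)},$$ the pair $(\Upsilon,\bm v)$ is a classical $(\Upsilon,\bm v)$-solution on $[0,T_1]\times(\mathfrak O\setminus\mathfrak B_0)$.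
   Context: Constants: $\mathsf{G}M_0>0$, $R_0>0$, $\Omega\in\mathbb R$, $\mathsf A>0$, $1<\gamma<2$. $\mathfrak B_0=\{\|\bm x\|\le R_0\}$. $\Phi(\bm x)=\chi(\|\bm x\|/R_0)\big[-\mathsf{G}M_0/\|\bm x\|-\frac{\Omega^2}{2}((x^1)^2+(x^2)^2)\big]$ with $\chi\in C^\infty(\mathbb R)$, $1_{[1/2,\infty[}\le\chi\le1_{[1/4,\infty[}$. $B=2\Omega\begin{bmatrix}0&-1&0\\1&0&0\\0&0&0\end{bmatrix}$. $A\Subset B'$ means $\mathbf{Cl}A$ is a compact subset of $B'$. Admissible domain: open connected $\mathfrak D\subset\mathbb R^3$ such that $\tilde{\mathfrak D}=\mathfrak D\cup\mathfrak B_0$ (its cover) is open connected, $\mathfrak D=\tilde{\mathfrak D}\setminus\mathfrak B_0$, $\partial\mathfrak D$ smooth. Admissible $\Upsilon$-data: $\overset{\circ}{\Upsilon}\in C^1(\mathbf{Cl}\tilde{\mathfrak D})$ with $\overset{\circ}{\Upsilon}>0$ on $\partial\mathfrak B_0$. Admissible flow on $[0,T]\times\mathfrak D$ associated with $\overset{\circ}{\Upsilon}$: a vector field $\bm\varphi\in C^1([0,T];C^1(\mathbf{Cl}\tilde{\mathfrak D}))\cap C([0,T];C^2(\mathbf{Cl}\tilde{\mathfrak D}))$ with $\bm\varphi(0,\bar{\bm x})=\bar{\bm x}$ on $\tilde{\mathfrak D}$ such that, writing $F=D\bm\varphi(t,\bar{\bm x})$ (Jacobian in $\bar{\bm x}$),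 $\bm v^L=F^{-1}\partial_t\bm\varphi$, $\Upsilon^L=\overset{\circ}{\Upsilon}(\bar{\bm x})(\det F)^{-(\gamma-1)}$, $\Phi^L=\Phi(\bm\varphi(t,\bar{\bm x}))$, the equation $$\partial_t\bm v^L+F^{-1}(\partial_tF)\bm v^L+F^{-1}BF\bm v^L+F^{-1}(F^{-1})^{\top}\mathrm{grad}_{\bar{\bm x}}(\Upsilon^L+\Phi^L)=0$$ holds on $[0,T]\times\mathfrak D$, and $\big(\tfrac1{R_0}F^{\top}\bm\varphi\,\big|\,\bm v^L\big)=0$ on $[0,T]\times\partial\mathfrak B_0$. Classical $(\Upsilon,\bm v)$-solution on $[0,T_1]\times\mathfrak D'$ ($\mathfrak D'$ with cover $\tilde{\mathfrak D}'$): $(\Upsilon,\bm v)$ has a $C^1$ extension to $[0,T_1]\times\tilde{\mathfrak D}'$, satisfies $\partial_t\Upsilon+(\bm v\cdot\nabla)\Upsilon+(\gamma-1)\Upsilon\,\mathrm{div}\bm v=0$ and $\partial_t\bm v+(\bm v\cdot\nabla)\bm v+B\bm v+\nabla(\Upsilon+\Phi)=0$ on $[0,T_1]\times\mathfrak D'$, and $\Upsilon>0$, $\bm x\cdot\bm v=0$ on $[0,T_1]\times\partial\mathfrak B_0$. *)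

(* Defs.v *)
From HB Require Import structures.
From mathcomp Require Import all_boot all_order all_algebra.
From mathcomp Require Import all_classical all_reals all_analysis.
Set Implicit Arguments. Unset Strict Implicit. Unset Printing Implicit Defensive.
Import Order.TTheory GRing.Theory Num.Theory.
Import numFieldNormedType.Exports.
Local Open Scope classical_set_scope.
Local Open Scope ring_scope.

Section Defs.
Variable R : realType.

Definition vec := 'cV[R]_3.

Definition ebasis (i : 'I_3) : vec := delta_mx i 0.

Definition dotv (u w : vec) : R := \sum_(i < 3) u i 0 * w i 0.
Definition enorm (x : vec) : R := Num.sqrt (dotv x x).

Definition closedB0 (R0 : R) : set vec := [set x | enorm x <= R0].

Definition pdv {V : normedModType R} (f : vec -> V) (i : 'I_3) : vec -> V :=
  fun x => 'D_(ebasis i) f x.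
Definition pdlv {V : normedModType R} (l : seq 'I_3) (f : vec -> V) : vec -> V :=
  foldr (fun i g => pdv g i) f l.

Definition jacv (f : vec -> vec) (x : vec) : 'M[R]_3 :=
  \matrix_(i < 3, j < 3) (pdv f j x) i 0.
Definition gradv (g : vec -> R) (x : vec) : vec := \col_(i < 3) pdv g i x.
Definition divv (f : vec -> vec) (x : vec) : R := \tr (jacv f x).

Definition cpt_sub (A B : set vec) := compact (closure A) /\ closure A `<=` B.

Definition convex_set3 (A : set vec) :=
  forall x y (s : R), A x -> A y -> 0 <= s <= 1 -> A ((1 - s) *: x + s *: y).

Definition smooth_on (U : set vec) (rho : vec -> R) :=
  forall (l : seq 'I_3) x, U x -> differentiable (pdlv l rho) x.

Definition smooth_boundary (D : set vec) :=
  forall p, closure D p -> ~ D p ->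
    exists (U : set vec) (rho : vec -> R),
      [/\ open U, U p, smooth_on U rho, gradv rho p != 0 &
          forall x, U x -> (D x <-> rho x < 0)].

Definition dcover (R0 : R) (D : set vec) : set vec := D `|` closedB0 R0.

Definition admissible_domain (R0 : R) (D : set vec) :=
  [/\ open D /\ connected D, open (dcover R0 D), connected (dcover R0 D),
      D = dcover R0 D `\` closedB0 R0 & smooth_boundary D].

Definition CkCl {V : normedModType R} (k : nat) (A : set vec) (f : vec -> V) :=
  [/\ {within closure A, continuous f},
      (forall l : seq 'I_3, (size l < k)%N -> forall x, A x -> differentiable (pdlv l f) x) &
      (forall l : seq 'I_3, (0 < size l <= k)%N ->
         exists g : vec -> V, (forall x, A x -> pdlv l f x = g x) /\
                              {within closure A, continuous g})].

Definition admissible_ups (R0 : R) (D : set vec) (ups0 : vec -> R) :=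
  CkCl 1 (dcover R0 D) ups0 /\ (forall x, enorm x = R0 -> 0 < ups0 x).

Definition contC {V : normedModType R} (k : nat) (A : set vec) (T : R)
    (F : R -> vec -> V) :=
  (forall t, 0 <= t <= T -> CkCl k A (F t)) /\
  (forall t, 0 <= t <= T -> forall eps : R, 0 < eps -> exists delta : R, 0 < delta /\
     forall s, 0 <= s <= T -> `|s - t| < delta ->
     forall l : seq 'I_3, (size l <= k)%N -> forall x, A x ->
       `|pdlv l (F s) x - pdlv l (F t) x| <= eps).

Definition C1C1 (A : set vec) (T : R) (F Fd : R -> vec -> vec) :=
  [/\ contC 1 A T F, contC 1 A T Fd &
   forall t, 0 <= t <= T -> forall eps : R, 0 < eps -> exists delta : R, 0 < delta /\
     forall s, 0 <= s <= T -> s != t -> `|s - t| < delta ->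
     forall l : seq 'I_3, (size l <= 1)%N -> forall x, A x ->
       `|(s - t)^-1 *: (pdlv l (F s) x - pdlv l (F t) x) - pdlv l (Fd t) x| <= eps].

Definition has_tder {V : normedModType R} (T : R) (f : R -> V) (t : R) (d : V) :=
  forall eps : R, 0 < eps -> exists delta : R, 0 < delta /\
    forall s, 0 <= s <= T -> s != t -> `|s - t| < delta ->
      `|(s - t)^-1 *: (f s - f t) - d| <= eps.

Definition Bmat (Om : R) : 'M[R]_3 :=
  \matrix_(i < 3, j < 3)
    (2 * Om * (if ((i : nat) == 1%N) && ((j : nat) == 0%N) then 1
               else if ((i : nat) == 0%N) && ((j : nat) == 1%N) then -1 else 0)).

Definition Phipot (GM0 R0 Om : R) (chi : R -> R) (x : vec) : R :=
  chi (enorm x / R0) *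
    (- GM0 / enorm x - Om ^+ 2 / 2 * (x 0 0 ^+ 2 + x 1 0 ^+ 2)).

Definition cutoff_chi (chi : R -> R) :=
  (forall (n : nat) (s : R), derivable (derive1n n chi) s 1) /\
  (forall s : R, (if 1/2 <= s then 1 else 0) <= chi s <= (if 1/4 <= s then 1 else 0)).

Definition Fmat (phi : R -> vec -> vec) t x := jacv (phi t) x.
Definition vL (phi dphi : R -> vec -> vec) t x : vec :=
  invmx (Fmat phi t x) *m dphi t x.
Definition upsL (gam : R) (ups0 : vec -> R) (phi : R -> vec -> vec) t x : R :=
  ups0 x * (\det (Fmat phi t x)) `^ (- (gam - 1)).

Definition admissible_flow (GM0 R0 Om gam : R) (chi : R -> R) (D : set vec)
    (ups0 : vec -> R) (T : R) (phi dphi : R -> vec -> vec) :=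
  [/\ C1C1 (dcover R0 D) T phi dphi /\ contC 2 (dcover R0 D) T phi,
      (forall x, dcover R0 D x -> phi 0 x = x),
      (forall t x, 0 <= t <= T -> D x \/ enorm x = R0 -> 0 < \det (Fmat phi t x)),
      (forall t x, 0 <= t <= T -> D x ->
         exists d : vec, has_tder T (fun s => vL phi dphi s x) t d /\
           d + invmx (Fmat phi t x) *m jacv (dphi t) x *m vL phi dphi t x
             + invmx (Fmat phi t x) *m Bmat Om *m Fmat phi t x *m vL phi dphi t x
             + invmx (Fmat phi t x) *m (invmx (Fmat phi t x))^T
                 *m gradv (fun y => upsL gam ups0 phi t y + Phipot GM0 R0 Om chi (phi t y)) x
           = 0) &
      (forall t x, 0 <= t <= T -> enorm x = R0 ->
         dotv (R0^-1 *: ((Fmat phi t x)^T *m phi t x)) (vL phi dphi t x) = 0)].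

Definition jcont {V : normedModType R} (T1 : R) (A : set vec) (f : R -> vec -> V) :=
  forall t x, 0 <= t <= T1 -> A x -> forall eps : R, 0 < eps ->
    exists delta : R, 0 < delta /\
      forall s y, 0 <= s <= T1 -> A y -> `|s - t| < delta -> `|y - x| < delta ->
        `|f s y - f t x| < eps.

Definition C1tx {V : normedModType R} (T1 : R) (A : set vec) (f ft : R -> vec -> V) :=
  [/\ jcont T1 A f,
      (forall t x, 0 <= t <= T1 -> A x -> has_tder T1 (fun s => f s x) t (ft t x)),
      jcont T1 A ft &
      forall i : 'I_3,
        (forall t x, 0 <= t <= T1 -> A x -> derivable (f t) x (ebasis i)) /\
        jcont T1 A (fun t x => pdv (f t) i x)].

(* classical (Upsilon, v)-solution on [0,T1] x D' where D' has dcover Dc *)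
Definition classical_sol (GM0 R0 Om gam : R) (chi : R -> R) (T1 : R)
    (D' Dc : set vec) (ups : R -> vec -> R) (v : R -> vec -> vec) :=
  exists (U Ut : R -> vec -> R) (V Vt : R -> vec -> vec),
  [/\ (forall t x, 0 <= t <= T1 -> D' x -> U t x = ups t x /\ V t x = v t x),
      C1tx T1 Dc U Ut /\ C1tx T1 Dc V Vt,
      (forall t x, 0 <= t <= T1 -> D' x ->
         Ut t x + dotv (V t x) (gradv (U t) x) + (gam - 1) * U t x * divv (V t) x = 0),
      (forall t x, 0 <= t <= T1 -> D' x ->
         Vt t x + jacv (V t) x *m V t x + Bmat Om *m V t x
           + gradv (fun y => U t y + Phipot GM0 R0 Om chi y) x = 0) &
      (forall t x, 0 <= t <= T1 -> enorm x = R0 -> 0 < U t x /\ dotv x (V t x) = 0)].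

End Defs.

(* Main.v *)
(* A map is strictly differentiable at [p] relative to a set when the remainder
   [f q - f r - L (q - r)] is [o(|q - r|)] as both [q] and [r] tend to [p] in the set.  This
   composes and inverts like differentiability, and when it holds at every point the
   derivative is automatically continuous, so that joint [C^1] regularity in [(t, x)], up to
   the end points of the time interval, never has to be split into partial derivatives.

   For small times [phi t] is a small Lipschitz perturbation of the identity on the convex
   set [O1]; hence [psi t x] is the fixed point of [y |-> x - (phi t y - y)], and [psi] is
   strictly differentiable as an inverse map.  The tangency condition makes [|phi t y|]
   constant in time on the sphere, and near-identity maps that preserve the sphere also
   preserve its inside and its outside.  The two Eulerian equations are then the chain rule
   (with Jacobi's formula for the determinant) applied to [U = Ups^L o psi] and
   [v = dphi o psi].

   The delicate point is the [C^1] extension of [v] into the ball: [dphi] is [C^1] in space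
   everywhere, but the flow equation provides a time derivative outside the ball only.  That
   derivative is [- (v . grad) v - B v - grad (U + Phi)], which is continuous up to the sphere,
   and [v] is extended by a first-order reflection across the sphere. *)
Require Import Defs.
From HB Require Import structures.
From mathcomp Require Import all_boot all_order all_algebra.
From mathcomp Require Import all_classical all_reals all_analysis.
From mathcomp Require Import ring lra.
Import Order.TTheory GRing.Theory Num.Theory.
Import numFieldNormedType.Exports.
Local Open Scope classical_set_scope.
Local Open Scope ring_scope.

Set Implicit Arguments.
Unset Strict Implicit.
Unset Printing Implicit Defensive.

(** * Strict differentiability *)

Section StrictDiff.
Context {R : realType}.
Implicit Types E V W : normedModType R.

(** The regularity at hand is mixed: two space derivatives of [phi], one of [dphi], and a time
    derivative of the velocity on [D] only. So strictness is split into a spatial estimate uniform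
    in time ([space_strict]) and a temporal one uniform in space ([time_strict]). The two may hold
    on different sets and are joined only where both are available. [U] involves one space
    derivative of [phi] and needs no extension. Its equation is an identity along trajectories: the
    spatial part of the derivative of [Ups^L] cancels, and the time part is Jacobi's formula. The
    momentum equation at [x] is the flow equation at [psi t x], which must lie in [D] as soon as [x]
    is outside the ball; hence the care about the sphere. That equation differentiates [vL] in time,
    not [dphi], so the acceleration is recovered from [dphi = F vL] by the product rule. Norms on
    vectors and matrices are maxima of entries. This is the source of the recurring factor [3], and
    of [1 / 48 = 1 / (3 * 16)] and [1 / 144 = 1 / (3 * 48)] in the smallness conditions. *)

Definition bounded_linear E V (L : E -> V) :=
  linear L /\ exists2 C : R, 0 < C & forall u, `|L u| <= C * `|u|.

Definition strict_diff E V (K : set E) (f : E -> V) (p : E) (L : E -> V) :=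
  bounded_linear L /\
  forall eps : R, 0 < eps -> exists2 d : R, 0 < d &
    forall q r, K q -> K r -> `|q - p| < d -> `|r - p| < d ->
      `|f q - f r - L (q - r)| <= eps * `|q - r|.

Lemma common_delta (I : finType) (P : I -> R -> Prop) :
  (forall i d d', d' <= d -> P i d -> P i d') ->
  (forall i, exists2 d, 0 < d & P i d) -> exists2 d, 0 < d & forall i, P i d.
Proof.
move=> mono /(_ _)/cid2-/all_sig2 [d d0 Pd].
(* The seed [1] keeps the minimum positive even over an empty index type. *)
exists (\big[Num.min/1]_i d i) => [|i].
  by elim/big_ind: _ => // x y x0 y0; rewrite lt_min x0 y0.
by apply: mono (Pd i); exact: bigmin_le_cond.
Qed.

Lemma bl_linear E V (L : E -> V) : bounded_linear L -> linear L.
Proof. by case. Qed.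

Section LinearTheory.
Context {E V : normedModType R} (L : E -> V) (lL : linear L).
Let LL : {linear E -> V} := HB.pack L (GRing.isLinear.Build _ _ _ _ _ lL).
Lemma bl0 : L 0 = 0. Proof. exact: (linear0 LL). Qed.
Lemma blD u v : L (u + v) = L u + L v. Proof. exact: (linearD LL). Qed.
Lemma blB u v : L (u - v) = L u - L v. Proof. exact: (linearB LL). Qed.
Lemma blN u : L (- u) = - L u. Proof. exact: (linearN LL). Qed.
Lemma blZ a u : L (a *: u) = a *: L u. Proof. exact: (linearZ_LR LL). Qed.
Lemma bl_sum (I : finType) (F : I -> E) : L (\sum_i F i) = \sum_i L (F i).
Proof. exact: (linear_sum LL). Qed.
End LinearTheory.

Lemma bounded_linear_cst0 E V : bounded_linear (fun _ : E => 0 : V).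
Proof.
split=> [a u v|]; first by rewrite scaler0 addr0.
by exists 1 => // u; rewrite normr0 mul1r.
Qed.

Lemma bounded_linear_id E : bounded_linear (@id E).
Proof. by split=> //; exists 1 => // u; rewrite mul1r. Qed.

Lemma bounded_linearD E V (L M : E -> V) : bounded_linear L -> bounded_linear M ->
  bounded_linear (fun u => L u + M u).
Proof.
move=> [lL [C C0 LC]] [lM [C' C'0 MC]]; split=> [a u v|].
  by rewrite lL lM scalerDr addrACA.
exists (C + C'); first exact: addr_gt0.
by move=> u; rewrite mulrDl (le_trans (ler_normD _ _))// lerD.
Qed.

Lemma bounded_linear_comp E V W (L : E -> V) (M : V -> W) :
  bounded_linear L -> bounded_linear M -> bounded_linear (fun u => M (L u)).
Proof.
move=> [lL [C C0 LC]] [lM [C' C'0 MC]]; split=> [a u v|].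
  by rewrite lL lM.
exists (C' * C); first exact: mulr_gt0.
by move=> u; rewrite (le_trans (MC _))// -mulrA ler_pM2l.
Qed.

Lemma bounded_linearZ E V (c : R) (L : E -> V) : bounded_linear L ->
  bounded_linear (fun u => c *: L u).
Proof.
move=> bL; apply: bounded_linear_comp bL _; split=> [a u v|].
  by rewrite scalerDr !scalerA mulrC.
by exists (`|c| + 1) => [|u]; rewrite ?normrZ ?ler_wpM2r ?lerDl// ltr_pwDr.
Qed.

Lemma bounded_linearZl E V (v : V) (L : E -> R) : bounded_linear L ->
  bounded_linear (fun u => L u *: v).
Proof.
move=> bL; apply: (bounded_linear_comp (M := fun x : R => x *: v)) bL _; split=> [a x y|].
  by rewrite scalerDl scalerA.
exists (`|v| + 1) => [|u]; first by rewrite ltr_pwDr.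
by rewrite normrZ mulrC ler_wpM2r// lerDl.
Qed.

Lemma bounded_linear_mx E m n (L : E -> 'M[R]_(m, n)) :
  (forall i j, bounded_linear (fun u => L u i j)) -> bounded_linear L.
Proof.
move=> bL; split=> [a u v|].
  by apply/matrixP => i j; rewrite !mxE; case: (bL i j) => ->.
have /(_ _)/cid2-/all_sig2[C C0 LC] : forall ij : 'I_m * 'I_n, exists2 C : R, 0 < C &
    forall u, `|L u ij.1 ij.2| <= C * `|u| by case=> i j; have [_] := bL i j.
exists (1 + \sum_ij C ij) => [|u].
  by rewrite ltr_pwDl// sumr_ge0// => i _; exact: ltW.
rewrite [leLHS]mx_normrE; apply: bigmax_le => [|ij _].
  by rewrite mulr_ge0// addr_ge0// sumr_ge0// => i _; exact: ltW.
rewrite (le_trans (LC _ _))// ler_wpM2r// (bigD1 ij)//= addrCA lerDl.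
by rewrite addr_ge0// sumr_ge0// => i _; exact: ltW.
Qed.

Lemma strict_diff_bl E V K f p L : @strict_diff E V K f p L -> bounded_linear L.
Proof. by case. Qed.

(** Using the hypothesis at [min (eps / C) (1 / 2)] absorbs any fixed factor [C]. Error terms in
    sums, products and compositions thus need no balancing, and [eps < 1] is available for quadratic
    ones. *)
Lemma strict_diffW E V K f p (L : E -> V) (C : R) : bounded_linear L -> 0 < C ->
  (forall eps : R, 0 < eps -> eps < 1 -> exists2 d : R, 0 < d &
    forall q r, K q -> K r -> `|q - p| < d -> `|r - p| < d ->
      `|f q - f r - L (q - r)| <= C * eps * `|q - r|) -> strict_diff K f p L.
Proof.
move=> bL C0 H; split=> // eps e0.
pose e := Num.min (eps / C) (1 / 2).
have e'0 : 0 < e by rewrite lt_min divr_gt0//= divr_gt0.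
have e1 : e < 1 by rewrite gt_min; apply/orP; right; lra.
have [d d0 Hd] := H e e'0 e1.
exists d => // q r Kq Kr qp rp; apply: (le_trans (Hd q r Kq Kr qp rp)).
by rewrite ler_wpM2r// mulrC -ler_pdivlMr// ge_min lexx.
Qed.

(** The remainder at [eps = 1] plus the bound on [L]. As both points are free, this is a genuine
    local Lipschitz bound, which chain rule and inverse map rely on. *)
Lemma strict_diff_lip E V K (f : E -> V) p L : strict_diff K f p L ->
  exists C d : R, [/\ 0 < C, 0 < d &
    forall q r, K q -> K r -> `|q - p| < d -> `|r - p| < d ->
      `|f q - f r| <= C * `|q - r|].
Proof.
move=> [[lL [C C0 LC]] /(_ 1 ltr01) [d d0 H]].
exists (1 + C), d; split=> //; first exact: addr_gt0.
move=> q r Kq Kr qp rp.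
rewrite -[f q - f r](subrK (L (q - r))) mulrDl (le_trans (ler_normD _ _))// lerD//.
exact: H.
Qed.

(** Only what happens near [p] matters, so one rule covers restricting the set, changing it away
    from [p], and replacing the function by one that agrees with it locally. *)
Lemma strict_diff_near E V K K' (f g : E -> V) p L :
  strict_diff K f p L -> K' p ->
  (exists2 d : R, 0 < d & forall q, K' q -> `|q - p| < d -> K q /\ g q = f q) ->
  strict_diff K' g p L.
Proof.
move=> [bL H] K'p [d d0 fg]; split=> // e /H[d' d'0 {}H].
exists (Num.min d d'); first by rewrite lt_min d0.
move=> q r Kq Kr; rewrite !lt_min => /andP[qd qd'] /andP[rd rd'].
have [Kq' ->] := fg q Kq qd; have [Kr' ->] := fg r Kr rd.
exact: H.
Qed.

Lemma strict_diff_eqL E V K (f : E -> V) p L L' :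
  strict_diff K f p L -> L =1 L' -> strict_diff K f p L'.
Proof. by move=> H /funext <-. Qed.

Lemma strict_diff_lin E V K p (L : E -> V) : bounded_linear L -> strict_diff K L p L.
Proof.
move=> bL; split=> // e e0; exists 1 => // q r _ _ _ _.
by rewrite (blB (proj1 bL)) subrr normr0 mulr_ge0// ltW.
Qed.

Lemma strict_diff_cst E V K p (v : V) : strict_diff K (fun _ : E => v) p (fun=> 0).
Proof.
split=> [|e e0]; first exact: bounded_linear_cst0.
by exists 1 => // q r _ _ _ _; rewrite subrr subr0 normr0 mulr_ge0// ltW.
Qed.

Lemma strict_diffD E V K (f g : E -> V) p L M :
  strict_diff K f p L -> strict_diff K g p M ->
  strict_diff K (fun q => f q + g q) p (fun u => L u + M u).
Proof.
move=> [bL fL] [bM gM]; apply: (@strict_diffW _ _ _ _ _ _ 2) => //.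
  exact: bounded_linearD.
move=> e e0 _; have [d d0 fd] := fL e e0; have [d' d'0 gd] := gM e e0.
exists (Num.min d d'); first by rewrite lt_min d0.
move=> q r Kq Kr; rewrite !lt_min => /andP[qd qd'] /andP[rd rd'].
have -> : f q + g q - (f r + g r) - (L (q - r) + M (q - r)) =
  (f q - f r - L (q - r)) + (g q - g r - M (q - r)).
  by rewrite !opprD (addrACA (f q)) (addrACA (f q - f r)).
rewrite (le_trans (ler_normD _ _))// -mulrA mulr_natl mulr2n.
by apply: lerD; [exact: fd|exact: gd].
Qed.

Lemma strict_diff_comp E V W K K' (f : E -> V) (g : V -> W) p L M :
  strict_diff K f p L -> strict_diff K' g (f p) M -> K p ->
  (exists2 d : R, 0 < d & forall q, K q -> `|q - p| < d -> K' (f q)) ->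
  strict_diff K (fun q => g (f q)) p (fun u => M (L u)).
Proof.
move=> fL [bM gM] Kp [d1 d10 Kf]; have bL := strict_diff_bl fL.
have [C [d2 [C0 d20 fC]]] := strict_diff_lip fL.
have [lM [C' C'0 MC]] := bM.
apply: (@strict_diffW _ _ _ _ _ _ (C + C')).
- exact: bounded_linear_comp.
- exact: addr_gt0.
move=> e e0 _; have [d3 d30 fd] := fL.2 e e0; have [d4 d40 gd] := gM e e0.
exists (Num.min (Num.min d1 d2) (Num.min d3 (d4 / C))).
  by rewrite !lt_min d10 d20 d30 divr_gt0.
move=> q r Kq Kr; rewrite !lt_min => /andP[/andP[q1 q2] /andP[q3 q4]].
move=> /andP[/andP[r1 r2] /andP[r3 r4]].
have pp : `|p - p| < d2 by rewrite subrr normr0.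
have H1 := gd (f q) (f r) (Kf q Kq q1) (Kf r Kr r1).
have -> : g (f q) - g (f r) - M (L (q - r)) =
  (g (f q) - g (f r) - M (f q - f r)) + M (f q - f r - L (q - r)).
  by rewrite (blB lM (f q - f r)) addrA subrK.
rewrite (le_trans (ler_normD _ _))// mulrDl mulrDl lerD//.
  rewrite (le_trans (H1 _ _))//.
  - by rewrite (le_lt_trans (fC _ _ Kq Kp q2 pp))// mulrC -ltr_pdivlMr.
  - by rewrite (le_lt_trans (fC _ _ Kr Kp r2 pp))// mulrC -ltr_pdivlMr.
  by rewrite mulrAC [leRHS]mulrC ler_pM2l// fC.
by rewrite (le_trans (MC _))// -mulrA ler_pM2l// fd.
Qed.

Lemma strict_diffM E K (f g : E -> R) p L M : K p ->
  strict_diff K f p L -> strict_diff K g p M ->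
  strict_diff K (fun q => f q * g q) p (fun u => f p * M u + L u * g p).
Proof.
move=> Kp fL gM; have bL := strict_diff_bl fL; have bM := strict_diff_bl gM.
have [Cf [d1 [Cf0 d10 fC]]] := strict_diff_lip fL.
have [Cg [d2 [Cg0 d20 gC]]] := strict_diff_lip gM.
have [lL [CL CL0 LC]] := bL; have [lM [CM CM0 MC]] := bM.
pose C := (`|f p| + 1) + CM + (`|g p| + 1) + CL.
have C0 : 0 < C.
  have := normr_ge0 (f p); have := normr_ge0 (g p); rewrite /C; lra.
apply: (@strict_diffW _ _ _ _ _ _ C) => //.
  by apply: bounded_linearD; [exact: (bounded_linearZ (f p) bM)|exact: (bounded_linearZl (g p) bL)].
move=> e e0 e1; have [d3 d30 fd] := fL.2 e e0; have [d4 d40 gd] := gM.2 e e0.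
exists (Num.min (Num.min (Num.min d1 d2) (Num.min d3 d4)) (Num.min (e / Cf) (e / Cg))).
  by rewrite !lt_min d10 d20 d30 d40 !divr_gt0.
move=> q r Kq Kr.
rewrite !lt_min => /andP[/andP[/andP[q1 q2] /andP[q3 q4]] /andP[q5 q6]].
move=> /andP[/andP[/andP[r1 r2] /andP[r3 r4]] /andP[r5 r6]].
have pp1 : `|p - p| < d1 by rewrite subrr normr0.
have pp2 : `|p - p| < d2 by rewrite subrr normr0.
have fqp : `|f q - f p| <= e.
  by rewrite (le_trans (fC _ _ Kq Kp q1 pp1))// mulrC -ler_pdivlMr// ltW.
have grp : `|g r - g p| <= e.
  by rewrite (le_trans (gC _ _ Kr Kp r2 pp2))// mulrC -ler_pdivlMr// ltW.
have fq : `|f q| <= `|f p| + 1.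
  rewrite -[f q](subrK (f p)) (le_trans (ler_normD _ _))// addrC lerD2l.
  exact: le_trans fqp (ltW e1).
have gr : `|g r| <= `|g p| + 1.
  rewrite -[g r](subrK (g p)) (le_trans (ler_normD _ _))// addrC lerD2l.
  exact: le_trans grp (ltW e1).
(* One factor is evaluated at [q] and the other at [r]. Comparing each with its value at [p] gives
   four terms, each with a factor at most [e] or a remainder. *)
have -> : f q * g q - f r * g r - (f p * M (q - r) + L (q - r) * g p) =
  f q * (g q - g r - M (q - r)) + (f q - f p) * M (q - r) +
  (f q - f r - L (q - r)) * g r + L (q - r) * (g r - g p) by ring.
have : `|f q * (g q - g r - M (q - r))| <= (`|f p| + 1) * (e * `|q - r|).
  by rewrite normrM ler_pM//; exact: gd.
have : `|(f q - f p) * M (q - r)| <= e * (CM * `|q - r|).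
  by rewrite normrM ler_pM.
have : `|(f q - f r - L (q - r)) * g r| <= (e * `|q - r|) * (`|g p| + 1).
  by rewrite normrM ler_pM//; exact: fd.
have : `|L (q - r) * (g r - g p)| <= (CL * `|q - r|) * e.
  by rewrite normrM ler_pM.
move=> h1 h2 h3 h4.
apply: (@le_trans _ _ ((`|f p| + 1) * (e * `|q - r|) + e * (CM * `|q - r|) +
  (e * `|q - r|) * (`|g p| + 1) + (CL * `|q - r|) * e)); last by rewrite /C; nra.
by do 3![rewrite (le_trans (ler_normD _ _))// lerD//].
Qed.

Lemma strict_diff_mx E K m n (f : E -> 'M[R]_(m, n)) p (L : E -> 'M[R]_(m, n)) :
  (forall i j, strict_diff K (fun q => f q i j) p (fun u => L u i j)) ->
  strict_diff K f p L.
Proof.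
move=> H; split=> [|e e0]; first by apply: bounded_linear_mx => i j; case: (H i j).
have [|ij|d d0 Hd] := @common_delta ('I_m * 'I_n)%type (fun ij d =>
    forall q r, K q -> K r -> `|q - p| < d -> `|r - p| < d ->
      `|f q ij.1 ij.2 - f r ij.1 ij.2 - L (q - r) ij.1 ij.2| <= e * `|q - r|).
- move=> ij d d' dd' Hd q r Kq Kr qd rd.
  by apply: Hd => //; [exact: lt_le_trans qd _|exact: lt_le_trans rd _].
- by have [_ /(_ e e0)] := H ij.1 ij.2.
exists d => // q r Kq Kr qd rd; rewrite [leLHS]mx_normrE.
apply: bigmax_le => [|ij _]; first by rewrite mulr_ge0// ltW.
by rewrite !mxE; exact: Hd.
Qed.

End StrictDiff.

(** * Mean value inequalities in space and time *)

Section MeanValue.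
Context {R : realType}.
Local Notation vec := (vec R).

Lemma coord_le_norm (u : vec) i : `|u i 0| <= `|u|.
Proof.
rewrite [leRHS]mx_normrE.
by apply: le_trans (le_bigmax _ (fun ij : 'I_3 * 'I_1 => `|u ij.1 ij.2|) (i, 0)).
Qed.

Lemma norm_le_coord (u : vec) (c : R) : 0 <= c -> (forall i, `|u i 0| <= c) -> `|u| <= c.
Proof.
move=> c0 H; rewrite [leLHS]mx_normrE; apply: bigmax_le => // -[i j] _ /=.
by rewrite (ord1 j).
Qed.

Lemma vec_ebasis (u : vec) : u = \sum_i u i 0 *: ebasis R i.
Proof.
apply/matrixP => k j; rewrite (ord1 j) summxE (bigD1 k)//= big1 => [|i ik].
  by rewrite !mxE !eqxx mulr1 addr0.
by rewrite !mxE eq_sym (negbTE ik) mulr0.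
Qed.

(** Scalar values are essential because the intermediate point depends on the function;
    vector-valued maps are handled entry by entry. *)
Lemma mvt_line (f : vec -> R) (y z : vec) :
  (forall s : R, 0 <= s <= 1 -> differentiable f (z + s *: (y - z))) ->
  exists2 s : R, 0 <= s <= 1 &
    f y - f z = \sum_i (y - z) i 0 * pdv f i (z + s *: (y - z)).
Proof.
move=> df.
pose g (s : R) := f (z + s *: (y - z)).
pose w (s : R) := z + s *: (y - z).
have dg (s : R) : 0 <= s <= 1 -> is_derive s 1 g ('d f (w s) (y - z)).
  move=> s01.
  have difw : is_diff s w (0 + ( *:%R^~ (y - z))).
    by apply: (is_diffD (f := cst z) (g := fun s : R => s *: (y - z))).
  have difg : differentiable (f \o w) s by apply: differentiable_comp => //; exact: df.
  split; first exact/derivable1_diffP.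
  rewrite deriveE// diff_comp//; last exact: df.
  by rewrite /= diff_val/= !fctE add0r scale1r.
have cg : {within `[0, 1], continuous g}.
  apply: derivable_within_continuous => s; rewrite in_itv/= => s01.
  by case: (dg s s01).
have [s s01] : exists2 s, s \in `]0, 1[%R & g 1 - g 0 = 'd f (w s) (y - z) * (1 - 0).
  apply: MVT => // s; rewrite in_itv/= => /andP[s0 s1].
  by apply: dg; rewrite !ltW.
rewrite subr0 mulr1 /g scale1r scale0r addr0 [z + (y - z)]addrC subrK => E.
have s01' : 0 <= s <= 1 by move: s01; rewrite in_itv/= => /andP[s0 s1]; rewrite !ltW.
exists s => //.
rewrite E {1}(vec_ebasis (y - z)) linear_sum/=.
apply: eq_bigr => i _; rewrite linearZ/= /pdv deriveE//; exact: df.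
Qed.

Lemma strict_diff_real (f df : R -> R) (p : R) :
  (exists2 d : R, 0 < d & forall x, `|x - p| < d -> is_derive x 1 f (df x)) ->
  {for p, continuous df} -> strict_diff setT f p (fun u => df p * u).
Proof.
move=> [d d0 H] cdf; split.
  exact: (bounded_linearZ (df p) (bounded_linear_id _)).
move=> e e0.
have /nbhs_normP[d' /= d'0 Hd'] := cdf _ (nbhsx_ballx (df p) e e0).
exists (Num.min d d'); first by rewrite lt_min d0.
have main q r : q <= r -> `|q - p| < Num.min d d' -> `|r - p| < Num.min d d' ->
   `|f r - f q - df p * (r - q)| <= e * `|r - q|.
  rewrite !lt_min => qr /andP[q1 q2] /andP[r1 r2].
  have near x : x \in `[q, r]%R -> `|x - p| < d /\ `|x - p| < d'.
    rewrite in_itv/= => /andP[qx xr]; move: q1 q2 r1 r2; rewrite !ltr_norml.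
    by move=> /andP[? ?] /andP[? ?] /andP[? ?] /andP[? ?]; split; apply/andP; split; lra.
  have [x xqr ->] : exists2 x, x \in `[q, r]%R & f r - f q = df x * (r - q).
    apply: MVT_segment => // [x xqr|].
      by apply: H; case: (near x) => //; move: xqr; exact: subset_itv_oo_cc.
    apply: derivable_within_continuous => x xqr.
    by have [/H[]] := near _ xqr.
  rewrite -mulrBl normrM ler_wpM2r//.
  have [_ xd'] := near _ xqr.
  have := Hd' x; rewrite /= distrC => /(_ xd').
  by rewrite /ball/= distrC => /ltW.
move=> q r _ _ qp rp; have [qr|/ltW rq] := leP q r; last exact: main.
have -> : f q - f r - df p * (q - r) = - (f r - f q - df p * (r - q)) by ring.
by rewrite normrN [`|q - r|]distrC; exact: main.
Qed.

End MeanValue.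

(** * Strict estimates in time, in space and on space-time slabs *)

Section SpaceTime.
Context {R : realType}.
Local Notation vec := (vec R).

Definition slab (T : R) (A : set vec) : set (R * vec) :=
  [set p | 0 <= p.1 <= T /\ A p.2].

Lemma prod_norm_lt (V W : normedModType R) (p : V * W) (d : R) :
  (`|p| < d) = (`|p.1| < d) && (`|p.2| < d).
Proof. by rewrite prod_normE gt_max. Qed.

Lemma fst_le_norm (V W : normedModType R) (p : V * W) : `|p.1| <= `|p|.
Proof. by rewrite prod_normE le_max lexx. Qed.

Lemma snd_le_norm (V W : normedModType R) (p : V * W) : `|p.2| <= `|p|.
Proof. by rewrite prod_normE le_max lexx orbT. Qed.

Lemma bounded_linear_fst (V W : normedModType R) : bounded_linear (fst : V * W -> V).
Proof. by split=> //; exists 1 => // u; rewrite mul1r fst_le_norm. Qed.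

Lemma bounded_linear_snd (V W : normedModType R) : bounded_linear (snd : V * W -> W).
Proof. by split=> //; exists 1 => // u; rewrite mul1r snd_le_norm. Qed.

Lemma bounded_linear_coord m n (i : 'I_m) (j : 'I_n) : bounded_linear (fun u : 'M[R]_(m, n) => u i j).
Proof.
split=> [a u v|]; first by rewrite !mxE.
exists 1 => // u; rewrite mul1r [leRHS]mx_normrE.
by apply: le_trans (le_bigmax _ (fun ij : 'I_m * 'I_n => `|u ij.1 ij.2|) (i, j)).
Qed.

Lemma bounded_linear_sum3 (E V : normedModType R) (L : 'I_3 -> E -> V) :
  (forall i, bounded_linear (L i)) -> bounded_linear (fun u => \sum_i L i u).
Proof.
move=> bL; rewrite (_ : (fun u => _) = fun u => L 0 u + (L 1 u + L 2%:R u)).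
  by do 2![apply: bounded_linearD => //].
by apply/funext => u; rewrite !big_ord_recl big_ord0 addr0; do 2?congr (_ + _);
  congr (L _ u); apply/val_inj.
Qed.

(** Strictness along time lines only: the space point [z] is the same at both times but is free near
    [x]. This uniformity lets it be added to [space_strict] to give joint strictness. *)
Definition time_strict {V : normedModType R} (T : R) (A : set vec) (f : R -> vec -> V)
    (t : R) (x : vec) (a : V) :=
  forall eps : R, 0 < eps -> exists2 d : R, 0 < d &
    forall (s s' : R) z, 0 <= s <= T -> 0 <= s' <= T -> A z ->
      `|s - t| < d -> `|s' - t| < d -> `|z - x| < d ->
      `|f s z - f s' z - (s - s') *: a| <= eps * `|s - s'|.

Definition space_strict {V : normedModType R} (T : R) (A : set vec) (f : R -> vec -> V)
    (t : R) (x : vec) (L : vec -> V) :=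
  bounded_linear L /\
  forall eps : R, 0 < eps -> exists2 d : R, 0 < d &
    forall (s : R) y z, 0 <= s <= T -> A y -> A z ->
      `|s - t| < d -> `|y - x| < d -> `|z - x| < d ->
      `|f s y - f s z - L (y - z)| <= eps * `|y - z|.

Lemma open_ball_sub (A : set vec) x : open A -> A x ->
  exists2 d : R, 0 < d & forall y, `|y - x| < d -> A y.
Proof.
move=> oA Ax; have /nbhs_normP[d /= d0 H] : nbhs x A by exact: open_nbhs_nbhs.
by exists d => // y yx; apply: H; rewrite /= distrC.
Qed.

Lemma line_near (x y z : vec) (d s : R) : 0 <= s <= 1 -> `|y - x| < d -> `|z - x| < d ->
  `|z + s *: (y - z) - x| < d.
Proof.
move=> /andP[s0 s1] yd zd.
have -> : z + s *: (y - z) - x = (1 - s) *: (z - x) + s *: (y - x).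
  by apply/matrixP => i j; rewrite !mxE; ring.
rewrite (le_lt_trans (ler_normD _ _))// !normrZ ger0_norm ?subr_ge0// (ger0_norm s0).
have [->|sn0] := eqVneq s 0; first by rewrite subr0 mul0r addr0 mul1r.
have s_gt0 : 0 < s by rewrite lt_def sn0.
have : (1 - s) * `|z - x| <= (1 - s) * d by rewrite ler_wpM2l// ?subr_ge0// ltW.
have : s * `|y - x| < s * d by rewrite ltr_pM2l.
by lra.
Qed.

(** Balls are convex, so the mean value point on the segment stays near [x], where each partial
    derivative differs little from its value at [(t, x)]. Three partials share the tolerance, whence
    [e' / 3]. *)
Lemma space_strict_C1 T (A : set vec) (f : R -> vec -> R) t x :
  open A -> 0 <= t <= T -> A x ->
  (forall s y, 0 <= s <= T -> A y -> differentiable (f s) y) ->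
  (forall i, jcont T A (fun s y => pdv (f s) i y)) ->
  space_strict T A f t x (fun u => \sum_i u i 0 * pdv (f t) i x).
Proof.
move=> oA tT Ax df cf; split.
  apply: bounded_linear_sum3 => i.
  exact: (bounded_linearZl (pdv (f t) i x) (bounded_linear_coord i 0)).
move=> e' e'0; pose e := e' / 3; have e0 : 0 < e by rewrite divr_gt0.
have [d2 d20 Hd2] := open_ball_sub oA Ax.
have [|i|d3 d30 Hd3] := @common_delta _ 'I_3 (fun i d => forall s y,
    0 <= s <= T -> A y -> `|s - t| < d -> `|y - x| < d ->
    `|pdv (f s) i y - pdv (f t) i x| < e).
- move=> i d d' dd' H s y sT Ay sd yd.
  by apply: H => //; [exact: lt_le_trans sd _|exact: lt_le_trans yd _].
- by have [d [d0 Hd]] := cf i t x tT Ax e e0; exists d.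
exists (Num.min d2 d3); first by rewrite !lt_min d20.
move=> s y z sT Ay Az; rewrite !lt_min.
move=> /andP[s2 s3] /andP[y2 y3] /andP[z2 z3].
have [r r01|r r01 ->] := @mvt_line _ (f s) y z.
  by apply: df => //; apply: Hd2; exact: line_near.
pose w := z + r *: (y - z).
have ww : `|w - x| < d3 by exact: line_near.
have Aw : A w by apply: Hd2; exact: line_near.
rewrite -sumrB (le_trans (ler_norm_sum _ _ _))//.
have -> : e' * `|y - z| = \sum_(i < 3) (e * `|y - z|).
  by rewrite sumr_const card_ord -mulr_natl /e; field.
apply: ler_sum => i _; rewrite -mulrBr normrM mulrC ler_pM//.
  exact/ltW/Hd3.
exact: coord_le_norm.
Qed.

(* Time increments need only be controlled on [A'], the intermediate point of the
   comparison of [f s y] with [f s' z] being [(s, z)]. *)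
Lemma strict_diff_space_time (V : normedModType R) T (A A' : set vec) (f : R -> vec -> V)
    t x a L :
  A' `<=` A -> space_strict T A f t x L -> time_strict T A' f t x a ->
  strict_diff (slab T A') (fun p => f p.1 p.2) (t, x) (fun u => u.1 *: a + L u.2).
Proof.
move=> A'A [bL fL] ft.
apply: (@strict_diffW _ _ _ _ _ _ _ 2) => //.
  apply: bounded_linearD; first exact/bounded_linearZl/bounded_linear_fst.
  exact: (bounded_linear_comp (bounded_linear_snd _ _) bL).
move=> e e0 _; have [d1 d10 Hd1] := ft e e0; have [d2 d20 Hd2] := fL e e0.
exists (Num.min d1 d2); first by rewrite lt_min d10.
move=> [s y] [s' z] [/= sT Ay] [/= s'T Az]; rewrite !prod_norm_lt/= !lt_min.
move=> /andP[/andP[s1 s2] /andP[y1 y2]] /andP[/andP[s'1 s'2] /andP[z1 z2]].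
have -> : f s y - f s' z - ((s - s') *: a + L (y - z)) =
   (f s z - f s' z - (s - s') *: a) + (f s y - f s z - L (y - z)).
  rewrite (addrC (_ - _ - _)) !opprD -[RHS]addrACA; congr (_ + _).
    by rewrite [RHS]addrA subrK.
  exact: addrC.
rewrite (le_trans (ler_normD _ _))// -mulrA mulr_natl mulr2n lerD//.
  rewrite (le_trans (Hd1 _ _ _ _ _ _ _ _ _))// ler_pM2l//.
  exact: (fst_le_norm ((s, y) - (s', z))).
rewrite (le_trans (Hd2 _ _ _ _ _ _ _ _ _))//; [exact: A'A..|].
rewrite ler_pM2l//; exact: (snd_le_norm ((s, y) - (s', z))).
Qed.

Lemma space_strict_slab (V : normedModType R) T (A : set vec) (f : R * vec -> V) t x L :
  strict_diff (slab T A) f (t, x) L ->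
  space_strict T A (fun s y => f (s, y)) t x (fun u => L (0, u)).
Proof.
move=> [bL H]; split.
  split=> [a u v|].
    by rewrite -(bl_linear bL) /=; congr (L _); apply/pair_equal_spec; rewrite /= scaler0 addr0.
  have [_ [C C0 LC]] := bL; exists C => // u; rewrite (le_trans (LC _))// ler_pM2l//.
  by rewrite prod_normE/= normr0 ge_max lexx normr_ge0.
move=> e /H[d d0 {}H]; exists d => // s y z sT Ay Az sd yd zd.
have := H (s, y) (s, z); rewrite !prod_norm_lt/= sd yd zd => /(_ _ _ isT isT).
have -> : (s, y) - (s, z) = (0, y - z) by rewrite -(subrr s).
rewrite prod_normE/= normr0 (max_idPr (normr_ge0 _)); exact.
Qed.

Lemma time_strict_slab (V : normedModType R) T (A : set vec) (f : R * vec -> V) t x L :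
  strict_diff (slab T A) f (t, x) L ->
  time_strict T A (fun s y => f (s, y)) t x (L (1, 0)).
Proof.
move=> [bL H] e /H[d d0 {}H]; exists d => // s s' z sT s'T Az sd s'd zd.
have := H (s, z) (s', z); rewrite !prod_norm_lt/= sd s'd zd => /(_ _ _ isT isT).
have -> : (s, z) - (s', z) = (s - s') *: (1, 0).
  by apply/pair_equal_spec; rewrite /= subrr scaler0 /GRing.scale/= mulr1.
rewrite (blZ (proj1 bL)) normrZ prod_normE/= normr0 normr1 (max_idPl ler01) mulr1; exact.
Qed.

Lemma is_derive_eps (V W : normedModType R) (f : V -> W) x v d :
  (forall e : R, 0 < e -> exists2 dl : R, 0 < dl & forall h : R, h != 0 -> `|h| < dl ->
     `|h^-1 *: (f (h *: v + x) - f x) - d| <= e) ->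
  is_derive x v f d.
Proof.
move=> H.
have cv : (fun h : R => h^-1 *: ((f \o shift x) (h *: v) - f x)) @ 0^' --> d.
  apply/cvgrPdist_le => e /H[dl dl0 Hdl].
  near=> h; rewrite distrC; apply: Hdl; first by near: h; exact: nbhs_dnbhs_neq.
  near: h; apply: dnbhs0_lt; exact: dl0.
split; first by apply/cvg_ex; exists d.
exact/cvg_lim.
Unshelve. all: by end_near. Qed.

Lemma has_tder_is_derive T (g : R -> R) s d : 0 < s < T -> has_tder T g s d -> is_derive s 1 g d.
Proof.
move=> /andP[s0 sT] H; apply: is_derive_eps => e /H[dl [dl0 Hdl]].
exists (Num.min dl (Num.min s (T - s))); first by rewrite !lt_min dl0 s0 subr_gt0.
move=> h h0; rewrite !lt_min => /and3P[h1 h2 h3].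
have := Hdl (h *: 1 + s); rewrite /GRing.scale/= mulr1 addrK; apply => //.
  move: h2 h3; rewrite !ltr_norml => /andP[? ?] /andP[? ?]; apply/andP; split; lra.
by rewrite -subr_eq0 addrK.
Qed.

Lemma has_tder_lip (V : normedModType R) T (g : R -> V) s d : has_tder T g s d ->
  exists2 dl : R, 0 < dl & forall r, 0 <= r <= T -> `|r - s| < dl ->
    `|g r - g s| <= (`|d| + 1) * `|r - s|.
Proof.
move=> /(_ 1 ltr01)[dl [dl0 H]]; exists dl => // r rT rs.
have [->|rns] := eqVneq r s; first by rewrite !subrr !normr0 mulr0.
have rs0 : 0 < `|r - s| by rewrite normr_gt0 subr_eq0.
have := H r rT rns rs => /(le_trans (lerB_dist _ _)).
rewrite lerBlDl normrZ normfV mulrC ler_pdivrMr//; lra.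
Qed.

(** At the ends of [[0, T]] the derivative [has_tder] is one-sided. The mean value theorem wants
    ordinary derivatives at interior times only; at the ends it wants continuity, which the local
    Lipschitz bound supplies. *)
Lemma has_tder_mvt T (g dg : R -> R) s s' :
  (forall r, 0 <= r <= T -> has_tder T g r (dg r)) ->
  0 <= s' -> s' <= s -> s <= T ->
  exists2 c, s' <= c <= s & g s - g s' = dg c * (s - s').
Proof.
move=> H s'0 ss' sT.
have [c] : exists2 c, c \in `[s', s]%R & g s - g s' = dg c * (s - s').
  apply: MVT_segment => // [r|].
    rewrite in_itv/= => /andP[r1 r2].
    by apply: (has_tder_is_derive (T := T)); [lra|apply: H; lra].
  apply/subspace_continuousP => r; rewrite /= in_itv/= => /andP[r1 r2].
  have [dl dl0 Hdl] : exists2 dl : R, 0 < dl & forall r', 0 <= r' <= T ->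
      `|r' - r| < dl -> `|g r' - g r| <= (`|dg r| + 1) * `|r' - r|.
    by apply: has_tder_lip; apply: H; lra.
  apply/cvgrPdist_le => e e0; rewrite near_withinE; near=> r'.
  move=> /= /itvP r'I; have r'1 : s' <= r' by rewrite r'I.
  have r'2 : r' <= s by rewrite r'I.
  have C0 : 0 < `|dg r| + 1 by rewrite ltr_wpDl.
  have h1 : `|r' - r| < dl.
    by rewrite distrC; near: r'; apply: cvgr_dist_lt.
  have h2 : `|r' - r| < e / (`|dg r| + 1).
    by rewrite distrC; near: r'; apply: cvgr_dist_lt => //; rewrite divr_gt0.
  rewrite distrC (le_trans (Hdl _ _ h1))//; first lra.
  by rewrite mulrC -ler_pdivlMr// ltW.
by rewrite in_itv/= => c1 c2; exists c.
Unshelve. all: by end_near. Qed.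

End SpaceTime.

(** * From strict estimates to continuous derivatives; inverse maps *)

Section Derivatives.
Context {R : realType}.
Local Notation vec := (vec R).
Implicit Types V W : normedModType R.

Lemma has_tderP V T (f : R -> V) t d :
  has_tder T f t d <->
  forall e : R, 0 < e -> exists2 dl : R, 0 < dl &
    forall s, 0 <= s <= T -> `|s - t| < dl -> `|f s - f t - (s - t) *: d| <= e * `|s - t|.
Proof.
have E (s : R) : s != t -> (s - t) *: ((s - t)^-1 *: (f s - f t) - d) = f s - f t - (s - t) *: d.
  by move=> st; rewrite scalerBr scalerA divff ?subr_eq0// scale1r.
split=> H e /H.
  move=> [dl [dl0 Hdl]]; exists dl => // s sT st.
  have [->|nst] := eqVneq s t; first by rewrite !subrr scale0r subrr !normr0 mulr0.
  by rewrite -E// normrZ mulrC ler_wpM2r// Hdl.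
move=> [dl dl0 Hdl]; exists dl; split=> // s sT nst st.
have := Hdl s sT st; rewrite -E// normrZ mulrC ler_pM2r//.
by rewrite normr_gt0 subr_eq0.
Qed.

Lemma time_strict_has_tder V T (A : set vec) (f : R -> vec -> V) t x a : 0 <= t <= T -> A x ->
  time_strict T A f t x a -> has_tder T (fun s => f s x) t a.
Proof.
move=> tT Ax H; apply/has_tderP => e /H[d d0 {}H]; exists d => // s sT st.
by apply: H => //; rewrite subrr normr0.
Qed.

Lemma space_strict_is_derive V T (A : set vec) (f : R -> vec -> V) t x L v : open A ->
  0 <= t <= T -> A x -> space_strict T A f t x L -> is_derive x v (f t) (L v).
Proof.
move=> oA tT Ax [[lL [C C0 LC]] H]; apply: is_derive_eps => e e0.
have v0 : 0 < `|v| + 1 by rewrite ltr_wpDl.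
have [d1 d10 H1] := H (e / (`|v| + 1)) (divr_gt0 e0 v0).
have [d2 d20 H2] := open_ball_sub oA Ax.
exists (Num.min d1 d2 / (`|v| + 1)); first by rewrite divr_gt0// lt_min d10.
move=> h h0; rewrite ltr_pdivlMr// => hd.
have hv : `|h *: v + x - x| < Num.min d1 d2.
  rewrite addrK normrZ (le_lt_trans _ hd)// ler_wpM2l// lerDl//.
move: hv; rewrite lt_min => /andP[hv1 hv2].
have := H1 t (h *: v + x) x tT (H2 _ hv2) Ax; rewrite !subrr !normr0 => /(_ d10 hv1 d10).
rewrite addrK (blZ lL) => H3.
have -> : h^-1 *: (f t (h *: v + x) - f t x) - L v =
    h^-1 *: (f t (h *: v + x) - f t x - h *: L v).
  by rewrite [RHS]scalerBr scalerA mulVf// scale1r.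
rewrite normrZ normfV ler_pdivrMl ?normr_gt0// (le_trans H3)// normrZ.
rewrite mulrCA ler_wpM2l// mulrAC ler_pdivrMr// ler_pM2l// lerDl//.
Qed.

Lemma space_strict_pdv V T (A : set vec) (f : R -> vec -> V) t x L i : open A ->
  0 <= t <= T -> A x -> space_strict T A f t x L -> pdv (f t) i x = L (ebasis R i).
Proof.
by move=> oA tT Ax H; have [_ E] := space_strict_is_derive (ebasis R i) oA tT Ax H.
Qed.

(** The single increment [f s (y + h *: u) - f s y] is approximated both by the derivative at
    [(t, x)] and by the one at [(s, y)], so the two are close on [u]. The step [h] may depend on
    [(s, y)] because it divides out. *)
Lemma space_strict_derive_cont V T (A : set vec) (f : R -> vec -> V) (L : R -> vec -> vec -> V) :
  open A -> (forall s y, 0 <= s <= T -> A y -> space_strict T A f s y (L s y)) ->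
  forall u, jcont T A (fun s y => L s y u).
Proof.
move=> oA H u t x tT Ax e e0.
have u0 : 0 < `|u| + 1 by rewrite ltr_wpDl.
pose e1 := e / (2 * (`|u| + 1)).
have e10 : 0 < e1 by rewrite divr_gt0// mulr_gt0.
have [bL /(_ e1 e10)[d d0 Hd]] := H t x tT Ax.
exists d; split=> // s y sT Ay st yx.
have [bL' /(_ e1 e10)[d' d'0 Hd']] := H s y sT Ay.
have [dA dA0 HA] := open_ball_sub oA Ay.
(* The displaced point must stay in the ball of the estimate at [(s, y)], in [A], and in the ball of
   the estimate at [(t, x)], in this order. *)
pose m := Num.min d' (Num.min dA (d - `|y - x|)).
have m0 : 0 < m by rewrite !lt_min d'0 dA0 subr_gt0.
pose h := m / (`|u| + 1) / 2.
have h0 : 0 < h by rewrite !divr_gt0.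
have hu : `|h *: u| < m.
  rewrite normrZ gtr0_norm// /h mulrAC ltr_pdivrMr// mulrAC ltr_pdivrMr//.
  have := normr_ge0 u; nra.
move: (hu); rewrite !lt_min => /and3P[hu1 hu2 hu3].
move: (h) h0 hu hu1 hu2 hu3 => {}h h0 hu hu1 hu2 hu3.
have yhu : y + h *: u - y = h *: u by rewrite addrC addKr.
have Ar : A (y + h *: u) by apply: HA; rewrite yhu.
have q1 := Hd s (y + h *: u) y sT Ar Ay st.
have q2 := Hd' s (y + h *: u) y sT Ar Ay.
rewrite yhu !subrr !normr0 in q1 q2.
have {}q1 := q1 _ yx; have {}q2 := q2 d'0 hu1 d'0.
have {}q1 := q1 _.
have {q1} : `|f s (y + h *: u) - f s y - L t x (h *: u)| <= e1 * `|h *: u|.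
  apply: q1; rewrite addrAC (le_lt_trans (ler_normD _ _))//.
  by rewrite -ltrBrDl.
move=> q1; rewrite (blZ (proj1 bL)) in q1; rewrite (blZ (proj1 bL')) in q2.
have : `|h *: (L s y u - L t x u)| <= 2 * (e1 * `|h *: u|).
  have -> : h *: (L s y u - L t x u) = (f s (y + h *: u) - f s y - h *: L t x u) -
      (f s (y + h *: u) - f s y - h *: L s y u).
    by rewrite opprB [RHS]addrC scalerBr [RHS]addrA subrK.
  by rewrite (le_trans (ler_normB _ _))// mulr_natl mulr2n lerD.
rewrite !normrZ (gtr0_norm h0) => q3.
have : `|L s y u - L t x u| <= 2 * e1 * `|u|.
  by rewrite -(ler_pM2l h0) (le_trans q3)// le_eqVlt; apply/orP; left; apply/eqP; ring.
move/le_lt_trans; apply.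
have -> : 2 * e1 * `|u| = e * `|u| / (`|u| + 1) by rewrite /e1; field; exact: lt0r_neq0.
by rewrite ltr_pdivrMr// ltr_pM2l// ltrDl.
Qed.

Lemma time_strict_derive_cont V T (A : set vec) (f a : R -> vec -> V) : 0 < T ->
  (forall s y, 0 <= s <= T -> A y -> time_strict T A f s y (a s y)) -> jcont T A a.
Proof.
move=> T0 H t x tT Ax e e0; pose e1 := e / 3.
have e10 : 0 < e1 by rewrite divr_gt0.
have [d d0 Hd] := H t x tT Ax e1 e10.
exists d; split=> // s y sT Ay st yx.
have [d' d'0 Hd'] := H s y sT Ay e1 e10.
pose m := Num.min d' (Num.min T (d - `|s - t|)).
have m0 : 0 < m by rewrite !lt_min d'0 T0 subr_gt0.
(* A second time is needed inside [[0, T]]: the step goes forward from the first half and backward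
   from the second, and [m <= T] keeps it inside. This is where [0 < T] enters. *)
have [s' s'T s's] : exists2 s', 0 <= s' <= T & `|s' - s| = m / 3.
  have mT : m <= T by rewrite /m !ge_min lexx !orbT.
  have [sT2|sT2] := leP s (T / 2).
    by exists (s + m / 3); [lra|rewrite addrC addKr gtr0_norm ?divr_gt0].
  by exists (s - m / 3); [lra|rewrite addrC addKr normrN gtr0_norm ?divr_gt0].
have : `|s' - s| < m by rewrite s's; lra.
rewrite !lt_min => /and3P[s1 s2 s3].
have q1 := Hd s' s y s'T sT Ay; have q2 := Hd' s' s y s'T sT Ay.
rewrite !subrr !normr0 in q2; have {}q2 := q2 s1 d'0 d'0.
have {q1} : `|f s' y - f s y - (s' - s) *: a t x| <= e1 * `|s' - s|.
  apply: q1 => //.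
  have -> : s' - t = (s' - s) + (s - t) by rewrite addrA subrK.
  by rewrite (le_lt_trans (ler_normD _ _))// -ltrBrDr.
move=> q1.
have : `|(s' - s) *: (a s y - a t x)| <= 2 * (e1 * `|s' - s|).
  have -> : (s' - s) *: (a s y - a t x) = (f s' y - f s y - (s' - s) *: a t x) -
      (f s' y - f s y - (s' - s) *: a s y).
    by rewrite opprB [RHS]addrC scalerBr [RHS]addrA subrK.
  by rewrite (le_trans (ler_normB _ _))// mulr_natl mulr2n lerD.
have ss0 : 0 < `|s' - s| by rewrite s's divr_gt0.
rewrite normrZ mulrA mulrC ler_pM2r// => /le_lt_trans; apply.
by rewrite /e1; lra.
Qed.

Lemma strict_diff_jcont V T (A : set vec) (f : R * vec -> V) (L : R * vec -> R * vec -> V) :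
  (forall p, slab T A p -> strict_diff (slab T A) f p (L p)) -> jcont T A (fun t x => f (t, x)).
Proof.
move=> H t x tT Ax e e0; have Kp : slab T A (t, x) by [].
have [C [d [C0 d0 Hd]]] := strict_diff_lip (H (t, x) Kp).
exists (Num.min d (e / C)); split; first by rewrite lt_min d0 divr_gt0.
move=> s y sT Ay; rewrite !lt_min => /andP[s1 s2] /andP[y1 y2].
have := Hd (s, y) (t, x) (conj sT Ay) Kp; rewrite !prod_norm_lt/= s1 y1 !subrr !normr0 d0.
move=> /(_ isT isT)/le_lt_trans; apply.
by rewrite mulrC -ltr_pdivlMr// prod_norm_lt/= s2.
Qed.

(** The only passage back to partial derivatives: everything upstream works with strict derivatives
    on the slab, and continuity of the partials comes for free. *)
Lemma C1tx_strict_diff V T (A : set vec) (f : R * vec -> V) L : 0 < T -> open A ->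
  (forall p, slab T A p -> strict_diff (slab T A) f p (L p)) ->
  C1tx T A (fun t x => f (t, x)) (fun t x => L (t, x) (1, 0)).
Proof.
move=> T0 oA H; split.
- exact: strict_diff_jcont H.
- move=> t x tT Ax; exact: (time_strict_has_tder tT Ax (time_strict_slab (H (t, x) (conj tT Ax)))).
- apply: (time_strict_derive_cont (f := fun s y => f (s, y))) => // s y sT Ay.
  exact: (time_strict_slab (H (s, y) (conj sT Ay))).
- move=> i; have S s y : 0 <= s <= T -> A y ->
      space_strict T A (fun s y => f (s, y)) s y (fun u => L (s, y) (0, u)).
    by move=> sT Ay; exact: (space_strict_slab (H (s, y) (conj sT Ay))).
  split=> [t x tT Ax|].
    by have [] := space_strict_is_derive (ebasis R i) oA tT Ax (S t x tT Ax).
  move=> t x tT Ax e e0.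
  have [d [d0 Hd]] := space_strict_derive_cont oA S (ebasis R i) tT Ax e0.
  exists d; split=> // s y sT Ay st yx.
  rewrite (space_strict_pdv i oA tT Ax (S t x tT Ax)) (space_strict_pdv i oA sT Ay (S s y sT Ay)).
  exact: Hd.
Qed.

(* Applied with [A'] the open exterior of a ball and [A] its closure: the derivative extends
   to the boundary because [a] does. *)
Lemma time_strict_tder T (A A' : set vec) (f a : R -> vec -> R) t x :
  A' `<=` A -> (forall z, A z -> forall d : R, 0 < d -> exists2 z', A' z' & `|z' - z| < d) ->
  jcont T A f -> jcont T A a ->
  (forall s z, 0 <= s <= T -> A' z -> has_tder T (fun r => f r z) s (a s z)) ->
  0 <= t <= T -> A x -> time_strict T A f t x (a t x).
Proof.
move=> A'A dense cf ca ft tT Ax e e0.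
have [d [d0 Hd]] := ca t x tT Ax e e0.
exists d => // s s' z sT s'T Az st s't zx.
have main (r r' : R) z' : 0 <= r' -> r' <= r -> r <= T -> A' z' -> `|r - t| < d ->
    `|r' - t| < d -> `|z' - x| < d ->
    `|f r z' - f r' z' - (r - r') * a t x| <= e * `|r - r'|.
  move=> r'0 rr' rT Az' rt r't zx'.
  have [r1 r1T|c c1 ->] := @has_tder_mvt _ T (fun r => f r z') (fun r => a r z') r r' _ r'0 rr' rT.
    exact: ft.
  rewrite [(r - r') * _]mulrC -mulrBl normrM ler_wpM2r//.
  apply/ltW/Hd => //; [lra|exact: A'A|].
  by move: rt r't; rewrite !ltr_norml => /andP[? ?] /andP[? ?]; apply/andP; split; lra.
have main' z' : A' z' -> `|z' - x| < d ->
    `|f s z' - f s' z' - (s - s') * a t x| <= e * `|s - s'|.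
  move=> Az' z'x; have [ss|/ltW ss] := leP s' s; first by apply: main => //; lra.
  have -> : f s z' - f s' z' - (s - s') * a t x = - (f s' z' - f s z' - (s' - s) * a t x) by ring.
  by rewrite normrN [`|s - s'|]distrC; apply: main => //; lra.
rewrite -[_ *: _]/((s - s') * a t x).
(* The point [z] may lie outside [A']. The bound is proved at a nearby [z'] of [A'] and transferred
   by continuity of [f] at the two times, at the price of [eta]. *)
apply/ler_addgt0Pr => eta eta0.
have eta2 : 0 < eta / 2 by rewrite divr_gt0.
have [d1 [d10 H1]] := cf s z sT Az _ eta2; have [d2 [d20 H2]] := cf s' z s'T Az _ eta2.
have [|z' Az'] := dense z Az (Num.min (Num.min d1 d2) (d - `|z - x|)).
  by rewrite !lt_min d10 d20 subr_gt0.
rewrite !lt_min => /andP[/andP[z1 z2] z3].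
have z'x : `|z' - x| < d.
  by rewrite -[z'](subrK z) -addrA (le_lt_trans (ler_normD _ _))// -ltrBrDr.
have Q := main' z' Az' z'x.
have := H1 s z' sT (A'A _ Az'); rewrite subrr normr0 => /(_ d10 z1) q1.
have := H2 s' z' s'T (A'A _ Az'); rewrite subrr normr0 => /(_ d20 z2) q2.
have -> : f s z - f s' z - (s - s') * a t x = (f s z' - f s' z' - (s - s') * a t x) +
   (f s' z' - f s' z) - (f s z' - f s z) by ring.
rewrite (le_trans (ler_normB _ _))// (le_trans (lerD (ler_normD _ _) (lexx _)))//.
lra.
Qed.

Lemma bounded_linear_mulmx (M : 'M[R]_3) : bounded_linear (fun u : vec => M *m u).
Proof.
apply: bounded_linear_mx => i j.
rewrite (_ : (fun u => _) = fun u : vec => \sum_k M i k * u k j); last first.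
  by apply/funext => u; rewrite mxE.
apply: bounded_linear_sum3 => k.
exact: (bounded_linearZ (M i k) (bounded_linear_coord k j)).
Qed.

(** The expansion bound makes [psi] Lipschitz near [(t, x)]. The remainder of [phi] between two
    preimages is then small relative to the distance of the images, and [invmx F] turns it into the
    remainder of [psi]. *)
Lemma strict_diff_inverse T (A O : set vec) (phi psi : R -> vec -> vec) t x c (F : 'M[R]_3) (k : R) :
  strict_diff (slab T A) (fun p => phi p.1 p.2) (t, psi t x) (fun u => u.1 *: c + F *m u.2) ->
  F \in unitmx -> 0 <= t <= T -> O x -> 0 < k ->
  (forall s y, 0 <= s <= T -> O y -> A (psi s y) /\ y = phi s (psi s y)) ->
  (forall s y z, 0 <= s <= T -> A y -> A z -> `|y - z| <= k * `|phi s y - phi s z|) ->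
  strict_diff (slab T O) (fun p => psi p.1 p.2) (t, x) (fun u => invmx F *m (u.2 - u.1 *: c)).
Proof.
move=> S Fu tT Ox k0 psiK expand.
have bI := bounded_linear_mulmx (invmx F).
have [lI [CI CI0 IC]] := bI.
have [C [d1 [C0 d10 lip]]] := strict_diff_lip S.
have [Ay0 ephi] := psiK t x tT Ox.
set y0 := psi t x in S lip Ay0 ephi *.
have K0 : slab T A (t, y0) by [].
(* A Lipschitz constant for [(t, x) |-> (t, psi t x)]: [1] for the time component, and [k * (1 + C)]
   because moving the time displaces [phi] by at most [C] times the time step. *)
pose K := Num.max 1 (k * (1 + C)).
have K1 : 1 <= K by rewrite le_max lexx.
have Kk : k * (1 + C) <= K by rewrite le_max lexx orbT.
have K_gt0 : 0 < K by rewrite (lt_le_trans _ K1).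
have cpsi d : 0 < d -> exists2 d', 0 < d' & forall q, slab T O q -> `|q - (t, x)| < d' ->
    `|(q.1, psi q.1 q.2) - (t, y0)| < d.
  move=> d0; exists (Num.min d1 (d / K)); first by rewrite lt_min d10 divr_gt0.
  move=> [s y] [/= sT Oy]; rewrite lt_min => /andP[q1 q2].
  have [Ay yE] := psiK s y sT Oy.
  move: (q1) (q2); rewrite !prod_norm_lt/= => /andP[s1 y1] /andP[s2 y2].
  rewrite ltr_pdivlMr// in s2; rewrite ltr_pdivlMr// in y2.
  have sd : `|s - t| < d by rewrite (le_lt_trans _ s2)// ler_peMr.
  apply/andP; split => //.
  have H1 := expand s _ _ sT Ay Ay0.
  have H2 : `|phi s y0 - phi t y0| <= C * `|s - t|.
    have := lip (s, y0) (t, y0) (conj sT Ay0) K0; rewrite !prod_norm_lt/= !subrr !normr0 d10 s1.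
    by move=> /(_ isT isT); rewrite prod_normE/= subrr normr0 (max_idPl (normr_ge0 _)).
  rewrite (le_lt_trans H1)// -yE.
  have -> : y - phi s y0 = (y - x) - (phi s y0 - phi t y0).
    by rewrite -ephi opprB addrA subrK.
  have H3 : `|y - x - (phi s y0 - phi t y0)| <= `|y - x| + C * `|s - t|.
    by rewrite (le_trans (ler_normB _ _))// lerD2l.
  set m := Num.max `|y - x| `|s - t|.
  have m1 : `|y - x| <= m by rewrite le_max lexx.
  have m2 : `|s - t| <= m by rewrite le_max lexx orbT.
  have m3 : m * K < d by rewrite /m; have [_|_] := leP `|y - x| `|s - t|.
  have m0 : 0 <= m by rewrite (le_trans _ m1).
  rewrite (le_lt_trans _ m3)// (le_trans (_ : _ <= k * (1 + C) * m))//.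
    by rewrite -mulrA ler_pM2l// (le_trans H3)// mulrDl mul1r lerD// ler_pM2l.
  by rewrite mulrC ler_wpM2l.
apply: (@strict_diffW _ _ _ _ _ _ _ (CI * K)).
- have b2 : bounded_linear (fun u : R * vec => u.2 - u.1 *: c).
    have := bounded_linearD (bounded_linear_snd _ _)
      (bounded_linearZl (- c) (bounded_linear_fst R vec)).
    by under [X in bounded_linear X]funext do rewrite scalerN.
  exact: (bounded_linear_comp b2 bI).
- exact: mulr_gt0.
move=> e e0 _; have [d2 d20 Hd2] := S.2 e e0.
have [d3 d30 Hd3] := cpsi (Num.min d1 d2) ltac:(by rewrite lt_min d10).
exists d3 => // -[s y] [s' y'] Kq Kr /(Hd3 _ Kq) + /(Hd3 _ Kr).
move: Kq Kr => [/= sT Oy] [/= s'T Oy'].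
rewrite !lt_min => /andP[q1 q2] /andP[r1 r2].
have [Ay yE] := psiK s y sT Oy; have [Ay' yE'] := psiK s' y' s'T Oy'.
set z := psi s y in q1 q2 Ay yE *; set z' := psi s' y' in r1 r2 Ay' yE' *.
have H1 := Hd2 (s, z) (s', z') (conj sT Ay) (conj s'T Ay') q2 r2.
rewrite /= -yE -yE' in H1.
set n := `|(s, y) - (s', y')|.
have n1 : `|s - s'| <= n by exact: (fst_le_norm ((s, y) - (s', y'))).
have n2 : `|y - y'| <= n by exact: (snd_le_norm ((s, y) - (s', y'))).
have n0 : 0 <= n by exact: normr_ge0.
have zz : `|z - z'| <= K * n.
  rewrite (le_trans (expand s _ _ sT Ay Ay'))// -yE.
  have H2 : `|phi s z' - phi s' z'| <= C * `|s - s'|.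
    have := lip (s, z') (s', z') (conj sT Ay') (conj s'T Ay').
    have r1' : `|(s, z') - (t, y0)| < d1.
      by move: q1 r1; rewrite !prod_norm_lt/= => /andP[-> _] /andP[_ ->].
    by move=> /(_ r1' r1); rewrite prod_normE/= subrr normr0 (max_idPl (normr_ge0 _)).
  have -> : y - phi s z' = (y - y') - (phi s z' - phi s' z').
    by rewrite -yE' opprB addrA subrK.
  rewrite (le_trans (_ : _ <= k * (1 + C) * n))//; last by rewrite ler_wpM2r.
  rewrite -mulrA ler_pM2l// (le_trans (ler_normB _ _))// mulrDl mul1r lerD//.
  by rewrite (le_trans H2)// ler_pM2l.
have nz : `|(s, z) - (s', z')| <= K * n.
  by rewrite prod_normE/= ge_max zz andbT (le_trans n1)// ler_peMl.
(* The error of the inverse is minus [invmx F] applied to the error of [phi] between [(s, z)] and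
   [(s', z')]. *)
have -> : z - z' - invmx F *m (y - y' - (s - s') *: c) =
   - (invmx F *m (y - y' - ((s - s') *: c + F *m (z - z')))).
  rewrite opprD (addrA (y - y')); move: (y - y' - _) => w.
  by rewrite mulmxBr mulKmx// opprB.
rewrite normrN (le_trans (IC _))// -!mulrA ler_pM2l// (le_trans H1)//.
by rewrite mulrCA ler_pM2l.
Qed.

End Derivatives.

(** * Chain and product rules with mixed regularity; joint continuity *)

Section Composition.
Context {R : realType}.
Local Notation vec := (vec R).
Implicit Types V W : normedModType R.

Lemma telescope3 (V : zmodType) (x y z p q r : V) :
  x - z - (r + q) = (x - y - p) + (p - q) + (y - z - r).
Proof.
rewrite [x - y - p + _]addrA subrK [RHS]addrACA [x - y + _]addrA subrK.
by rewrite opprD [- q - r]addrC.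
Qed.

Lemma space_strict_mx m n T (A : set vec) (f : R -> vec -> 'M[R]_(m, n)) t x
    (L : vec -> 'M[R]_(m, n)) :
  (forall i j, space_strict T A (fun s y => f s y i j) t x (fun u => L u i j)) ->
  space_strict T A f t x L.
Proof.
move=> H; split=> [|e e0]; first by apply: bounded_linear_mx => i j; case: (H i j).
have [|ij|d d0 Hd] := @common_delta _ ('I_m * 'I_n)%type (fun ij d =>
    forall s y z, 0 <= s <= T -> A y -> A z -> `|s - t| < d -> `|y - x| < d -> `|z - x| < d ->
      `|f s y ij.1 ij.2 - f s z ij.1 ij.2 - L (y - z) ij.1 ij.2| <= e * `|y - z|).
- move=> ij d d' dd' Hd s y z sT Ay Az sd yd zd.
  by apply: Hd => //; exact: lt_le_trans dd'.
- by have [_ /(_ e e0)] := H ij.1 ij.2.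
exists d => // s y z sT Ay Az sd yd zd; rewrite [leLHS]mx_normrE.
apply: bigmax_le => [|ij _]; first by rewrite mulr_ge0// ltW.
by rewrite !mxE; exact: Hd.
Qed.

(** Only spatial strictness is asked of [g], so that the rule applies to [dphi] inside the ball as
    well, where no time derivative is given. *)
Lemma space_strict_comp V T (A O : set vec) (g : R -> vec -> V) (psi : R -> vec -> vec) t x M L :
  space_strict T A g t (psi t x) M ->
  strict_diff (slab T O) (fun p => psi p.1 p.2) (t, x) L -> 0 <= t <= T -> O x ->
  (forall s y, 0 <= s <= T -> O y -> A (psi s y)) ->
  space_strict T O (fun s y => g s (psi s y)) t x (fun u => M (L (0, u))).
Proof.
move=> [bM HM] S tT Ox Apsi.
have [bL HL] := space_strict_slab S.
have [lM [CM CM0 MC]] := bM.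
have [C [d1 [C0 d10 lip]]] := strict_diff_lip S.
split; first exact: (bounded_linear_comp bL bM).
move=> e e0.
have D0 : 0 < C + CM by exact: addr_gt0.
pose e1 := e / (C + CM); have e10 : 0 < e1 by rewrite divr_gt0.
have [d2 d20 H2] := HM e1 e10; have [d3 d30 H3] := HL e1 e10.
exists (Num.min (Num.min d1 (d2 / C)) (Num.min d2 d3)).
  by rewrite !lt_min d10 d20 d30 divr_gt0.
move=> s y z sT Oy Oz; rewrite !lt_min.
move=> /andP[/andP[s1 s2] /andP[s3 s4]] /andP[/andP[y1 y2] /andP[y3 y4]].
move=> /andP[/andP[z1 z2] /andP[z3 z4]].
have near w : O w -> `|w - x| < d1 -> `|w - x| < d2 / C -> `|psi s w - psi t x| < d2.
  move=> Ow w1 w2; rewrite (le_lt_trans (lip (s, w) (t, x) _ _ _ _))//=.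
  - by rewrite prod_norm_lt/= s1.
  - by rewrite subrr normr0.
  - by rewrite mulrC -ltr_pdivlMr// prod_norm_lt/= s2.
have Q1 := H2 s _ _ sT (Apsi s y sT Oy) (Apsi s z sT Oz) s3 (near y Oy y1 y2) (near z Oz z1 z2).
have Q2 := H3 s y z sT Oy Oz s4 y4 z4.
have Q3 : `|psi s y - psi s z| <= C * `|y - z|.
  have := lip (s, y) (s, z) (conj sT Oy) (conj sT Oz).
  rewrite !prod_norm_lt/= s1 y1 z1 => /(_ isT isT).
  by rewrite prod_normE/= subrr normr0 (max_idPr (normr_ge0 _)).
have -> : g s (psi s y) - g s (psi s z) - M (L (0, y - z)) =
  (g s (psi s y) - g s (psi s z) - M (psi s y - psi s z)) +
  M (psi s y - psi s z - L (0, y - z)).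
  by rewrite (blB (proj1 bM) (_ - _)) addrA subrK.
rewrite (le_trans (ler_normD _ _))//.
have -> : e * `|y - z| = e1 * (C * `|y - z|) + CM * (e1 * `|y - z|).
  by rewrite /e1; field; exact: lt0r_neq0.
rewrite lerD//; first by rewrite (le_trans Q1)// ler_pM2l.
by rewrite (le_trans (MC _))// ler_pM2l.
Qed.

Lemma has_tder_comp V T (A O : set vec) (g : R -> vec -> V) (psi : R -> vec -> vec) t x M L a :
  space_strict T A g t (psi t x) M ->
  strict_diff (slab T O) (fun p => psi p.1 p.2) (t, x) L -> 0 <= t <= T -> O x ->
  (forall s y, 0 <= s <= T -> O y -> A (psi s y)) ->
  has_tder T (fun s => g s (psi t x)) t a ->
  has_tder T (fun s => g s (psi s x)) t (a + M (L (1, 0))).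
Proof.
move=> [bM HM] S tT Ox Apsi /has_tderP ga; apply/has_tderP => e e0.
have [lM [CM CM0 MC]] := bM.
have [C [d1 [C0 d10 lip]]] := strict_diff_lip S.
have psit := time_strict_slab S.
have D0 : 0 < C + CM + 1 by rewrite !addr_gt0.
pose e1 := e / (C + CM + 1); have e10 : 0 < e1 by rewrite divr_gt0.
have [d2 d20 H2] := HM e1 e10; have [d3 d30 H3] := psit e1 e10; have [d4 d40 H4] := ga e1 e10.
exists (Num.min (Num.min d1 (d2 / C)) (Num.min d2 (Num.min d3 d4))).
  by rewrite !lt_min d10 d20 d30 d40 divr_gt0.
move=> s sT; rewrite !lt_min => /andP[/andP[s1 s2] /and3P[s3 s4 s5]].
have Q3 : `|psi s x - psi t x| <= C * `|s - t|.
  have := lip (s, x) (t, x) (conj sT Ox) (conj tT Ox).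
  rewrite !prod_norm_lt/= s1 !subrr !normr0 d10 => /(_ isT isT).
  by rewrite prod_normE/= subrr normr0 (max_idPl (normr_ge0 _)).
have Q1 : `|g s (psi s x) - g s (psi t x) - M (psi s x - psi t x)| <=
    e1 * `|psi s x - psi t x|.
  apply: H2 => //; [exact: Apsi|exact: Apsi| |by rewrite subrr normr0].
  by rewrite (le_lt_trans Q3)// mulrC -ltr_pdivlMr.
have Q2 : `|psi s x - psi t x - (s - t) *: L (1, 0)| <= e1 * `|s - t|.
  by apply: H3 => //; rewrite subrr normr0.
have Q4 := H4 s sT s5.
have -> : g s (psi s x) - g t (psi t x) - (s - t) *: (a + M (L (1, 0))) =
  (g s (psi s x) - g s (psi t x) - M (psi s x - psi t x)) +
  M (psi s x - psi t x - (s - t) *: L (1, 0)) + (g s (psi t x) - g t (psi t x) - (s - t) *: a).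
  by rewrite (blB lM (_ - _)) (blZ lM) scalerDr; exact: telescope3.
rewrite (le_trans (ler_normD _ _))//.
have -> : e * `|s - t| = e1 * (C * `|s - t|) + CM * (e1 * `|s - t|) + e1 * `|s - t|.
  by rewrite /e1; field; exact: lt0r_neq0.
rewrite lerD// (le_trans (ler_normD _ _))// lerD//; first by rewrite (le_trans Q1)// ler_pM2l.
by rewrite (le_trans (MC _))// ler_pM2l.
Qed.

(** The norms are maxima of entries, so the factor [3] counts the terms of a row. *)
Lemma mulmx_norm_le (A : 'M[R]_3) (u : vec) : `|A *m u| <= 3 * `|A| * `|u|.
Proof.
apply: norm_le_coord => [|i]; first by rewrite !mulr_ge0.
rewrite mxE (le_trans (ler_norm_sum _ _ _))//.
have -> : 3 * `|A| * `|u| = \sum_(k < 3) (`|A| * `|u|).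
  by rewrite sumr_const card_ord; ring.
apply: ler_sum => k _; rewrite normrM ler_pM//; last exact: coord_le_norm.
rewrite [leRHS]mx_normrE.
by apply: le_trans (le_bigmax _ (fun ij : 'I_3 * 'I_3 => `|A ij.1 ij.2|) (i, k)).
Qed.

Lemma has_tder_mulmx T (A : R -> 'M[R]_3) (u : R -> vec) t (dA : 'M[R]_3) du :
  has_tder T A t dA -> has_tder T u t du ->
  has_tder T (fun s => A s *m u s) t (dA *m u t + A t *m du).
Proof.
move=> HA Hu; apply/has_tderP => e e0.
have [d1 d10 H1] := has_tder_lip Hu.
set k := `|du| + 1 in H1; have k0 : 0 < k by rewrite ltr_wpDl.
pose D := 3 * (`|u t| + 1) + 3 * `|A t| + 3 * `|dA| + 1.
have D0 : 0 < D.
  by have := normr_ge0 (u t); have := normr_ge0 (A t); have := normr_ge0 dA; rewrite /D; lra.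
pose e1 := e / D; have e10 : 0 < e1 by rewrite divr_gt0.
have [d2 d20 H2] := (has_tderP _ _ _ _).1 HA e1 e10.
have [d3 d30 H3] := (has_tderP _ _ _ _).1 Hu e1 e10.
exists (Num.min (Num.min d1 (Num.min (k^-1) (e1 / k))) (Num.min d2 d3)).
  by rewrite !lt_min d10 d20 d30 divr_gt0// invr_gt0 k0.
move=> s sT; rewrite !lt_min => /andP[/and3P[s1 s2 s3] /andP[s4 s5]].
have Q1 := H1 s sT s1; have Q2 := H2 s sT s4; have Q3 := H3 s sT s5.
have Q4 : `|u s - u t| <= 1.
  by rewrite (le_trans Q1)// mulrC -ler_pdivlMr// div1r ltW.
have Q5 : `|u s - u t| <= e1.
  by rewrite (le_trans Q1)// mulrC -ler_pdivlMr// ltW.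
have Q6 : `|u s| <= `|u t| + 1.
  by rewrite -[u s](subrK (u t)) (le_trans (ler_normD _ _))// addrC lerD2l.
have -> : A s *m u s - A t *m u t - (s - t) *: (dA *m u t + A t *m du) =
  (A s - A t - (s - t) *: dA) *m u s + A t *m (u s - u t - (s - t) *: du) +
  (s - t) *: (dA *m (u s - u t)).
  rewrite !mulmxBl !mulmxBr scalerBr scalerDr -!scalemxAl -!scalemxAr.
  apply/matrixP => i j; rewrite !mxE; ring.
have h1 := le_trans (mulmx_norm_le (A s - A t - (s - t) *: dA) (u s))
  (ler_pM _ _ (ler_wpM2l (ler0n _ 3) Q2) Q6).
have h2 := le_trans (mulmx_norm_le (A t) (u s - u t - (s - t) *: du))
  (ler_wpM2l (mulr_ge0 (ler0n _ 3) (normr_ge0 _)) Q3).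
have h3 : `|(s - t) *: (dA *m (u s - u t))| <= `|s - t| * (3 * `|dA| * e1).
  rewrite normrZ ler_wpM2l// (le_trans (mulmx_norm_le _ _))//.
  by rewrite ler_wpM2l// mulr_ge0.
have -> : e * `|s - t| = D * e1 * `|s - t| by rewrite /e1; field; exact: lt0r_neq0.
rewrite (le_trans (ler_normD _ _))// (le_trans (lerD (ler_normD _ _) (lexx _)))//.
have st0 : 0 <= e1 * `|s - t| by rewrite mulr_ge0// ltW.
have := h1 (mulr_ge0 (ler0n _ 3) (normr_ge0 _)) (normr_ge0 _).
rewrite /D; lra.
Qed.

Lemma jcont_eq V T (A : set vec) (f g : R -> vec -> V) :
  (forall t x, 0 <= t <= T -> A x -> g t x = f t x) -> jcont T A f -> jcont T A g.
Proof.
move=> fg H t x tT Ax e /(H t x tT Ax)[d [d0 Hd]]; exists d; split=> // s y sT Ay st yx.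
by rewrite !fg//; exact: Hd.
Qed.

Lemma jcont_sub V T (A A' : set vec) (f : R -> vec -> V) :
  A' `<=` A -> jcont T A f -> jcont T A' f.
Proof.
move=> AA H t x tT Ax e /(H t x tT (AA _ Ax))[d [d0 Hd]].
by exists d; split=> // s y sT /AA Ay; exact: Hd.
Qed.

Lemma jcont_cst V T (A : set vec) (v : V) : jcont T A (fun _ _ => v).
Proof. by move=> t x tT Ax e e0; exists 1; split=> // *; rewrite subrr normr0. Qed.

Lemma jcontD V T (A : set vec) (f g : R -> vec -> V) : jcont T A f -> jcont T A g ->
  jcont T A (fun t x => f t x + g t x).
Proof.
move=> cf cg t x tT Ax e e0; have e2 : 0 < e / 2 by rewrite divr_gt0.
have [d1 [d10 H1]] := cf t x tT Ax _ e2; have [d2 [d20 H2]] := cg t x tT Ax _ e2.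
exists (Num.min d1 d2); split=> [|s y sT Ay]; first by rewrite lt_min d10.
rewrite !lt_min => /andP[s1 s2] /andP[y1 y2].
rewrite opprD addrACA (le_lt_trans (ler_normD _ _))//.
have := H1 s y sT Ay s1 y1; have := H2 s y sT Ay s2 y2; lra.
Qed.

Lemma jcontM T (A : set vec) (f g : R -> vec -> R) : jcont T A f -> jcont T A g ->
  jcont T A (fun t x => f t x * g t x).
Proof.
move=> cf cg t x tT Ax e e0; pose M := `|f t x| + `|g t x| + 1.
have M0 : 0 < M by rewrite ltr_wpDl// addr_ge0.
pose e1 := Num.min 1 (e / (2 * M)).
have e10 : 0 < e1 by rewrite lt_min ltr01 divr_gt0// mulr_gt0.
have [d1 [d10 H1]] := cf t x tT Ax _ e10; have [d2 [d20 H2]] := cg t x tT Ax _ e10.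
exists (Num.min d1 d2); split=> [|s y sT Ay]; first by rewrite lt_min d10.
rewrite !lt_min => /andP[s1 s2] /andP[y1 y2].
have {H1} := H1 s y sT Ay s1 y1; have {H2} := H2 s y sT Ay s2 y2.
set df := f s y - f t x; set dg := g s y - g t x => h2 h1.
have -> : f s y * g s y - f t x * g t x = df * dg + df * g t x + f t x * dg.
  by rewrite /df /dg; ring.
have e11 : e1 <= 1 by rewrite ge_min lexx.
have e1M : e1 * (2 * M) <= e by rewrite -ler_pdivlMr ?mulr_gt0// ge_min lexx orbT.
rewrite (le_lt_trans (ler_normD _ _))// (le_lt_trans (lerD (ler_normD _ _) (lexx _)))//.
rewrite !normrM.
have := normr_ge0 df; have := normr_ge0 dg; have := normr_ge0 (f t x); have := normr_ge0 (g t x).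
move: h1 h2 e1M; rewrite /M; move: `|df| `|dg| `|f t x| `|g t x| => a b c d.
move=> h1 h2 h3 d0 c0 b0 a0.
have : a * b <= e1 by nra.
have : a * d <= e1 * d by nra.
have : c * b <= c * e1 by nra.
nra.
Qed.

Lemma jcont_sum3 V T (A : set vec) (f : 'I_3 -> R -> vec -> V) : (forall i, jcont T A (f i)) ->
  jcont T A (fun t x => \sum_i f i t x).
Proof.
move=> H; apply: (@jcont_eq _ _ _ (fun t x => f ord0 t x + (f (lift ord0 ord0) t x +
   f (lift ord0 (lift ord0 ord0)) t x))) => [t x _ _|].
  by rewrite !big_ord_recl big_ord0 addr0.
by do 2![apply: jcontD => //].
Qed.

Lemma jcontZ T (A : set vec) (c : R) (f : R -> vec -> R) : jcont T A f ->
  jcont T A (fun t x => c * f t x).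
Proof. by move=> H; apply: jcontM => //; exact: jcont_cst. Qed.

Lemma jcont_coord T m n (A : set vec) (f : R -> vec -> 'M[R]_(m, n)) i j : jcont T A f ->
  jcont T A (fun t x => f t x i j).
Proof.
move=> H t x tT Ax e /(H t x tT Ax)[d [d0 Hd]]; exists d; split=> // s y sT Ay st yx.
apply: le_lt_trans (Hd s y sT Ay st yx).
have [_ [C _ HC]] := @bounded_linear_coord R m n i j.
rewrite [leRHS]mx_normrE.
have := le_bigmax (0 : R) (fun ij : 'I_m * 'I_n => `|(f s y - f t x) ij.1 ij.2|) (i, j).
by rewrite !mxE.
Qed.

End Composition.

(** * Jacobi's formula in dimension three *)

Section Determinant.
Context {R : realType}.

Let i0 : 'I_3 := Ordinal (isT : (0 < 3)%N).
Let i1 : 'I_3 := Ordinal (isT : (1 < 3)%N).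
Let i2 : 'I_3 := Ordinal (isT : (2 < 3)%N).
Let j0 : 'I_2 := Ordinal (isT : (0 < 2)%N).
Let j1 : 'I_2 := Ordinal (isT : (1 < 2)%N).

Let sum3E (V : nmodType) (f : 'I_3 -> V) : \sum_i f i = f i0 + f i1 + f i2.
Proof.
rewrite !big_ord_recl big_ord0 addr0 addrA.
by congr (f _ + f _ + f _); apply/val_inj.
Qed.

Let det2E (A : 'M[R]_2) : \det A = A j0 j0 * A j1 j1 - A j0 j1 * A j1 j0.
Proof.
have -> : j0 = ord0 by exact/val_inj.
have -> : j1 = lift ord0 ord0 by exact/val_inj.
rewrite (expand_det_row _ ord0) !big_ord_recl big_ord0 /cofactor !det_mx11 !mxE /=.
have -> : lift (lift ord0 ord0) (0 : 'I_1) = ord0 :> 'I_2 by exact/val_inj.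
by rewrite addr0 expr0 expr1 mul1r mulN1r mulrN.
Qed.

Let liftE : (lift i0 j0 = i1) * (lift i0 j1 = i2) * (lift i1 j0 = i0) * (lift i1 j1 = i2) *
  (lift i2 j0 = i0) * (lift i2 j1 = i1).
Proof. by do !split; apply/val_inj. Qed.

Lemma det3E (A : 'M[R]_3) : \det A =
  A i0 i0 * (A i1 i1 * A i2 i2 - A i1 i2 * A i2 i1)
  - A i0 i1 * (A i1 i0 * A i2 i2 - A i1 i2 * A i2 i0)
  + A i0 i2 * (A i1 i0 * A i2 i1 - A i1 i1 * A i2 i0).
Proof.
rewrite (expand_det_row _ i0) sum3E /cofactor !det2E !mxE !liftE /=.
by rewrite !(expr0, expr1, expr2); ring.
Qed.

(** With the trace expanded in entries, Jacobi's formula becomes a polynomial identity that [ring]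
    decides against the derivative of [det3E]. *)
Lemma tr_adj3E (A H : 'M[R]_3) : \tr (\adj A *m H) =
    (A i1 i1 * A i2 i2 - A i1 i2 * A i2 i1) * H i0 i0
  - (A i1 i0 * A i2 i2 - A i1 i2 * A i2 i0) * H i0 i1
  + (A i1 i0 * A i2 i1 - A i1 i1 * A i2 i0) * H i0 i2
  - (A i0 i1 * A i2 i2 - A i0 i2 * A i2 i1) * H i1 i0
  + (A i0 i0 * A i2 i2 - A i0 i2 * A i2 i0) * H i1 i1
  - (A i0 i0 * A i2 i1 - A i0 i1 * A i2 i0) * H i1 i2
  + (A i0 i1 * A i1 i2 - A i0 i2 * A i1 i1) * H i2 i0
  - (A i0 i0 * A i1 i2 - A i0 i2 * A i1 i0) * H i2 i1
  + (A i0 i0 * A i1 i1 - A i0 i1 * A i1 i0) * H i2 i2.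
Proof.
rewrite /mxtrace sum3E !mxE !sum3E !mxE /cofactor !det2E !mxE !liftE /=.
rewrite !(expr0, expr1, exprS); ring.
Qed.

Lemma strict_diff_det (E : normedModType R) (K : set E) (F : E -> 'M[R]_3) p L : K p ->
  strict_diff K F p L ->
  strict_diff K (fun q => \det (F q)) p (fun u => \tr (\adj (F p) *m L u)).
Proof.
move=> Kp S.
have c i j : strict_diff K (fun q => F q i j) p (fun u => L u i j).
  apply: (strict_diff_comp (g := fun A : 'M[R]_3 => A i j)
    (M := fun A : 'M[R]_3 => A i j) (K' := setT) S) => //.
    exact/strict_diff_lin/bounded_linear_coord.
  by exists 1.
have N (f : E -> R) M : strict_diff K f p M -> strict_diff K (fun q => - f q) p (fun u => - M u).
  move=> Sf.
  apply: (strict_diff_comp (g := fun x : R => - x) (M := fun x : R => - x) (K' := setT) Sf) => //.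
    apply: strict_diff_lin; split=> [a u v|]; first by rewrite opprD scalerN.
    by exists 1 => // u; rewrite normrN mul1r.
  by exists 1.
have m i j k l := strict_diffM Kp (c i j) (c k l).
have mm i j k l i' j' k' l' := strict_diffD (m i j k l) (N _ _ (m i' j' k' l')).
have := strict_diffD (strict_diffD (strict_diffM Kp (c i0 i0) (mm i1 i1 i2 i2 i1 i2 i2 i1))
  (N _ _ (strict_diffM Kp (c i0 i1) (mm i1 i0 i2 i2 i1 i2 i2 i0))))
  (strict_diffM Kp (c i0 i2) (mm i1 i0 i2 i1 i1 i1 i2 i0)).
have -> : (fun q => \det (F q)) = fun q => F q i0 i0 * (F q i1 i1 * F q i2 i2 - F q i1 i2 * F q i2 i1)
  - F q i0 i1 * (F q i1 i0 * F q i2 i2 - F q i1 i2 * F q i2 i0)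
  + F q i0 i2 * (F q i1 i0 * F q i2 i1 - F q i1 i1 * F q i2 i0).
  by apply/funext => q; exact: det3E.
move/strict_diff_eqL; apply => u; rewrite tr_adj3E /=; ring.
Qed.

End Determinant.

(** * Extension across a sphere *)

Section Extension.
Context {R : realType}.
Local Notation vec := (vec R).
Implicit Types E V W : normedModType R.

Lemma strict_diff_sum3 E V K (f : 'I_3 -> E -> V) p (L : 'I_3 -> E -> V) :
  (forall i, strict_diff K (f i) p (L i)) ->
  strict_diff K (fun q => \sum_i f i q) p (fun u => \sum_i L i u).
Proof.
move=> S; have := strict_diffD (S ord0)
  (strict_diffD (S (lift ord0 ord0)) (S (lift ord0 (lift ord0 ord0)))).
rewrite (_ : (fun q => _ + _) = fun q => \sum_i f i q); last first.
  by apply/funext => q; rewrite !big_ord_recl big_ord0 addr0.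
by move/strict_diff_eqL; apply => u; rewrite !big_ord_recl big_ord0 addr0.
Qed.

Lemma strict_diff_pair E V W K (f : E -> V) (g : E -> W) p L M :
  strict_diff K f p L -> strict_diff K g p M ->
  strict_diff K (fun q => (f q, g q)) p (fun u => (L u, M u)).
Proof.
move=> [[lL [C C0 LC]] HL] [[lM [C' C'0 MC]] HM]; split.
  split=> [a u v|]; first by rewrite lL lM.
  exists (C + C'); first exact: addr_gt0.
  move=> u; rewrite prod_normE ge_max/= mulrDl; apply/andP; split.
    by rewrite (le_trans (LC u))// lerDl mulr_ge0// ltW.
  by rewrite (le_trans (MC u))// lerDr mulr_ge0// ltW.
move=> e e0; have [d1 d10 H1] := HL e e0; have [d2 d20 H2] := HM e e0.
exists (Num.min d1 d2); first by rewrite lt_min d10.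
move=> q r Kq Kr; rewrite !lt_min => /andP[q1 q2] /andP[r1 r2].
by rewrite prod_normE ge_max/= H1// H2.
Qed.

Lemma strict_diff_snd V (K : set (R * vec)) (K' : set vec) (g : vec -> V) p L :
  strict_diff K' g p.2 L -> K p -> (forall q, K q -> K' q.2) ->
  strict_diff K (fun q => g q.2) p (fun u => L u.2).
Proof.
move=> S Kp KK'.
apply: (strict_diff_comp (f := snd) (g := g) (L := snd) (K' := K')) => //.
  exact/strict_diff_lin/bounded_linear_snd.
by exists 1 => // q /KK'.
Qed.

Lemma strict_diff_sqr K (x : vec) : K x ->
  strict_diff K (fun y => dotv y y) x (fun u => 2 * dotv x u).
Proof.
move=> Kx.
have c i : strict_diff K (fun y : vec => y i 0) x (fun u => u i 0).
  exact/strict_diff_lin/bounded_linear_coord.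
have := strict_diff_sum3 (fun i => strict_diffM Kx (c i) (c i)).
move/strict_diff_eqL; apply => u; rewrite /dotv mulr_sumr.
by apply: eq_bigr => i _; ring.
Qed.

(** A polynomial substitute for reflection in the sphere [dotv x x = N]: it fixes that sphere
    pointwise and, for [k] between [1] and [2], throws a shell just inside it to the outside. On the
    sphere its radial derivative is [1 - 2 k]. *)
Definition sphere_refl (N k : R) (x : vec) : vec := (1 + k * (1 - dotv x x / N)) *: x.

Lemma strict_diff_scaler K (x : vec) (f : vec -> R) L : K x -> strict_diff K f x L ->
  strict_diff K (fun y => f y *: y) x (fun u => f x *: u + L u *: x).
Proof.
move=> Kx S; apply: strict_diff_mx => i j.
have c : strict_diff K (fun y : vec => y i j) x (fun u => u i j).
  exact/strict_diff_lin/bounded_linear_coord.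
have := strict_diffM Kx S c.
rewrite (_ : (fun q => f q * q i j) = fun q => (f q *: q) i j); last first.
  by apply/funext => q; rewrite mxE.
by move/strict_diff_eqL; apply => u; rewrite !mxE.
Qed.

Lemma strict_diff_linl E V W K (f : E -> V) (M : V -> W) p L : bounded_linear M ->
  strict_diff K f p L -> strict_diff K (fun q => M (f q)) p (fun u => M (L u)).
Proof.
move=> bM [bL H]; have [lM [C C0 MC]] := bM.
apply: (strict_diffW (C := C)) => //; first exact: bounded_linear_comp bL bM.
move=> e e0 _; have [d d0 Hd] := H e e0; exists d => // q r Kq Kr qd rd.
rewrite -(blB lM) -(blB lM) (le_trans (MC _))// -mulrA ler_pM2l//.
exact: Hd.
Qed.

Lemma strict_diff_affine E K (f : E -> R) p L (a b : R) : strict_diff K f p L ->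
  strict_diff K (fun q => a + b * f q) p (fun u => b * L u).
Proof.
move=> S; have bM : bounded_linear (fun x : R => b * x).
  exact: (bounded_linearZ b (bounded_linear_id R)).
have := strict_diffD (strict_diff_cst K p a) (strict_diff_linl bM S).
by move/strict_diff_eqL; apply => u; rewrite add0r.
Qed.

Lemma strict_diff_sphere_refl K N k (x : vec) : K x ->
  strict_diff K (sphere_refl N k) x (fun u => (1 + k * (1 - dotv x x / N)) *: u -
    (2 * k / N * dotv x u) *: x).
Proof.
move=> Kx; have := strict_diff_scaler Kx
  (strict_diff_affine (1 + k) (- (k / N)) (strict_diff_sqr Kx)).
rewrite (_ : (fun y => _) = sphere_refl N k); last first.
  by apply/funext => y; congr (_ *: _); ring.
move/strict_diff_eqL; apply => u; rewrite -[in RHS](scaleNr _ x) /=; congr (_ *: _ + _ *: _); ring.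
Qed.

Lemma dotvZ (a : R) (x : vec) : dotv (a *: x) (a *: x) = a ^+ 2 * dotv x x.
Proof. by rewrite /dotv mulr_sumr; apply: eq_bigr => i _; rewrite !mxE; ring. Qed.

Lemma dotv_ge0 (x : vec) : 0 <= dotv x x.
Proof. by apply: sumr_ge0 => i _; rewrite -expr2 sqr_ge0. Qed.

Lemma enorm_le (x : vec) (r : R) : 0 <= r -> (enorm x <= r) = (dotv x x <= r ^+ 2).
Proof.
by move=> r0; rewrite -ler_sqr ?nnegrE ?sqrtr_ge0// sqr_sqrtr// dotv_ge0.
Qed.

Lemma coord_le_enorm (x : vec) (r : R) i : 0 <= r -> dotv x x <= r ^+ 2 -> `|x i 0| <= r.
Proof.
move=> r0 H; rewrite -[r]ger0_norm// -ler_sqr ?nnegrE// !real_normK ?num_real//.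
apply: le_trans H; rewrite /dotv (bigD1 i)//= -expr2 lerDl.
by apply: sumr_ge0 => j _; rewrite -expr2 sqr_ge0.
Qed.

Lemma norm_le_enorm (x : vec) (r : R) : 0 <= r -> dotv x x <= r ^+ 2 -> `|x| <= r.
Proof. by move=> r0 H; apply: norm_le_coord => // i; exact: coord_le_enorm. Qed.

(** The squared positive part is the simplest [C^1] function vanishing on a half-line; it serves as
    cutoff where first-order smoothness is enough. *)
Definition pos2 (x : R) : R := (Num.max 0 x) ^+ 2.

Lemma strict_diff_pos2 (c : R) : strict_diff setT pos2 c (fun u => 2 * Num.max 0 c * u).
Proof.
split; first exact: (bounded_linearZ (2 * Num.max 0 c) (bounded_linear_id R)).
(* The derivative [2 * Num.max 0 c] is 2-Lipschitz in [c]. *)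
move=> e e0; exists (e / 2); first by rewrite divr_gt0.
move=> q r _ _; rewrite /pos2 !ltr_norml => /andP[q1 q2] /andP[r1 r2].
have main (x y : R) : y <= x -> - (e / 2) < x - c -> x - c < e / 2 ->
    - (e / 2) < y - c -> y - c < e / 2 ->
    `|Num.max 0 x ^+ 2 - Num.max 0 y ^+ 2 - 2 * Num.max 0 c * (x - y)| <= e * (x - y).
  move=> yx x1 x2 y1 y2; rewrite ler_norml.
  by have [c0|c0] := leP 0 c; have [x0|x0] := leP 0 x; have [y0|y0] := leP 0 y;
     apply/andP; split; nra.
have [qr|/ltW rq] := leP q r; last by rewrite (ger0_norm (_ : 0 <= q - r)) ?subr_ge0// main.
rewrite [`|q - r|]distrC (ger0_norm (_ : 0 <= r - q)) ?subr_ge0// -normrN.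
by rewrite (_ : - _ = Num.max 0 r ^+ 2 - Num.max 0 q ^+ 2 - 2 * Num.max 0 c * (r - q)) ?main//; ring.
Qed.

(** Two moving points may lie on different sides, so equal derivatives at [p] do not suffice: such a
    pair is joined through a common point [m] of both pieces, no farther from either end than the
    ends from each other. *)
Lemma strict_diff_glue E V (K1 K2 : set E) (f h G : E -> V) p L :
  strict_diff K1 f p L -> strict_diff K2 h p L ->
  (forall q, K1 q -> G q = f q) -> (forall q, K2 q -> G q = h q) ->
  (exists2 d : R, 0 < d & forall q r, K1 q -> K2 r -> `|q - p| < d -> `|r - p| < d ->
     exists m, [/\ K1 m, K2 m, `|q - m| <= `|q - r| & `|m - r| <= `|q - r|]) ->
  strict_diff (K1 `|` K2) G p L.
Proof.
move=> [bL H1] [_ H2] Gf Gh [d d0 bridge].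
apply: (strict_diffW (C := 2)) => // e e0 _.
have [d1 d10 {}H1] := H1 e e0; have [d2 d20 {}H2] := H2 e e0.
(* With [q] and [r] within [dl] of [p], the bridge point [m] is only known to be within [3 * dl]. *)
pose dl := Num.min d (Num.min (d1 / 3) (d2 / 3)).
have dl0 : 0 < dl by rewrite !lt_min d0 !divr_gt0.
have dl1 : 3 * dl <= d1.
  by rewrite mulrC -ler_pdivlMr// /dl !ge_min lexx orbT.
have dl2 : 3 * dl <= d2.
  by rewrite mulrC -ler_pdivlMr// /dl !ge_min lexx !orbT.
have dld : dl <= d by rewrite /dl ge_min lexx.
have mixed q r : K1 q -> K2 r -> `|q - p| < dl -> `|r - p| < dl ->
    `|G q - G r - L (q - r)| <= 2 * e * `|q - r|.
  move=> Kq Kr qd rd.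
  have [m [Km1 Km2 qm mr]] := bridge q r Kq Kr (lt_le_trans qd dld) (lt_le_trans rd dld).
  have qr : `|q - r| < 2 * dl.
    have -> : q - r = (q - p) - (r - p) by rewrite opprB addrA subrK.
    rewrite (le_lt_trans (ler_normB _ _))//; lra.
  have mp : `|m - p| < 3 * dl.
    have -> : m - p = (q - p) - (q - m) by rewrite opprB [RHS]addrC addrA subrK.
    rewrite (le_lt_trans (ler_normB _ _))//; lra.
  have q3 : `|q - p| < 3 * dl by lra.
  have r3 : `|r - p| < 3 * dl by lra.
  have Q1 := H1 q m Kq Km1 (lt_le_trans q3 dl1) (lt_le_trans mp dl1).
  have Q2 := H2 m r Km2 Kr (lt_le_trans mp dl2) (lt_le_trans r3 dl2).
  rewrite -(Gf _ Kq) -(Gf _ Km1) in Q1; rewrite -(Gh _ Kr) -(Gh _ Km2) in Q2.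
  have -> : G q - G r - L (q - r) = (G q - G m - L (q - m)) + (G m - G r - L (m - r)).
    by rewrite addrACA -opprD -(blD (proj1 bL)) !addrA !subrK.
  rewrite (le_trans (ler_normD _ _))// -mulrA mulr_natl mulr2n lerD//.
    by rewrite (le_trans Q1)// ler_pM2l.
  by rewrite (le_trans Q2)// ler_pM2l.
exists dl => // q r Kq Kr qd rd.
have ee : e <= 2 * e by lra.
case: Kq => Kq; case: Kr => Kr.
- rewrite !Gf// (le_trans (H1 q r Kq Kr _ _))//; [lra|lra|by rewrite ler_wpM2r].
- exact: mixed.
- rewrite -normrN [`|q - r|]distrC.
  have -> : - (G q - G r - L (q - r)) = G r - G q - L (r - q).
    by rewrite -[r - q]opprB (blN (proj1 bL)) opprK opprD opprB opprK.
  exact: mixed.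
- rewrite !Gh// (le_trans (H2 q r Kq Kr _ _))//; [lra|lra|by rewrite ler_wpM2r].
Qed.

End Extension.

(** * A strictly differentiable extension into the ball *)

Section BallExtension.
Context {R : realType}.
Local Notation vec := (vec R).

Lemma dotvv_cont (x : vec) (e : R) : 0 < e ->
  exists2 d : R, 0 < d & forall y, `|y - x| < d -> `|dotv y y - dotv x x| < e.
Proof.
move=> e0; have [C [d [C0 d0 H]]] := strict_diff_lip (strict_diff_sqr (K := setT) (x := x) I).
exists (Num.min d (e / C)); first by rewrite lt_min d0 divr_gt0.
move=> y; rewrite lt_min => /andP[y1 y2].
rewrite (le_lt_trans (H y x I I y1 _))//; first by rewrite subrr normr0.
by rewrite mulrC -ltr_pdivlMr.
Qed.

Lemma open_dotvv_gt (c : R) : open [set x : vec | c < dotv x x].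
Proof.
rewrite openE => x xc; apply/nbhs_ballP.
have [|d d0 Hd] := @dotvv_cont x (dotv x x - c); first by rewrite subr_gt0.
by exists d => // y; rewrite -ball_normE/= distrC => /Hd; rewrite ltr_norml => /andP[+ _]; lra.
Qed.

(** Along the segment the squared length is a quadratic polynomial in [s], so the intermediate value
    theorem for polynomials applies. The crossing point is the bridge required by
    [strict_diff_glue]. *)
Lemma sphere_crossing (y z : vec) (N : R) : N <= dotv y y -> dotv z z <= N ->
  exists2 s : R, 0 <= s <= 1 & dotv (z + s *: (y - z)) (z + s *: (y - z)) = N.
Proof.
move=> yN zN; pose w := y - z.
have E (s : R) : dotv (z + s *: w) (z + s *: w) = dotv w w * s ^+ 2 + 2 * dotv z w * s + dotv z z.
  move: w => w.
  rewrite /dotv mulr_sumr !mulr_suml -!big_split/=.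
  by apply: eq_bigr => i _; rewrite !mxE; ring.
pose p : {poly R} := (dotv w w)%:P * 'X^2 + (2 * dotv z w)%:P * 'X + (dotv z z - N)%:P.
have pE s : p.[s] = dotv (z + s *: w) (z + s *: w) - N.
  by rewrite E /p !(hornerD, hornerM, hornerC, hornerX, hornerXn) addrA.
have yE : z + 1 *: w = y by rewrite scale1r /w addrC subrK.
have [|s s01] := @poly_ivt _ p 0 1 ler01.
  by rewrite !pE scale0r addr0 yE; apply/andP; split; [rewrite subr_le0|rewrite subr_ge0].
rewrite /root pE subr_eq0 => /eqP sN; exists s => //.
Qed.

(* Reflecting along rays, [2 f(s1 x) - f(s2 x)] matches [f] to first order on the
   sphere, since the radial stretchings [1 - 2] and [1 - 4] of [s1] and [s2] combine to
   [2 (1 - 2) - (1 - 4) = 1].  The reflections are only used in a shell of relative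
   thickness [mu0], which the factor [pos2] cuts off to first order. *)
Lemma extend_ball (R0 T eta : R) (O : set vec) (f b : R -> vec -> R) (L : R -> vec -> vec -> R) :
  0 < R0 -> open O -> 0 < eta ->
  (forall x y, dotv x x <= R0 ^+ 2 -> `|y - x| < eta -> O y) ->
  (forall t x, 0 <= t <= T -> O x -> R0 ^+ 2 <= dotv x x ->
     strict_diff (slab T [set y | O y /\ R0 ^+ 2 <= dotv y y]) (fun p => f p.1 p.2) (t, x)
       (fun u => u.1 * b t x + L t x u.2)) ->
  exists G : R -> vec -> R,
    (forall t x, R0 ^+ 2 <= dotv x x -> G t x = f t x) /\
    forall t x, 0 <= t <= T -> O x -> exists L' : R * vec -> R,
      strict_diff (slab T O) (fun p => G p.1 p.2) (t, x) L' /\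
      (R0 ^+ 2 <= dotv x x -> L' =1 (fun u => u.1 * b t x + L t x u.2)).
Proof.
move=> R00 oO eta0 Oeta Sf.
set N := R0 ^+ 2; have N0 : 0 < N by rewrite exprn_gt0.
set A := [set y | O y /\ N <= dotv y y].
(* Relative depth below the sphere: [1] at the centre, [0] on the sphere, negative outside. *)
pose mu (x : vec) := 1 + (- N^-1) * dotv x x.
have muE x : dotv x x = (1 - mu x) * N by rewrite /mu; field; exact: lt0r_neq0.
have muN x : (N <= dotv x x) = (mu x <= 0).
  by rewrite muE -{1}[N]mul1r ler_pM2r// lerBrDl -lerBrDr subrr.
have muN' x : (dotv x x <= N) = (0 <= mu x).
  by rewrite muE -{2}[N]mul1r ler_pM2r// lerBlDl lerDr.
(* Depth below [1 / 2] gives [(1 + k mu)^2 (1 - mu) >= 1], so reflected points are not inside the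
   ball; depth below [eta / (4 * R0)] keeps the displacement [k mu |x|] under [eta], so they stay in
   [O]. *)
pose mu1 := Num.min (1 / 2) (eta / (4 * R0)).
have mu10 : 0 < mu1 by rewrite lt_min !divr_gt0// mulr_gt0.
have mu1_half : mu1 <= 1 / 2 by rewrite ge_min lexx.
have mu1_eta : mu1 * (4 * R0) <= eta by rewrite -ler_pdivlMr ?mulr_gt0// ge_min lexx orbT.
pose mu0 := mu1 / 2; have mu00 : 0 < mu0 by rewrite divr_gt0.
pose B := [set x | O x /\ 0 <= mu x < mu1].
have sigA k x : 1 <= k -> k <= 2 -> 0 <= mu x < mu1 -> A (sphere_refl N k x).
  move=> k1 k2 /andP[m0 m1]; have rE : sphere_refl N k x = (1 + k * mu x) *: x.
    by rewrite /sphere_refl /mu; congr (_ *: _); ring.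
  have xN : dotv x x <= R0 ^+ 2 by rewrite -/N muN'.
  split; last first.
    rewrite rE dotvZ muE mulrA -{1}[N]mul1r ler_pM2r//.
    move: m0 m1; move: (mu x) => m m0 m1.
    have a1 : m <= k * m by rewrite ler_peMl.
    have a2 : 0 <= k * m * (1 / 2 - m) by rewrite mulr_ge0//; lra.
    have a3 : 0 <= (k * m) ^+ 2 * (1 - m) by rewrite mulr_ge0// ?sqr_ge0//; lra.
    move: (k * m) a1 a2 a3 => a a1 a2 a3; lra.
  apply: (Oeta x) => //.
  have -> : sphere_refl N k x - x = (k * mu x) *: x by rewrite rE scalerDl scale1r addrC addKr.
  rewrite normrZ ger0_norm ?mulr_ge0//; last lra.
  have xR : `|x| <= R0 by apply: norm_le_enorm => //; exact: ltW.
  rewrite (le_lt_trans (ler_wpM2l _ xR))//; first by rewrite mulr_ge0//; lra.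
  apply: lt_le_trans mu1_eta.
  rewrite mulrA ltr_pM2r//; move: m0 m1; move: (mu x) => m m0 m1; nra.
(* This is [1 - (mu / mu0)^2]. It equals [1] with zero derivative on the sphere, so the cutoff [th]
   does not disturb the first-order matching; it is nonpositive from depth [mu0] on, before the
   reflections stop being controlled at [mu1]. *)
pose g x := 1 + (- (mu0 ^- 2)) * (mu x * mu x).
pose th x := pos2 (g x).
pose h t x := th x * (2 * f t (sphere_refl N 1 x) + (-1) * f t (sphere_refl N 2 x)).
pose G t x := if N <= dotv x x then f t x else h t x.
have Gf t x : N <= dotv x x -> G t x = f t x by rewrite /G => ->.
exists G; split=> [t x|t x tT Ox]; first exact: Gf.
have Smu : strict_diff setT mu x (fun u => - N^-1 * (2 * dotv x u)).
  exact: strict_diff_affine (strict_diff_sqr _).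
have Tx : (setT : set vec) x by [].
have Sg := strict_diff_affine 1 (- (mu0 ^- 2)) (strict_diffM Tx Smu Smu).
have [Lth Sth Lth0] : exists2 Lth, strict_diff setT th x Lth & mu x = 0 -> forall u, Lth u = 0.
  have := strict_diff_comp Sg (@strict_diff_pos2 R (g x)) Tx.
  move=> /(_ (ex_intro2 _ _ 1 ltr01 (fun _ _ _ => I))) S; eexists; first exact: S.
  by move=> m0 u; rewrite m0 mul0r mulr0 addr0 !mulr0.
have [d1 d10 Od1] := open_ball_sub oO Ox.
have Sh : 0 <= mu x < mu1 -> exists2 Lh, strict_diff (slab T B) (fun p => h p.1 p.2) (t, x) Lh &
    mu x = 0 -> Lh =1 (fun u => u.1 * b t x + L t x u.2).
  move=> mx.
  have KB : slab T B (t, x) by [].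
  have Sthp := strict_diff_snd (p := (t, x)) Sth KB (fun _ _ => I).
  have Sr k : 1 <= k -> k <= 2 -> strict_diff (slab T B) (fun p => f p.1 (sphere_refl N k p.2)) (t, x)
      (fun u => u.1 * b t (sphere_refl N k x) + L t (sphere_refl N k x)
         ((1 + k * (1 - dotv x x / N)) *: u.2 - (2 * k / N * dotv x u.2) *: x)).
    move=> k1 k2; have [Or Nr] := sigA k x k1 k2 mx.
    have Sp := strict_diff_pair (strict_diff_lin (slab T B) (t, x) (bounded_linear_fst R vec))
      (strict_diff_snd (p := (t, x)) (strict_diff_sphere_refl N k Tx) KB (fun _ _ => I)).
    apply: (strict_diff_comp Sp (Sf t _ tT Or Nr)) => //.
    exists 1 => // -[s y] [/= sT [Oy my]] _; split => //; exact: sigA.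
  have S1 := Sr 1 (lexx _) (ler1n R 2); have S2 := Sr 2 (ler1n R 2) (lexx _).
  have bl (c : R) : bounded_linear (fun z : R => c * z).
    exact: (bounded_linearZ c (bounded_linear_id R)).
  have := strict_diffM KB Sthp (strict_diffD (strict_diff_linl (bl 2) S1) (strict_diff_linl (bl (-1)) S2)).
  move=> Shx; eexists; first exact: Shx.
  move=> mx0 u /=.
  have xN : dotv x x = N by rewrite muE mx0 subr0 mul1r.
  have rx k : sphere_refl N k x = x.
    by rewrite /sphere_refl xN divff ?lt0r_neq0// subrr mulr0 addr0 scale1r.
  have gx : g x = 1 by rewrite /g mx0 mul0r mulr0 addr0.
  have thx : th x = 1 by rewrite /th gx /pos2 (max_idPr ler01) expr1n.
  rewrite thx mul1r Lth0// mul0r addr0 !rx xN.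
  rewrite divff ?lt0r_neq0// subrr !mulr0 addr0 !scale1r.
  have [lL _] : bounded_linear (fun u : R * vec => u.1 * b t x + L t x u.2).
    by have [|[]] := Sf t x tT Ox; first by rewrite xN.
  set v1 := u.2 - _; set v2 := u.2 - _.
  transitivity (2 * (u.1 * b t x + L t x v1) - (u.1 * b t x + L t x v2)); first by ring.
  have -> : u.1 * b t x + L t x u.2 =
      (fun w : R * vec => w.1 * b t x + L t x w.2) (2 *: (u.1, v1) - (u.1, v2)).
    congr (_ * b t x + L t x _) => /=; first by rewrite scaler_nat mulr2n addrK.
    by apply/matrixP => i j; rewrite /v1 /v2 !mxE; ring.
  by rewrite (blB lL) (blZ lL).
have Gh t' x' : dotv x' x' < N -> G t' x' = h t' x' by rewrite /G ltNge => /negbTE ->.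
have [xN|xN|xN] := ltgtP (dotv x x) N.
- have [mx|mx] := ltP (mu x) mu1.
    have mx0 : 0 <= mu x by rewrite -muN' ltW.
    have [|Lh SLh _] := Sh; first by rewrite mx0.
    exists Lh; split=> //.
    have [|d2 d20 Hd2] := @dotvv_cont x (Num.min (N - dotv x x) (dotv x x - (1 - mu1) * N)).
      by rewrite lt_min !subr_gt0 xN muE/= ltr_pM2r// ltrD2l ltrN2.
    apply: (strict_diff_near SLh) => //.
    exists (Num.min d1 d2); first by rewrite lt_min d10.
    move=> [s y] [/= sT Oy]; rewrite prod_norm_lt/= !lt_min => /andP[_ /andP[_ y2]].
    have := Hd2 y y2; rewrite lt_min => /andP[y3 y4].
    have yN : dotv y y < N.
      have := le_lt_trans (ler_norm _) y3; lra.
    split; last by rewrite Gh.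
    do 2!split => //; rewrite -muN' (ltW yN)/=.
    have : (1 - mu1) * N < dotv y y.
      by move: y4; rewrite ltr_norml => /andP[+ _]; lra.
    by rewrite muE ltr_pM2r// ltrD2l ltrN2.
  (* At depth at least [mu1], hence strictly beyond [mu0], the cutoff vanishes on a whole
     neighbourhood. *)
  exists (fun=> 0); split=> //.
  have [|d2 d20 Hd2] := @dotvv_cont x (Num.min (N - dotv x x) ((1 - mu0) * N - dotv x x)).
    rewrite lt_min !subr_gt0 xN muE/= ltr_pM2r// ltrD2l ltrN2 (lt_le_trans _ mx)//.
    by rewrite /mu0 ltr_pdivrMr// ltr_pMr// ltr1n.
  apply: (strict_diff_near (strict_diff_cst setT (t, x) 0)) => //.
  exists d2 => // -[s y] [/= sT Oy]; rewrite prod_norm_lt/= => /andP[_ y2]; split=> //.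
  have := Hd2 y y2; rewrite lt_min => /andP[/(le_lt_trans (ler_norm _)) y3 /(le_lt_trans (ler_norm _)) y4].
  have yN : dotv y y < N by lra.
  have y0 : mu0 < mu y.
    have : dotv y y < (1 - mu0) * N by lra.
    by rewrite muE ltr_pM2r// ltrD2l ltrN2.
  have gy : g y <= 0.
    rewrite /g mulNr subr_le0 mulrC ler_pdivlMr ?exprn_gt0// mul1r -expr2.
    by rewrite ler_sqr ?nnegrE ltW// (lt_trans mu00).
  by rewrite Gh// /h /th /pos2 (max_idPl gy) expr0n/= mul0r.
- have [|d2 d20 Hd2] := @dotvv_cont x (dotv x x - N); first by rewrite subr_gt0.
  exists (fun u => u.1 * b t x + L t x u.2); split=> //.
  apply: (strict_diff_near (Sf t x tT Ox (ltW xN))) => //.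
  exists d2 => // -[s y] [/= sT Oy]; rewrite prod_norm_lt/= => /andP[_ y2].
  have yN : N <= dotv y y.
    by move: (Hd2 y y2); rewrite ltr_norml => /andP[+ _]; lra.
  by split; [|exact: Gf].
- have mx0 : mu x = 0 by rewrite /mu xN mulNr mulVf ?subrr// lt0r_neq0.
  have [|Lh SLh /(_ mx0) LhE] := Sh; first by rewrite mx0 lexx.
  have Nx : N <= dotv x x by rewrite xN.
  exists (fun u => u.1 * b t x + L t x u.2); split=> //.
  have SA := Sf t x tT Ox Nx.
  have GA q : slab T A q -> G q.1 q.2 = f q.1 q.2 by move=> [_ [_ ?]]; exact: Gf.
  (* [B] contains the sphere, where [G] is [f]. There [th] is [1] and both reflections fix the
     point, so [h] is [2 f - f]. *)
  have GB q : slab T B q -> G q.1 q.2 = h q.1 q.2.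
    move=> [_ [_ /andP[]]]; rewrite -muN' le_eqVlt => /orP[/eqP qN _|qN _]; last exact: Gh.
    have mq : mu q.2 = 0 by rewrite /mu qN mulNr mulVf ?subrr// lt0r_neq0.
    rewrite Gf ?qN// /h.
    have rq k : sphere_refl N k q.2 = q.2.
      by rewrite /sphere_refl qN divff ?lt0r_neq0// subrr mulr0 addr0 scale1r.
    have gq : g q.2 = 1 by rewrite /g mq mul0r mulr0 addr0.
    by rewrite /th gq /pos2 (max_idPr ler01) expr1n mul1r !rq; ring.
  have Sgl := strict_diff_glue SA (strict_diff_eqL SLh LhE) GA GB.
  have [|d2 d20 Hd2] := @dotvv_cont x (mu1 * N); first by rewrite mulr_gt0.
  have small y : `|y - x| < d2 -> mu y < mu1.
    move=> /Hd2; rewrite xN distrC => /(le_lt_trans (ler_norm _)).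
    by rewrite muE -{1}[N]mul1r -mulrBl ltr_pM2r// opprB addrC subrK.
  apply: strict_diff_near (Sgl _) _ _ => //.
    exists (Num.min d1 d2); first by rewrite lt_min d10.
    move=> [s y] [s' z] [/= sT [Oy yN]] [/= s'T [Oz /andP[mz _]]].
    rewrite !prod_norm_lt/= !lt_min => /andP[_ /andP[y1 y2]] /andP[/andP[s'1 s'2] /andP[z1 z2]].
    rewrite -muN' in mz.
    have [r r01 mN] := sphere_crossing yN mz; set m := z + r *: (y - z) in mN.
    have Om : O m by apply: Od1; exact: line_near.
    have mm : mu m = 0 by rewrite /mu mN mulNr mulVf ?subrr// lt0r_neq0.
    (* The bridge carries the time of the inner point, so each leg is bounded by the pair component
       by component. *)
    exists (s', m); split.
    - by split => //; split=> //; rewrite mN.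
    - by split => //; split=> //; rewrite mm lexx.
    - rewrite !prod_normE/= ge_max !le_max lexx/=; apply/orP; right.
      have -> : y - m = (1 - r) *: (y - z) by apply/matrixP => i j; rewrite !mxE; ring.
      by case/andP: r01 => r0 r1; rewrite normrZ ger0_norm ?subr_ge0// ler_piMl// gerBl.
    - rewrite !prod_normE/= subrr normr0 ge_max !le_max normr_ge0/=; apply/orP; right.
      have -> : m - z = r *: (y - z) by rewrite /m addrC addKr.
      by case/andP: r01 => r0 r1; rewrite normrZ ger0_norm// ler_piMl.
  exists d2 => // -[s y] [/= sT Oy]; rewrite prod_norm_lt/= => /andP[_ y2]; split=> //.
  have [yN|yN] := leP N (dotv y y); first by left; split.
  by right; split => //; split=> //; rewrite -muN' (ltW yN) small.
Qed.

End BallExtension.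

(** * The potential *)

Section Potential.
Context {R : realType}.
Local Notation vec := (vec R).

Lemma strict_diff_setT_comp (E : normedModType R) (K : set E) (f : E -> R) (g : R -> R) p L M :
  K p -> strict_diff K f p L -> strict_diff setT g (f p) M ->
  strict_diff K (fun q => g (f q)) p (fun u => M (L u)).
Proof. by move=> Kp Sf Sg; apply: (strict_diff_comp Sf Sg) => //; exists 1. Qed.

Lemma strict_diff_powR (a p : R) : 0 < p ->
  strict_diff setT (fun x => x `^ a) p (fun u => a * p `^ (a - 1) * u).
Proof.
move=> p0; apply: (@strict_diff_real _ _ (fun x => a * x `^ (a - 1))).
  exists p => // x xp; apply: is_derive1_powR.
  by move: xp; rewrite ltr_norml => /andP[+ _]; lra.
have cp : {for p, continuous (fun x : R => x `^ (a - 1))}.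
  apply: differentiable_continuous; apply/derivable1_diffP.
  by have [] := is_derive1_powR (a - 1) p0.
exact: cvgM (cvg_cst _) cp.
Qed.

Lemma strict_diff_cutoff chi (p : R) : cutoff_chi chi ->
  strict_diff setT chi p (fun u => chi^`()%classic p * u).
Proof.
move=> [dchi _]; apply: (@strict_diff_real _ _ chi^`()%classic).
  exists 1 => // x _; rewrite derive1E; apply: derivableP; exact: (dchi 0%N x).
apply: differentiable_continuous; apply/derivable1_diffP; exact: (dchi 1%N p).
Qed.

(** As a real power of a polynomial, the norm and its inverse are both covered by one chain rule
    away from the origin. *)
Lemma enorm_powR (x : vec) : enorm x = dotv x x `^ (2^-1).
Proof. by rewrite powR12_sqrt// dotv_ge0. Qed.

Lemma strict_diff_Phipot (GM0 R0 Om : R) chi (x : vec) : cutoff_chi chi -> 0 < dotv x x ->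
  exists L, strict_diff [set y : vec | 0 < dotv y y] (Phipot GM0 R0 Om chi) x L.
Proof.
move=> Hchi x0; set K := [set y : vec | 0 < dotv y y].
have Kx : K x by [].
have S2 := strict_diff_sqr Kx.
have Sn a := strict_diff_setT_comp Kx S2 (strict_diff_powR a x0).
have c (i : 'I_3) : strict_diff K (fun y : vec => y i 0) x (fun u => u i 0).
  exact/strict_diff_lin/bounded_linear_coord.
have cc i := strict_diffM Kx (c i) (c i).
have Schi := strict_diff_setT_comp Kx (strict_diff_affine 0 (R0^-1) (Sn 2^-1)) (strict_diff_cutoff _ Hchi).
have := strict_diffM Kx Schi (strict_diffD (strict_diff_affine 0 (- GM0) (Sn (- 2^-1)))
  (strict_diff_affine 0 (- (Om ^+ 2 / 2)) (strict_diffD (cc 0) (cc 1)))).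
move=> S; eexists; apply: (strict_diff_near S) => //.
exists 1 => // y Ky _; split=> //; rewrite /Phipot enorm_powR !add0r.
rewrite [R0^-1 * _]mulrC; congr (_ * _).
rewrite powRN !expr2; ring.
Qed.

Lemma jcont_grad_Phipot (GM0 R0 Om T : R) chi i : cutoff_chi chi ->
  jcont T [set y : vec | 0 < dotv y y] (fun _ y => pdv (Phipot GM0 R0 Om chi) i y).
Proof.
move=> Hchi.
have oK := @open_dotvv_gt R 0.
have /choice[L HL] : forall y : vec, exists L, 0 < dotv y y ->
    strict_diff [set y : vec | 0 < dotv y y] (Phipot GM0 R0 Om chi) y L.
  move=> y; have [y0|y0] := ltP 0 (dotv y y); last by exists (fun=> 0).
  by have [L HL] := strict_diff_Phipot GM0 R0 Om Hchi y0; exists L.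
have S s y : 0 <= s <= T -> [set y : vec | 0 < dotv y y] y ->
    space_strict T [set y : vec | 0 < dotv y y] (fun _ => Phipot GM0 R0 Om chi) s y (L y).
  move=> sT Ky; have [bL H] := HL y Ky; split=> // e /H[d d0 {}H].
  by exists d => // s' z w _ Kz Kw _; exact: H.
apply: jcont_eq (space_strict_derive_cont oK S (ebasis R i)) => t x tT Kx.
exact: space_strict_pdv (S t x tT Kx).
Qed.

Lemma dotvv_gt0 (x : vec) : x != 0 -> 0 < dotv x x.
Proof.
move=> x0; rewrite lt_def dotv_ge0 andbT; apply: contraNneq x0 => /eqP.
rewrite psumr_eq0 => [/allP H|i _]; last by rewrite -expr2 sqr_ge0.
apply/eqP/matrixP => i j; rewrite (ord1 j) mxE.
by have := H i (mem_index_enum i); rewrite /= -expr2 sqrf_eq0 => /eqP.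
Qed.

End Potential.

(** * The flow map and its inverse *)

Section Flow.
Context {R : realType}.
Local Notation vec := (vec R).
Implicit Types V : normedModType R.

Lemma within_cont_eps V (A : set vec) (g : vec -> V) x : {within closure A, continuous g} ->
  A x -> forall e : R, 0 < e ->
  exists2 d : R, 0 < d & forall y, A y -> `|y - x| < d -> `|g y - g x| < e.
Proof.
move=> /subspace_continuousP cg Ax e e0.
have /cvgrPdist_lt/(_ e e0) := cg x (subset_closure Ax).
rewrite near_withinE => /nbhs_normP[d /= d0 Hd]; exists d => // y Ay yx.
by rewrite distrC; apply: Hd; [rewrite /= distrC|exact: subset_closure].
Qed.

Lemma CkCl_cont V k (A : set vec) (f : vec -> V) l x : CkCl k A f -> (size l <= k)%N -> A x ->
  forall e : R, 0 < e ->
  exists2 d : R, 0 < d & forall y, A y -> `|y - x| < d -> `|pdlv l f y - pdlv l f x| < e.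
Proof.
move=> [cf _ H] lk Ax e e0; case: l lk => [|i l] lk.
  exact: within_cont_eps cf Ax e e0.
have [|g [fg cg]] := H (i :: l); first by [].
have [d d0 Hd] := within_cont_eps cg Ax e0.
by exists d => // y Ay yx; rewrite !fg//; exact: Hd.
Qed.

(** Continuity in time is uniform in the space point, so it adds to continuity in space at the fixed
    time [t]. *)
Lemma contC_jcont V k (A : set vec) T (F : R -> vec -> V) l : contC k A T F -> (size l <= k)%N ->
  jcont T A (fun t => pdlv l (F t)).
Proof.
move=> [HF1 HF2] lk t x tT Ax e e0; have e2 : 0 < e / 2 by rewrite divr_gt0.
have [d1 d10 H1] := CkCl_cont (HF1 t tT) lk Ax e2.
have [d2 [d20 H2]] := HF2 t tT _ e2.
exists (Num.min d1 d2); split=> [|s y sT Ay]; first by rewrite lt_min d10.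
rewrite !lt_min => /andP[s1 s2] /andP[y1 y2].
have q1 := H1 y Ay y1; have q2 := H2 s sT s2 l lk y Ay.
have -> : pdlv l (F s) y - pdlv l (F t) x =
  (pdlv l (F s) y - pdlv l (F t) y) + (pdlv l (F t) y - pdlv l (F t) x) by rewrite addrA subrK.
rewrite (le_lt_trans (ler_normD _ _))//; lra.
Qed.

Lemma coord_differentiable m n (f : vec -> 'M[R]_(m, n)) x i j : differentiable f x ->
  differentiable (fun y => f y i j) x /\
  forall k, pdv (fun y => f y i j) k x = (pdv f k x) i j.
Proof.
move=> df.
have dc : differentiable (fun A : 'M[R]_(m, n) => A i j) (f x) by exact: differentiable_coord.
have dfc : differentiable ((fun A : 'M[R]_(m, n) => A i j) \o f) x by exact: differentiable_comp.
split=> // k; rewrite /pdv (deriveE _ dfc) diff_comp// deriveE//=.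
pose c : {linear 'M[R]_(m, n) -> R} := HB.pack (fun A : 'M[R]_(m, n) => A i j)
  (GRing.isLinear.Build _ _ _ _ _ (proj1 (bounded_linear_coord i j))).
by rewrite (diff_lin (f := c)) //; move=> A; exact: coord_continuous.
Qed.

Lemma has_tder_coord T m n (f : R -> 'M[R]_(m, n)) t d i j : has_tder T f t d ->
  has_tder T (fun s => f s i j) t (d i j).
Proof.
move=> H e /H[dl [dl0 {}H]]; exists dl; split=> // s sT nst st.
apply: le_trans (H s sT nst st); rewrite [leRHS]mx_normrE.
have := le_bigmax (0 : R)
  (fun ij : 'I_m * 'I_n => `|((s - t)^-1 *: (f s - f t) - d) ij.1 ij.2|) (i, j).
by rewrite !mxE.
Qed.

Lemma space_strict_jacv T (A : set vec) (F : R -> vec -> vec) t x :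
  open A -> contC 1 A T F -> 0 <= t <= T -> A x ->
  space_strict T A F t x (fun u => jacv (F t) x *m u).
Proof.
move=> oA cF tT Ax; apply: space_strict_mx => i j; rewrite (ord1 j) {j}.
have dF s y : 0 <= s <= T -> A y -> differentiable (F s) y.
  by move=> sT Ay; have [_ /(_ [::]) H _] := cF.1 s sT; exact: H.
have := @space_strict_C1 _ T A (fun s y => F s y i 0) t x oA tT Ax.
move=> /(_ _ _)[|k|bL H].
- by move=> s y sT Ay; have [] := coord_differentiable i 0 (dF s y sT Ay).
- apply: jcont_eq (jcont_coord i 0 (contC_jcont (l := [:: k]) cF isT)) => s y sT Ay.
  by have [_ ->] := coord_differentiable i 0 (dF s y sT Ay).
have E : (fun u : vec => \sum_k u k 0 * pdv (fun y => F t y i 0) k x) =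
    (fun u => (jacv (F t) x *m u) i 0).
  apply/funext => u; rewrite mxE; apply: eq_bigr => k _; rewrite mxE mulrC.
  by have [_ ->] := coord_differentiable i 0 (dF t x tT Ax).
by rewrite -E.
Qed.

Lemma time_strict_mx m n T (A : set vec) (f : R -> vec -> 'M[R]_(m, n)) t x
    (a : 'M[R]_(m, n)) :
  (forall i j, time_strict T A (fun s y => f s y i j) t x (a i j)) -> time_strict T A f t x a.
Proof.
move=> H e e0.
have [|ij|d d0 Hd] := @common_delta _ ('I_m * 'I_n)%type (fun ij d =>
    forall s s' z, 0 <= s <= T -> 0 <= s' <= T -> A z -> `|s - t| < d -> `|s' - t| < d ->
      `|z - x| < d -> `|f s z ij.1 ij.2 - f s' z ij.1 ij.2 - (s - s') *: a ij.1 ij.2| <=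
        e * `|s - s'|).
- move=> ij d d' dd' Hd s s' z sT s'T Az sd s'd zd.
  by apply: Hd => //; exact: lt_le_trans dd'.
- exact: H ij.1 ij.2 e e0.
exists d => // s s' z sT s'T Az sd s'd zd; rewrite [leLHS]mx_normrE.
apply: bigmax_le => [|ij _]; first by rewrite mulr_ge0// ltW.
by rewrite !mxE; exact: Hd.
Qed.

Lemma time_strict_C1 m n T (A : set vec) (f a : R -> vec -> 'M[R]_(m, n)) t x :
  jcont T A f -> jcont T A a ->
  (forall s z, 0 <= s <= T -> A z -> has_tder T (fun r => f r z) s (a s z)) ->
  0 <= t <= T -> A x -> time_strict T A f t x (a t x).
Proof.
move=> cf ca H tT Ax; apply: time_strict_mx => i j.
apply: (time_strict_tder (A' := A) (a := fun s y => a s y i j)) => //.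
- by move=> z Az d d0; exists z => //; rewrite subrr normr0.
- exact: jcont_coord.
- exact: jcont_coord.
- by move=> s z sT Az; apply: has_tder_coord; exact: H.
Qed.

Lemma jcont_mx m n T (A : set vec) (f : R -> vec -> 'M[R]_(m, n)) :
  (forall i j, jcont T A (fun t x => f t x i j)) -> jcont T A f.
Proof.
move=> H t x tT Ax e e0.
have [|ij|d d0 Hd] := @common_delta _ ('I_m * 'I_n)%type (fun ij d => forall s y,
  0 <= s <= T -> A y -> `|s - t| < d -> `|y - x| < d ->
  `|f s y ij.1 ij.2 - f t x ij.1 ij.2| < e).
- by move=> ij d d' dd' Hd s y sT Ay sd yd; apply: Hd => //; exact: lt_le_trans dd'.
- by have [d [d0 Hd]] := H ij.1 ij.2 t x tT Ax e e0; exists d.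
exists d; split=> // s y sT Ay sd yd; rewrite [ltLHS]mx_normrE.
by apply: bigmax_lt => // -[i j] _; rewrite !mxE; exact: (Hd (i, j)).
Qed.

Lemma jcont_jacv T (A : set vec) (F : R -> vec -> vec) : contC 1 A T F ->
  jcont T A (fun t => jacv (F t)).
Proof.
move=> cF; apply: jcont_mx => i j.
apply: jcont_eq (jcont_coord i 0 (contC_jcont (l := [:: j]) cF isT)) => t x _ _.
by rewrite mxE.
Qed.

(** * Strict derivatives of the flow, its Jacobian matrix and [Ups^L] *)

Section FlowMap.
Variables (T : R) (A : set vec) (phi dphi : R -> vec -> vec).
Hypotheses (oA : open A) (C11 : C1C1 A T phi dphi) (C2 : contC 2 A T phi).

Lemma strict_diff_flow t x : 0 <= t <= T -> A x ->
  strict_diff (slab T A) (fun p => phi p.1 p.2) (t, x)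
    (fun u => u.1 *: dphi t x + Fmat phi t x *m u.2).
Proof.
move=> tT Ax; have [c1 c2 td] := C11.
have S : space_strict T A phi t x (fun u => Fmat phi t x *m u) by exact: space_strict_jacv.
have H : time_strict T A phi t x (dphi t x).
  apply: (time_strict_C1 (a := dphi)) => //.
  - exact: (contC_jcont (l := [::]) c1).
  - exact: (contC_jcont (l := [::]) c2).
  - move=> s z sT Az e /(td s sT)[d [d0 Hd]]; exists d; split=> // r rT rs rd.
    exact: (Hd r rT rs rd [::]).
exact: (strict_diff_space_time (fun _ (Ay : A _) => Ay) S H).
Qed.

(** Exchanging the time derivative with the Jacobian is built into differentiability with values in
    [C^1]: the difference quotients converge for words [[:: j]] too. *)
Lemma has_tder_Fmat t x : 0 <= t <= T -> A x ->
  has_tder T (fun s => Fmat phi s x) t (jacv (dphi t) x).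
Proof.
move=> tT Ax e; have [_ _ td] := C11; move=> e0; have [d [d0 Hd]] := td t tT e e0.
exists d; split=> // r rT rs rd; rewrite [leLHS]mx_normrE.
apply: bigmax_le => [|[i j] _]; first exact: ltW.
rewrite !mxE /=; apply: le_trans (Hd r rT rs rd [:: j] isT x Ax).
by have := coord_le_norm ((r - t)^-1 *: (pdv (phi r) j x - pdv (phi t) j x) - pdv (dphi t) j x) i;
  rewrite !mxE.
Qed.

(** The second space derivatives of [phi] give the spatial part and the [C^1] time derivative the
    temporal one. Only the latter is named, since it alone survives in the equation for [U]. *)
Lemma strict_diff_Fmat t x : 0 <= t <= T -> A x ->
  exists L, strict_diff (slab T A) (fun p => Fmat phi p.1 p.2) (t, x) L /\
    L (1, 0) = jacv (dphi t) x.
Proof.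
move=> tT Ax; have [c1 c2 _] := C11.
have dphi2 j s y : 0 <= s <= T -> A y -> differentiable (pdv (phi s) j) y.
  by move=> sT Ay; have [_ /(_ [:: j]) H _] := C2.1 s sT; exact: H.
have Sij i j := @space_strict_C1 _ T A (fun s y => Fmat phi s y i j) t x oA tT Ax.
have FE i j s : (fun y => Fmat phi s y i j) = (fun y => pdv (phi s) j y i 0).
  by apply/funext => y; rewrite mxE.
have {}Sij : forall i j, space_strict T A (fun s y => Fmat phi s y i j) t x
    (fun u => \sum_k u k 0 * pdv (fun y => Fmat phi t y i j) k x).
  move=> i j; apply: Sij => [s y sT Ay|k].
    by rewrite FE; have [] := coord_differentiable i 0 (dphi2 j s y sT Ay).
  apply: jcont_eq (jcont_coord i 0 (contC_jcont (l := [:: k; j]) C2 isT)) => s y sT Ay.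
  by rewrite FE; have [_ ->] := coord_differentiable i 0 (dphi2 j s y sT Ay).
have SF : space_strict T A (Fmat phi) t x
    (fun u => \matrix_(i, j) \sum_k u k 0 * pdv (fun y => Fmat phi t y i j) k x).
  apply: space_strict_mx => i j; set M := (X in space_strict _ _ _ _ _ X).
  rewrite (_ : M = (fun u : vec => \sum_k u k 0 * pdv (fun y => Fmat phi t y i j) k x)).
    exact: Sij.
  by apply/funext => u; rewrite /M mxE.
have TF : time_strict T A (Fmat phi) t x (jacv (dphi t) x).
  apply: (time_strict_C1 (a := fun s y => jacv (dphi s) y)) => //.
  - exact: jcont_jacv.
  - exact: jcont_jacv.
  - by move=> s z sT Az; exact: has_tder_Fmat.
have := strict_diff_space_time (fun _ (Ay : A _) => Ay) SF TF.
move=> S; eexists; split; first exact: S.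
by rewrite /= scale1r (bl0 (proj1 (proj1 SF))) addr0.
Qed.

(** Jacobi's formula and the power rule produce the adjugate over the determinant, that is
    [invmx F]. The trace is the divergence of the velocity seen from the reference point. *)
Lemma strict_diff_upsL gam ups0 t x : CkCl 1 A ups0 -> 0 <= t <= T -> A x ->
  0 < \det (Fmat phi t x) ->
  exists L, strict_diff (slab T A) (fun p => upsL gam ups0 phi p.1 p.2) (t, x) L /\
    L (1, 0) = - (gam - 1) * upsL gam ups0 phi t x *
      \tr (invmx (Fmat phi t x) *m jacv (dphi t) x).
Proof.
move=> Hups tT Ax det0; have K : slab T A (t, x) by [].
have [LF [SF LF1]] := strict_diff_Fmat tT Ax.
have cups : contC 1 A T (fun _ => ups0).
  by split=> // s sT e e0; exists 1; split=> // *; rewrite subrr normr0 ltW.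
have dups y : A y -> differentiable ups0 y.
  by move=> Ay; have [_ /(_ [::]) H _] := Hups; exact: H.
have S0 : space_strict T A (fun _ => ups0) t x (fun u => \sum_k u k 0 * pdv ups0 k x).
  apply: (@space_strict_C1 _ T A (fun _ => ups0)) => // [s y sT Ay|k]; first exact: dups.
  exact: (contC_jcont (l := [:: k]) cups).
have T0 : time_strict T A (fun _ => ups0) t x 0.
  move=> e e0; exists 1 => // *.
  by rewrite subrr scaler0 subrr normr0 mulr_ge0// ltW.
have Su := strict_diff_space_time (fun _ (Ay : A _) => Ay) S0 T0.
have Sd := strict_diff_setT_comp K (strict_diff_det K SF) (strict_diff_powR (- (gam - 1)) det0).
have := strict_diffM K Su Sd.
move=> S; eexists; split; first exact: S.
rewrite /= LF1 scaler0 add0r (bl0 (proj1 (proj1 S0))) mul0r addr0 /upsL.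
set d := \det _ in det0 *; set a := - (gam - 1).
have -> : invmx (Fmat phi t x) = d^-1 *: \adj (Fmat phi t x).
  by rewrite /invmx unitmxE unitfE lt0r_neq0.
rewrite -scalemxAl mxtraceZ.
have -> : d `^ (a - 1) = d `^ a / d.
  by rewrite powRD ?powR_inv1 ?ltW//; apply/implyP; rewrite lt0r_neq0.
ring.
Qed.

End FlowMap.
End Flow.

(** * Compactness margins and maps close to the identity *)

Section NearIdentity.
Context {R : realType}.
Local Notation vec := (vec R).

(** Half the radius available at [x] serves every point of the half ball around [x], and compactness
    makes the choice uniform. *)
Lemma compact_open_margin (K O : set vec) : compact K -> open O -> K `<=` O ->
  exists2 eta : R, 0 < eta & forall x y, K x -> `|y - x| < eta -> O y.
Proof.
move=> /compact_near_coveringP cK oO KO.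
have H : \forall e \near (0 : R)^'+, K `<=` (fun x => forall y, `|y - x| < e -> O y).
  apply: cK => x Kx.
  have [d d0 Hd] := open_ball_sub oO (KO x Kx).
  have d2 : 0 < d / 2 by rewrite divr_gt0.
  exists (ball x (d / 2), [set e | e < d / 2]) => /=.
    split; first exact: nbhsx_ballx.
    exact: nbhs_right_lt.
  move=> [x' e] /= [+ ed] y yx'; rewrite -ball_normE/= => xx'.
  apply: Hd; have -> : y - x = (y - x') - (x - x') by rewrite opprB addrA subrK.
  rewrite (le_lt_trans (ler_normB _ _))//; lra.
have /filter_ex[eta [eta0 Heta]] : \forall e \near (0 : R)^'+,
    0 < e /\ K `<=` (fun x => forall y, `|y - x| < e -> O y).
  near=> e; split; first by [].
  by near: e; exact: H.
by exists eta => // x y Kx; exact: Heta.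
Unshelve. all: by end_near. Qed.

Lemma dotv_le (u w : vec) : `|dotv u w| <= 3 * `|u| * `|w|.
Proof.
rewrite /dotv (le_trans (ler_norm_sum _ _ _))//.
have -> : 3 * `|u| * `|w| = \sum_(k < 3) (`|u| * `|w|) by rewrite sumr_const card_ord; ring.
by apply: ler_sum => i _; rewrite normrM ler_pM// coord_le_norm.
Qed.

Lemma dotvv_scale_add (a p e : vec) (l : R) :
  dotv (a + l *: p + e) (a + l *: p + e) = dotv a a + 2 * l * dotv a p + 2 * dotv a e +
    l ^+ 2 * dotv p p + 2 * l * dotv p e + dotv e e.
Proof.
rewrite /dotv !mulr_sumr -!big_split/=.
by apply: eq_bigr => i _; rewrite !mxE; ring.
Qed.

Lemma dotvBl (a b c : vec) : dotv (a - b) c = dotv a c - dotv b c.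
Proof. by rewrite /dotv -sumrB; apply: eq_bigr => i _; rewrite !mxE; ring. Qed.

(* Write [y = (1 + l) p] with [p] on the sphere; then [f y = f p + l p + e] where [e] is
   small compared with [l], so that [|f y|^2 - |f p|^2] has the sign of [l]. *)
Lemma radial_order (f : vec -> vec) (O : set vec) (R0 : R) : 0 < R0 ->
  (forall y, dotv y y <= R0 ^+ 2 -> O y) ->
  (forall y, O y -> `|f y - y| <= R0 / 48) ->
  (forall y z, O y -> O z -> `|f y - y - (f z - z)| <= 1 / 48 * `|y - z|) ->
  (forall p, dotv p p = R0 ^+ 2 -> dotv (f p) (f p) = R0 ^+ 2) ->
  forall y, O y -> (R0 ^+ 2 < dotv y y -> R0 ^+ 2 < dotv (f y) (f y)) /\
    (dotv y y < R0 ^+ 2 -> dotv (f y) (f y) < R0 ^+ 2).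
Proof.
move=> R00 BO small lip sph y Oy; set N := R0 ^+ 2; have N0 : 0 < N by rewrite exprn_gt0.
(* The origin has no radial projection; there the bound [R0 / 48] on the displacement already puts
   the image well inside. *)
have [y0|y0] := eqVneq y 0.
  have yy0 : dotv y y = 0 by rewrite y0 /dotv big1// => i _; rewrite mxE mul0r.
  rewrite yy0; split=> [/(lt_trans N0)|_]; first by rewrite ltxx.
  have := small y Oy; rewrite y0 subr0 => H.
  rewrite (le_lt_trans (ler_norm _))// (le_lt_trans (dotv_le _ _))//.
  have := normr_ge0 (f 0); rewrite /N; nra.
have yy0 := dotvv_gt0 y0; pose r := enorm y.
have r0 : 0 < r by rewrite sqrtr_gt0.
have rr : r ^+ 2 = dotv y y by rewrite sqr_sqrtr// ltW.
pose p := (R0 / r) *: y.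
have pN : dotv p p = N by rewrite dotvZ -rr /N; field; exact: lt0r_neq0.
have Op : O p by apply: BO; rewrite pN.
pose l := (r - R0) / R0.
have yE : y = p + l *: p.
  rewrite /p /l scalerA -scalerDl -[LHS]scale1r; congr (_ *: _).
  by field; rewrite !lt0r_neq0.
have yN : dotv y y = (1 + l) ^+ 2 * N.
  by rewrite -rr /l /N; field; exact: lt0r_neq0.
have l1 : -1 < l by rewrite /l ltr_pdivlMr// mulN1r ltrDr.
pose e := f y - y - (f p - p).
have yp : y - p = l *: p by rewrite {1}yE addrC addKr.
have fyE : f y = f p + l *: p + e.
  have G (a b c d : vec) : a = b + (c - d) + (a - c - (b - d)).
    by apply/matrixP => i j; rewrite !mxE; ring.
  by rewrite -yp; exact: G.
have pR : `|p| <= R0 by apply: norm_le_enorm; [exact: ltW|rewrite pN].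
have fpN : dotv (f p) (f p) = N by exact: sph.
have fpR : `|f p| <= R0 by apply: norm_le_enorm; [exact: ltW|rewrite fpN].
have eR : `|e| <= 1 / 48 * (`|l| * R0).
  have := lip y p Oy Op; rewrite yp.
  rewrite normrZ -/e => /le_trans; apply; rewrite ler_pM2l//; exact: ler_wpM2l.
(* The factor [3] of [dotv_le] turns [1 / 48] into [1 / 16]. Relative to the main term
   [2 l N + l^2 N], with [l > -1], the four errors are then too small to change the sign. *)
have b1 : `|dotv (f p - p) p| <= N / 16.
  rewrite (le_trans (dotv_le _ _))//.
  have -> : N / 16 = 3 * (R0 / 48) * R0 by rewrite /N; field.
  by rewrite ler_pM// ?mulr_ge0// ler_pM2l// small.
have b2 : `|dotv (f p) e| <= `|l| * N / 16.
  rewrite (le_trans (dotv_le _ _))//.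
  have -> : `|l| * N / 16 = 3 * R0 * (1 / 48 * (`|l| * R0)) by rewrite /N; field.
  by rewrite ler_pM// ?mulr_ge0// ler_pM2l.
have b3 : `|dotv p e| <= `|l| * N / 16.
  rewrite (le_trans (dotv_le _ _))//.
  have -> : `|l| * N / 16 = 3 * R0 * (1 / 48 * (`|l| * R0)) by rewrite /N; field.
  by rewrite ler_pM// ?mulr_ge0// ler_pM2l.
have b4 : `|dotv e e| <= l ^+ 2 * N / 768.
  rewrite (le_trans (dotv_le _ _))//.
  have -> : l ^+ 2 * N / 768 = 3 * (1 / 48 * (`|l| * R0)) * (1 / 48 * (`|l| * R0)).
    by rewrite -[l ^+ 2]real_normK ?num_real// /N; field.
  by rewrite ler_pM// ?mulr_ge0// ler_pM2l.
have dfp : dotv (f p) p = N + dotv (f p - p) p by rewrite dotvBl pN addrC subrK.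
rewrite fyE dotvv_scale_add fpN pN dfp yN.
have e0 := dotv_ge0 e.
move: b1 b2 b3 b4; move: (dotv (f p - p) p) (dotv (f p) e) (dotv p e) (dotv e e) e0 => a b c d d0.
rewrite !ler_norml => /andP[a1 a2] /andP[b1 b2] /andP[c1 c2] /andP[_ d2].
split=> H.
  have l0 : 0 < l.
    rewrite ltNge; apply/negP => l0; move: H; rewrite ltNge => /negP; apply.
    rewrite -[leRHS]mul1r ler_pM2r// expr_le1//; lra.
  rewrite gtr0_norm// in b1 b2 c1 c2.
  have := mulr_gt0 l0 N0; nra.
have l0 : l < 0.
  rewrite ltNge; apply/negP => l0; move: H; rewrite ltNge => /negP; apply.
  rewrite -[leLHS]mul1r ler_pM2r// expr_ge1//; lra.
rewrite ltr0_norm// in b1 b2 c1 c2.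
have q1 : 0 < - l * N by rewrite mulr_gt0// oppr_gt0.
have q2 : 0 <= (- l) * N * (1 + l) by rewrite mulr_ge0// ltW//; lra.
have h1 : l * a <= - l * (N / 16) by nra.
have h2 : l * c <= (- l) * (- l * N / 16) by nra.
nra.
Qed.

Lemma dotv_trmx (M : 'M[R]_3) (a b : vec) : dotv (M^T *m a) b = dotv a (M *m b).
Proof.
have E (u w : vec) : dotv u w = (u^T *m w) 0 0.
  by rewrite mxE; apply: eq_bigr => i _; rewrite mxE.
by rewrite !E trmx_mul trmxK mulmxA.
Qed.

(** An admissible flow comes with a positive Jacobian outside the ball and on the sphere; in the
    interior positivity is obtained from closeness to the identity. *)
Lemma det_near1 : exists2 k : R, 0 < k & forall F : 'M[R]_3, `|F - 1%:M| < k -> 0 < \det F.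
Proof.
have [C [d [C0 d0 H]]] := strict_diff_lip (strict_diff_det (I : @setT 'M[R]_3 1%:M)
  (strict_diff_lin setT 1%:M (bounded_linear_id _))).
exists (Num.min d C^-1); first by rewrite lt_min d0 invr_gt0.
move=> F; rewrite lt_min => /andP[F1 F2].
have := H F 1%:M I I F1; rewrite subrr normr0 det1 => /(_ d0).
have : C * `|F - 1%:M| < 1 by rewrite mulrC -ltr_pdivlMr// div1r.
rewrite ler_norml => h /andP[h1 h2]; lra.
Qed.

Lemma banach_ball (f : vec -> vec) (x : vec) (r : R) : 0 < r ->
  (forall y, `|y - x| <= r -> `|f y - x| <= r) ->
  (forall y z, `|y - x| <= r -> `|z - x| <= r -> `|f y - f z| <= 1 / 2 * `|y - z|) ->
  exists2 y, `|y - x| <= r & y = f y.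
Proof.
move=> r0 fU lip; pose U : set vec := [set y | `|y - x| <= r].
have fUU : set_fun U U f by move=> y; exact: fU.
have cU : closed U.
  have -> : U = closed_ball x r.
    by rewrite closed_ballE//; apply/seteqP; split=> y; rewrite /closed_ball_/= distrC.
  exact: closed_ball_closed.
have [y Uy yE] : exists2 y, U y & y = [fun of mkfun fUU] y.
  have cf : is_contraction [fun of mkfun fUU].
    have h0 : 0 <= (1 / 2 : R) by [].
    exists (NngNum h0); split => /=; first lra.
    by move=> [y z] /= [Uy Uz]; exact: lip.
  pose X : completeNormedModType R := HB.pack 'cV[R]_3.
  apply: (@banach_fixed_point R X U [fun of mkfun fUU] cf cU); by exists x; rewrite /U/= subrr normr0 ltW.
by exists y.
Qed.

End NearIdentity.

(** * Short-time invertibility and invariance of the sphere *)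

Section InverseFlow.
Context {R : realType}.
Local Notation vec := (vec R).

Lemma pdv_id_near (A : set vec) (f : vec -> vec) j x : open A -> A x ->
  (forall y, A y -> f y = y) -> pdv f j x = ebasis R j.
Proof.
move=> oA Ax fid; have [d d0 Hd] := open_ball_sub oA Ax.
have [_ E] : is_derive x (ebasis R j) f (ebasis R j); last exact: E.
have v0 : 0 < `|ebasis R j| + 1 by rewrite ltr_wpDl.
apply: is_derive_eps => e e0; exists (d / (`|ebasis R j| + 1)); first by rewrite divr_gt0.
move=> h h0; rewrite ltr_pdivlMr// => hd.
rewrite !fid//; last first.
  apply: Hd; rewrite addrK normrZ (le_lt_trans _ hd)// ler_wpM2l// lerDl//.
by rewrite addrK scalerA mulVf// scale1r subrr normr0 ltW.
Qed.

(** At time [0] the flow and its partials are those of the identity. The modulus of continuity in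
    time is uniform in space, so one [d] serves all of [A]. *)
Lemma flow_near_id (T k : R) (A : set vec) (phi : R -> vec -> vec) : open A -> 0 < T ->
  contC 1 A T phi -> (forall x, A x -> phi 0 x = x) -> 0 < k ->
  exists2 d : R, 0 < d & forall s x, 0 <= s <= T -> s < d -> A x ->
    `|phi s x - x| <= k /\ forall j, `|pdv (phi s) j x - ebasis R j| <= k.
Proof.
move=> oA T0 [_ H] phi0 k0.
have T00 : 0 <= (0 : R) <= T by rewrite lexx ltW.
have [d [d0 Hd]] := H 0 T00 k k0; exists d => // s x sT sd Ax.
have s0 : `|s - 0| < d by rewrite subr0 ger0_norm//; case/andP: sT.
split; first by have := Hd s sT s0 [::] isT x Ax; rewrite /= phi0.
by move=> j; have := Hd s sT s0 [:: j] isT x Ax; rewrite /= (pdv_id_near j oA Ax phi0).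
Qed.

(** Convexity keeps the whole segment in [O], where the mean value theorem is applied to each
    component; the factor [3] counts the partial derivatives. *)
Lemma near_id_lip (O : set vec) (f : vec -> vec) (k : R) : 0 <= k -> convex_set3 O ->
  (forall y, O y -> differentiable f y) ->
  (forall y j, O y -> `|pdv f j y - ebasis R j| <= k) ->
  forall y z, O y -> O z -> `|f y - y - (f z - z)| <= 3 * k * `|y - z|.
Proof.
move=> k0 cO df Hk y z Oy Oz; apply: norm_le_coord => [|i]; first by rewrite !mulr_ge0.
have Oseg (s : R) : 0 <= s <= 1 -> O (z + s *: (y - z)).
  move=> s01; have := cO z y s Oz Oy s01.
  by congr O; apply/matrixP => a b; rewrite !mxE; ring.
have [|s s01 E] := @mvt_line _ (fun w => f w i 0) y z.
  by move=> s s01; have [] := coord_differentiable i 0 (df _ (Oseg s s01)).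
set w := z + s *: (y - z) in E; have Ow : O w by exact: Oseg.
have -> : (f y - y - (f z - z)) i 0 = \sum_j (y - z) j 0 * (pdv f j w - ebasis R j) i 0.
  have -> : (f y - y - (f z - z)) i 0 = (f y i 0 - f z i 0) - (y - z) i 0 by rewrite !mxE; ring.
  rewrite E {2}(vec_ebasis (y - z)) summxE -sumrB; apply: eq_bigr => j _.
  have [_ ->] := coord_differentiable i 0 (df _ Ow).
  by move: (pdv f j w) (ebasis R j) ((y - z) j 0) => a b c; rewrite !mxE; ring.
rewrite (le_trans (ler_norm_sum _ _ _))//.
have -> : 3 * k * `|y - z| = \sum_(j < 3) (`|y - z| * k) by rewrite sumr_const card_ord; ring.
apply: ler_sum => j _; rewrite normrM ler_pM//; first exact: coord_le_norm.
exact: le_trans (coord_le_norm _ _) (Hk _ _ Ow).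
Qed.

Lemma has_tder_sub (V : normedModType R) (T T1 : R) (f : R -> V) t d :
  T1 <= T -> has_tder T f t d ->
  has_tder T1 f t d.
Proof.
move=> T1T H e /H[dl [dl0 {}H]]; exists dl; split=> // s /andP[s0 sT].
by apply: H; rewrite s0 (le_trans sT).
Qed.

Lemma has_tder_eq (V : normedModType R) T (f g : R -> V) t d : 0 <= t <= T ->
  (forall s, 0 <= s <= T -> g s = f s) -> has_tder T f t d -> has_tder T g t d.
Proof.
move=> tT fg H e /H[dl [dl0 {}H]]; exists dl; split=> // s sT.
by rewrite !fg//; exact: H.
Qed.

Lemma zero_tder_const T (g : R -> R) t : 0 <= t <= T ->
  (forall s, 0 <= s <= T -> has_tder T g s 0) -> g t = g 0.
Proof.
move=> /andP[t0 tT] H.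
have [c _] := has_tder_mvt (dg := fun=> 0) H (lexx 0) t0 tT.
by rewrite mul0r => /eqP; rewrite subr_eq0 => /eqP.
Qed.

Lemma flow_sphere T (A : set vec) (phi dphi : R -> vec -> vec) p : open A ->
  C1C1 A T phi dphi -> A p -> phi 0 p = p ->
  (forall t, 0 <= t <= T -> dotv (phi t p) (dphi t p) = 0) ->
  forall t, 0 <= t <= T -> dotv (phi t p) (phi t p) = dotv p p.
Proof.
move=> oA C11 Ap phi0 tang t tT.
rewrite (zero_tder_const (g := fun s => dotv (phi s p) (phi s p)) tT) ?phi0// => s sT.
have K : slab T A (s, p) by [].
have S := strict_diff_comp (strict_diff_flow oA C11 sT Ap)
  (strict_diff_sqr (K := setT) (x := phi s p) I) K (ex_intro2 _ _ 1 ltr01 (fun _ _ _ => I)).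
have := time_strict_has_tder sT Ap (time_strict_slab S).
rewrite /= mulmx0 addr0 scale1r tang// mulr0; exact.
Qed.

(** The same [k] bounds the displacement of [phi] and the margin of [O] in [O1], so the closed
    [k]-ball around [x] stays in [O1] and is mapped into itself by the contraction. *)
Lemma inverse_flow_exists T (O O1 : set vec) (phi : R -> vec -> vec) (k : R) : 0 < k ->
  (forall x y, O x -> `|y - x| <= k -> O1 y) ->
  (forall s y, 0 <= s <= T -> O1 y -> `|phi s y - y| <= k) ->
  (forall s y z, 0 <= s <= T -> O1 y -> O1 z ->
     `|phi s y - y - (phi s z - z)| <= 1 / 48 * `|y - z|) ->
  exists psi : R -> vec -> vec, forall s x, 0 <= s <= T -> O x ->
    O1 (psi s x) /\ x = phi s (psi s x).
Proof.
move=> k0 OO1 small lip.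
suff H : forall p : R * vec, exists y, 0 <= p.1 <= T -> O p.2 ->
    O1 y /\ p.2 = phi p.1 y.
  have [psi0 Hpsi] := choice H.
  by exists (fun s x => psi0 (s, x)) => s x; exact: (Hpsi (s, x)).
move=> [s x] /=; have [[sT Ox]|no] := pselect (0 <= s <= T /\ O x); last first.
  (* Outside the slab the value is irrelevant; [x] is a default that lets choice produce a total
     function. *)
  by exists x => sT Ox; case: no.
have [y|y z yx zx|y yx yE] := @banach_ball _ (fun y => x - (phi s y - y)) x k k0.
- by move=> yx; rewrite addrC addKr normrN small//; exact: OO1 yx.
- have -> : x - (phi s y - y) - (x - (phi s z - z)) = - (phi s y - y - (phi s z - z)).
    by apply/matrixP => i j; rewrite !mxE; ring.
  rewrite normrN (le_trans (lip _ _ _ sT (OO1 x y Ox yx) (OO1 x z Ox zx)))// ler_wpM2r//; lra.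
exists y => _ _; split; first exact: OO1 yx.
have : y + (phi s y - y) = x by rewrite {1}yE subrK.
by rewrite addrC subrK.
Qed.

End InverseFlow.

(** * Eulerian fields *)

Section EulerianPreliminaries.
Context {R : realType}.
Local Notation vec := (vec R).
Implicit Types V W : normedModType R.

Lemma jcont_time_sub V (T T1 : R) (A : set vec) (f : R -> vec -> V) : T1 <= T ->
  jcont T A f -> jcont T1 A f.
Proof.
move=> T1T H t x /andP[t0 tT] Ax e e0.
have [|d [d0 Hd]] := H t x _ Ax e e0; first by rewrite t0 (le_trans tT).
by exists d; split=> // s y /andP[s0 sT]; apply: Hd; rewrite s0 (le_trans sT).
Qed.

Lemma jcont_comp V T (A O : set vec) (g : R -> vec -> V) (psi : R -> vec -> vec) :
  jcont T A g -> jcont T O psi -> (forall t x, 0 <= t <= T -> O x -> A (psi t x)) ->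
  jcont T O (fun t x => g t (psi t x)).
Proof.
move=> cg cpsi OA t x tT Ox e e0.
have [d1 [d10 H1]] := cg t (psi t x) tT (OA t x tT Ox) e e0.
have [d2 [d20 H2]] := cpsi t x tT Ox d1 d10.
exists (Num.min d1 d2); split=> [|s y sT Oy]; first by rewrite lt_min d10.
rewrite !lt_min => /andP[s1 s2] /andP[_ y2].
by apply: H1 => //; [exact: OA|exact: H2].
Qed.

Lemma space_strict_linl V W T (A : set vec) (f : R -> vec -> V) t x L (M : V -> W) :
  bounded_linear M -> space_strict T A f t x L ->
  space_strict T A (fun s y => M (f s y)) t x (fun u => M (L u)).
Proof.
move=> bM [bL H]; have [lM [C C0 MC]] := bM.
split=> [|e e0]; first exact: bounded_linear_comp bL bM.
have [d d0 Hd] := H (e / C) (divr_gt0 e0 C0); exists d => // s y z sT Ay Az sd yd zd.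
rewrite -!(blB lM) (le_trans (MC _))// -ler_pdivlMl// mulrA [C^-1 * e]mulrC.
exact: Hd.
Qed.

(** By the chain rule the Lagrangian pressure gradient is [F^T *m g] with [g] Eulerian. The factor
    [invmx F *m (invmx F)^T] therefore leaves [g] once the equation is multiplied by [F]. *)
Lemma lagrangian_accel (F B J : 'M[R]_3) (d w g : vec) : F \in unitmx ->
  d + invmx F *m J *m w + invmx F *m B *m F *m w + invmx F *m (invmx F)^T *m (F^T *m g) = 0 ->
  F *m d = - (J *m w + B *m (F *m w) + g).
Proof.
move=> Fu; have trK : (invmx F)^T *m (F^T *m g) = g.
  by rewrite mulmxA -trmx_mul mulmxV// trmx1 mul1mx.
move=> /(congr1 (mulmx F)); rewrite !mulmxDr mulmx0 -!mulmxA !(mulKVmx Fu) trK -!addrA => /eqP.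
by rewrite addr_eq0 => /eqP.
Qed.

End EulerianPreliminaries.

(** * The two Eulerian equations and the extension of the velocity *)

Section Eulerian.
Context {R : realType}.
Local Notation vec := (vec R).
Variables (GM0 R0 Om gam : R) (chi : R -> R) (D : set vec) (ups0 : vec -> R) (T T1 : R).
Variables (phi dphi psi : R -> vec -> vec) (O O1 : set vec) (eta : R).
Local Notation A := (dcover R0 D).
Hypotheses (R0_gt0 : 0 < R0) (Hchi : cutoff_chi chi) (oA : open A) (Hups : CkCl 1 A ups0).
Hypotheses (T1_gt0 : 0 < T1) (T1_le : T1 <= T).
Hypotheses (C11 : C1C1 A T phi dphi) (C2 : contC 2 A T phi).
Hypothesis det_gt0 : forall t y, 0 <= t <= T1 -> O1 y -> 0 < \det (Fmat phi t y).
Hypothesis flow_eq : forall t x, 0 <= t <= T -> D x ->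
  exists d : vec, has_tder T (fun s => vL phi dphi s x) t d /\
    d + invmx (Fmat phi t x) *m jacv (dphi t) x *m vL phi dphi t x
      + invmx (Fmat phi t x) *m Bmat Om *m Fmat phi t x *m vL phi dphi t x
      + invmx (Fmat phi t x) *m (invmx (Fmat phi t x))^T
          *m gradv (fun y => upsL gam ups0 phi t y + Phipot GM0 R0 Om chi (phi t y)) x = 0.
Hypotheses (oO : open O) (oO1 : open O1) (O1A : O1 `<=` A).
Hypothesis psiK : forall t x, 0 <= t <= T1 -> O x -> O1 (psi t x) /\ x = phi t (psi t x).
Hypothesis expand : forall s y z, 0 <= s <= T1 -> O1 y -> O1 z ->
  `|y - z| <= 2 * `|phi s y - phi s z|.
Hypothesis O1D : forall y, O1 y -> R0 ^+ 2 < dotv y y -> D y.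
Hypothesis phi_ext : forall t y, 0 <= t <= T1 -> O1 y -> R0 ^+ 2 < dotv y y ->
  R0 ^+ 2 < dotv (phi t y) (phi t y).
Hypothesis psi_ext : forall t x, 0 <= t <= T1 -> O x -> R0 ^+ 2 < dotv x x ->
  R0 ^+ 2 < dotv (psi t x) (psi t x).
Hypothesis psi_sph : forall t x, 0 <= t <= T1 -> O x -> dotv x x = R0 ^+ 2 ->
  dotv (psi t x) (psi t x) = R0 ^+ 2.
Hypothesis ups_gt0 : forall y, dotv y y = R0 ^+ 2 -> 0 < ups0 y.
Hypothesis tangent : forall t y, 0 <= t <= T1 -> dotv y y = R0 ^+ 2 ->
  dotv (phi t y) (dphi t y) = 0.
Hypotheses (eta_gt0 : 0 < eta)
  (margin : forall x y, dotv x x <= R0 ^+ 2 -> `|y - x| < eta -> O y).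

Let T1T t : 0 <= t <= T1 -> 0 <= t <= T.
Proof. by move=> /andP[-> /le_trans->]. Qed.

Let slab_sub (V : normedModType R) (f : R * vec -> V) t y L : 0 <= t <= T1 -> O1 y ->
  strict_diff (slab T A) f (t, y) L -> strict_diff (slab T1 O1) f (t, y) L.
Proof.
move=> tT Oy S; apply: (strict_diff_near S) => //; exists 1 => // -[s z] [/= sT Oz] _.
by split=> //; split; [exact: T1T|exact: O1A].
Qed.

Let U t x := upsL gam ups0 phi t (psi t x).
Let v t x := dphi t (psi t x).
Let F t x := Fmat phi t (psi t x).
Let J t x := jacv (dphi t) (psi t x).
(** The space derivative of [v = dphi o psi], since [psi] has Jacobian [invmx F]. *)
Let Dv t x (u : vec) := J t x *m (invmx (F t x) *m u).
Let Phi := Phipot GM0 R0 Om chi.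

Let psi_O1 t x : 0 <= t <= T1 -> O x -> O1 (psi t x).
Proof. by move=> tT Ox; have [] := psiK tT Ox. Qed.

Let F_unit t x : 0 <= t <= T1 -> O x -> F t x \in unitmx.
Proof. by move=> tT Ox; rewrite unitmxE unitfE gt_eqF// det_gt0//; exact: psi_O1. Qed.

Let strict_psi t x : 0 <= t <= T1 -> O x ->
  strict_diff (slab T1 O) (fun p => psi p.1 p.2) (t, x)
    (fun u => invmx (F t x) *m (u.2 - u.1 *: v t x)).
Proof.
move=> tT Ox; have Oy := psi_O1 tT Ox.
apply: (strict_diff_inverse (A := O1) (phi := phi) (k := 2)) => //; last exact: F_unit.
by apply: slab_sub => //; apply: strict_diff_flow => //; [exact: T1T|exact: O1A].
Qed.

Let strict_U t x : 0 <= t <= T1 -> O x -> exists L : R * vec -> R,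
  [/\ strict_diff (slab T1 O1) (fun p => upsL gam ups0 phi p.1 p.2) (t, psi t x) L,
      L (1, 0) = - (gam - 1) * U t x * \tr (invmx (F t x) *m J t x) &
      strict_diff (slab T1 O) (fun p => U p.1 p.2) (t, x)
        (fun u => L (u.1, invmx (F t x) *m (u.2 - u.1 *: v t x)))].
Proof.
move=> tT Ox; have Oy := psi_O1 tT Ox.
have [L [SL L1]] := strict_diff_upsL oA C11 C2 gam Hups (T1T tT) (O1A Oy) (det_gt0 tT Oy).
have SL' := slab_sub tT Oy SL.
exists L; split=> //.
have Sp := strict_diff_pair (strict_diff_lin (slab T1 O) (t, x) (bounded_linear_fst R vec))
  (strict_psi tT Ox).
apply: (strict_diff_comp Sp SL') => //.
by exists 1 => // -[s z] [/= sT Oz] _; split=> //=; exact: psi_O1.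
Qed.

Let space_dphi t y : 0 <= t <= T1 -> O1 y ->
  space_strict T1 O1 dphi t y (fun u => jacv (dphi t) y *m u).
Proof.
move=> tT Oy; have [_ cd _] := C11.
have [bL H] := space_strict_jacv oA cd (T1T tT) (O1A Oy).
split=> // e /H[d d0 {}H]; exists d => // s z w sT Oz Ow; apply: H;
  [exact: T1T|exact: O1A|exact: O1A].
Qed.

Let space_v t x : 0 <= t <= T1 -> O x -> space_strict T1 O v t x (Dv t x).
Proof.
move=> tT Ox; have Oy := psi_O1 tT Ox.
have := space_strict_comp (space_dphi tT Oy) (strict_psi tT Ox) tT Ox psi_O1.
by congr space_strict; apply/funext => u; rewrite /= scale0r subr0.
Qed.

Let Oext := [set x | O x /\ R0 ^+ 2 < dotv x x].
Let Ocl := [set x | O x /\ R0 ^+ 2 <= dotv x x].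

Let pdv_U t x i L : 0 <= t <= T1 -> O x ->
  strict_diff (slab T1 O) (fun p => U p.1 p.2) (t, x)
        (fun u => L (u.1, invmx (F t x) *m (u.2 - u.1 *: v t x))) ->
  derivable (U t) x (ebasis R i) /\ pdv (U t) i x = L (0, invmx (F t x) *m ebasis R i).
Proof.
move=> tT Ox S; have [d E] := space_strict_is_derive (ebasis R i) oO tT Ox (space_strict_slab S).
by split=> //; rewrite /pdv E /= scale0r subr0.
Qed.

Let N_gt0 : 0 < R0 ^+ 2. Proof. by rewrite exprn_gt0. Qed.

Let Phi_space t x : 0 < dotv x x -> exists L,
  space_strict T1 [set y : vec | 0 < dotv y y] (fun _ => Phi) t x L.
Proof.
move=> x0; have [L [bL H]] := strict_diff_Phipot GM0 R0 Om Hchi x0; exists L; split=> // e.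
by move=> /H[d d0 {}H]; exists d => // s y z _ Ky Kz _; exact: H.
Qed.

Let open_pos := @open_dotvv_gt R 0.

(** The chain rule for [(U + Phi) o phi]. It is stated outside the ball because [phi] maps the
    exterior to itself, hence away from the origin, where [Phi] is strictly differentiable. *)
Let lagrangian_grad t x : 0 <= t <= T1 -> Oext x ->
  gradv (fun y => upsL gam ups0 phi t y + Phi (phi t y)) (psi t x) =
  (F t x)^T *m (\col_i (pdv (U t) i x + pdv Phi i x)).
Proof.
move=> tT [Ox xN]; have [Oy xE] := psiK tT Ox; have yN := psi_ext tT Ox xN.
have [LG [SG _ SU]] := strict_U tT Ox.
set y := psi t x in Oy xE yN SG *.
pose B := [set z | O1 z /\ R0 ^+ 2 < dotv z z].
have oB : open B by exact: openI oO1 (@open_dotvv_gt R _).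
have By : B y by [].
have x0 : 0 < dotv (phi t y) (phi t y) by rewrite -xE (lt_trans N_gt0).
have [LP SP] := Phi_space t x0.
have Sphi : strict_diff (slab T1 B) (fun p => phi p.1 p.2) (t, y)
    (fun u => u.1 *: dphi t y + Fmat phi t y *m u.2).
  apply: (strict_diff_near (strict_diff_flow oA C11 (T1T tT) (O1A Oy))) => //.
  by exists 1 => // -[s z] [/= sT [Oz _]] _; split=> //; split; [exact: T1T|exact: O1A].
have SPphi := space_strict_comp SP Sphi tT By
  (fun s z sT (Bz : B z) => lt_trans N_gt0 (phi_ext sT Bz.1 Bz.2)).
have lP := proj1 (proj1 SP).
have lG := proj1 (proj1 SG).
have lG0 : linear (fun u : vec => LG (0, u)) by exact: (proj1 (proj1 (space_strict_slab SG))).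
have pPhi i : pdv Phi i x = LP (ebasis R i).
  by have := space_strict_pdv i open_pos tT x0 SP; rewrite -xE.
apply/matrixP => i j; rewrite (ord1 j) {j} mxE.
have D1 := space_strict_is_derive (ebasis R i) oO1 tT Oy (space_strict_slab SG).
have D2 := space_strict_is_derive (ebasis R i) oB tT By SPphi.
have -> : pdv (fun y => upsL gam ups0 phi t y + Phi (phi t y)) i y =
    LG (0, ebasis R i) + LP (Fmat phi t y *m ebasis R i).
  have [_ E] := is_deriveD D1 D2.
  by rewrite /pdv E /= scale0r add0r.
have FE : F t x *m ebasis R i = \sum_j F t x j i *: ebasis R j.
  rewrite {1}[F t x *m _]vec_ebasis; apply: eq_bigr => j _; congr (_ *: _).
  rewrite mxE (bigD1 i)//= big1 => [|k ki]; first by rewrite !mxE !eqxx mulr1 addr0.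
  by rewrite !mxE (negbTE ki) mulr0.
(* Inserting [invmx F *m F] rewrites the derivative of [Ups^L] through the partials of [U], with no
   second composition with [phi]. *)
have -> : LG (0, ebasis R i) = \sum_j F t x j i * LG (0, invmx (F t x) *m ebasis R j).
  rewrite -{1}[ebasis R i](mulKmx (F_unit tT Ox)) FE mulmx_sumr.
  rewrite (bl_sum lG0); apply: eq_bigr => j _.
  by rewrite -scalemxAr (blZ lG0).
rewrite -/(F t x) FE (bl_sum lP) -big_split/= [RHS]mxE; apply: eq_bigr => j _.
rewrite !mxE (blZ lP) pPhi; have [_ ->] := pdv_U j tT Ox SU.
by rewrite [_ *: _]/(_ * _) -mulrDr.
Qed.

(** The acceleration dictated by the momentum equation, written as sums of products of scalars so
    that joint continuity can be read off factor by factor; [bE] restores the matrix form. *)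
Let b t x : vec := \col_i - (\sum_j Dv t x (ebasis R j) i 0 * v t x j 0 +
  \sum_j Bmat Om i j * v t x j 0 + (pdv (U t) i x + pdv Phi i x)).

Let Dv_sum t x (u : vec) i : \sum_j Dv t x (ebasis R j) i 0 * u j 0 = (Dv t x u) i 0.
Proof.
rewrite {2}[u]vec_ebasis /Dv !mulmx_sumr summxE; apply: eq_bigr => k _.
by rewrite -!scalemxAr [RHS]mxE mulrC.
Qed.

Let bE t x : b t x = - (Dv t x (v t x) + Bmat Om *m v t x + \col_i (pdv (U t) i x + pdv Phi i x)).
Proof.
apply/matrixP => i j; rewrite (ord1 j) {j} [LHS]mxE.
have K (X Y Z : vec) : (- (X + Y + Z)) i 0 = - (X i 0 + Y i 0 + Z i 0) by rewrite !mxE.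
by rewrite K -Dv_sum [(_ *m v t x) i 0]mxE [(\col_i _) i 0]mxE.
Qed.

(** Differentiating [dphi = F vL] gives [J vL + F d], and the motion of [psi] adds [- J vL]. What
    remains is [F d], which [lagrangian_accel] identifies. *)
Let tder_v t x : 0 <= t <= T1 -> Oext x -> has_tder T1 (fun s => v s x) t (b t x).
Proof.
move=> tT /[dup] Ex [Ox xN]; have [Oy xE] := psiK tT Ox; have yN := psi_ext tT Ox xN.
have Dy := O1D Oy yN; have [d [Hd eqn]] := flow_eq (T1T tT) Dy.
rewrite (lagrangian_grad tT Ex) in eqn.
have td : has_tder T1 (fun s => dphi s (psi t x)) t
    (J t x *m vL phi dphi t (psi t x) + F t x *m d).
  have := has_tder_mulmx (has_tder_sub T1_le (has_tder_Fmat C11 (T1T tT) (O1A Oy)))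
    (has_tder_sub T1_le Hd).
  apply: has_tder_eq => // s sT; rewrite /vL mulKVmx//.
  by rewrite unitmxE unitfE gt_eqF// det_gt0.
have := has_tder_comp (space_dphi tT Oy) (strict_psi tT Ox) tT Ox psi_O1 td.
congr has_tder; rewrite bE /= scale1r sub0r !mulmxN.
have Fu := F_unit tT Ox.
rewrite -/(F t x) -/(J t x) in eqn.
rewrite addrC addKr (lagrangian_accel Fu eqn); congr (- (_ + _ *m _ + _)).
exact: mulKVmx.
Qed.

Let strict_U_choice : exists LG : R * vec -> R * vec -> R, forall p, slab T1 O p ->
  [/\ strict_diff (slab T1 O1) (fun p => upsL gam ups0 phi p.1 p.2) (p.1, psi p.1 p.2) (LG p),
      LG p (1, 0) = - (gam - 1) * U p.1 p.2 * \tr (invmx (F p.1 p.2) *m J p.1 p.2) &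
      strict_diff (slab T1 O) (fun p => U p.1 p.2) p
        (fun u => LG p (u.1, invmx (F p.1 p.2) *m (u.2 - u.1 *: v p.1 p.2)))].
Proof.
suff H : forall p : R * vec, exists L : R * vec -> R, slab T1 O p ->
  [/\ strict_diff (slab T1 O1) (fun p => upsL gam ups0 phi p.1 p.2) (p.1, psi p.1 p.2) L,
      L (1, 0) = - (gam - 1) * U p.1 p.2 * \tr (invmx (F p.1 p.2) *m J p.1 p.2) &
      strict_diff (slab T1 O) (fun p => U p.1 p.2) p
        (fun u => L (u.1, invmx (F p.1 p.2) *m (u.2 - u.1 *: v p.1 p.2)))].
  by have [LG HLG] := choice H; exists LG.
move=> [t x]; have [[tT Ox]|no] := pselect (slab T1 O (t, x)); last by exists (fun=> 0).
by have [L HL] := strict_U tT Ox; exists L.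
Qed.

Let LU (LG : R * vec -> R * vec -> R) p (u : R * vec) : R :=
  LG p (u.1, invmx (F p.1 p.2) *m (u.2 - u.1 *: v p.1 p.2)).

Let jcont_v : jcont T1 O v.
Proof.
have [_ cd _] := C11.
apply: (jcont_comp (A := O1)); last exact: psi_O1.
  exact: (jcont_time_sub T1_le (jcont_sub O1A (contC_jcont (l := [::]) cd isT))).
apply: (strict_diff_jcont (f := fun p => psi p.1 p.2)
  (L := fun p u => invmx (F p.1 p.2) *m (u.2 - u.1 *: v p.1 p.2))).
by move=> [t x] [/= tT Ox]; exact: strict_psi.
Qed.

(** Strict derivatives are automatically continuous, so the pressure gradient and [Dv] have no jump
    at the sphere, although the acceleration was derived off it. *)
Let jcont_b i : jcont T1 Ocl (fun t x => b t x i 0).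
Proof.
have OclO : Ocl `<=` O by move=> x [].
have [LG HLG] := strict_U_choice.
have [_ _ _ cU] := C1tx_strict_diff (L := LU LG) T1_gt0 oO
  (fun p Kp => let: And3 _ _ SUp := HLG p Kp in SUp).
apply: (@jcont_eq _ _ _ _ (fun t x => (-1) * (\sum_j Dv t x (ebasis R j) i 0 * v t x j 0 +
  \sum_j Bmat Om i j * v t x j 0 + (pdv (U t) i x + pdv Phi i x)))) => [t x _ _|].
  by rewrite [LHS]mxE mulN1r.
have cv j : jcont T1 Ocl (fun t x => v t x j 0) := jcont_coord j 0 (jcont_sub OclO jcont_v).
apply: jcontZ; apply: jcontD; last first.
  apply: jcontD; first exact: jcont_sub OclO (proj2 (cU i)).
  have Ocl_pos : Ocl `<=` [set y | 0 < dotv y y] by move=> x [_]; exact: lt_le_trans.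
  exact: (jcont_sub Ocl_pos (jcont_grad_Phipot GM0 R0 Om i Hchi)).
apply: jcontD; apply: jcont_sum3 => j; last exact: jcontZ.
apply: jcontM => //; apply: jcont_coord.
exact: jcont_sub OclO (space_strict_derive_cont oO space_v (ebasis R j)).
Qed.

Let dense_ext z : Ocl z -> forall d : R, 0 < d -> exists2 z', Oext z' & `|z' - z| < d.
Proof.
move=> [Oz zN] d d0.
have [d1 d10 Hd1] := open_ball_sub oO Oz.
have z0 : 0 < `|z| + 1 by rewrite ltr_wpDl.
pose h := Num.min d d1 / (`|z| + 1).
have h0 : 0 < h by rewrite divr_gt0// lt_min d0.
have zh : `|(1 + h) *: z - z| < Num.min d d1.
  rewrite scalerDl scale1r addrC addKr normrZ gtr0_norm// /h mulrAC ltr_pdivrMr//.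
  by rewrite ltr_pM2l ?lt_min ?d0// ltrDl.
move: zh; rewrite lt_min => /andP[zd zd1].
exists ((1 + h) *: z) => //; split; first exact: Hd1.
rewrite dotvZ (le_lt_trans zN)// -{1}[dotv z z]mul1r ltr_pM2r ?(lt_le_trans N_gt0)//.
by rewrite expr_gt1//; lra.
Qed.

(** Spatial strictness holds on all of [O]. The temporal one reaches the sphere because the open
    exterior is dense in [Ocl] and [b] is continuous up to it. *)
Let strict_v i t x : 0 <= t <= T1 -> O x -> R0 ^+ 2 <= dotv x x ->
  strict_diff (slab T1 Ocl) (fun p => v p.1 p.2 i 0) (t, x)
    (fun u => u.1 * b t x i 0 + Dv t x u.2 i 0).
Proof.
move=> tT Ox xN; have OclO : Ocl `<=` O by move=> y [].
apply: (strict_diff_space_time (f := fun s y => v s y i 0) (a := b t x i 0)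
  (L := fun u => Dv t x u i 0) OclO).
  exact: (space_strict_linl (bounded_linear_coord i 0) (space_v tT Ox)).
apply: (time_strict_tder (A := Ocl) (A' := Oext) (a := fun t x => b t x i 0)) => //.
- by move=> y [Oy /ltW].
- exact: jcont_sub OclO (jcont_coord i 0 jcont_v).
- by move=> s z sT Ez; apply: has_tder_coord; exact: tder_v.
Qed.

Let extension_v : exists V LV,
  (forall t x, R0 ^+ 2 <= dotv x x -> V t x = v t x) /\
  forall p, slab T1 O p -> strict_diff (slab T1 O) (fun p => V p.1 p.2) p (LV p) /\
    (R0 ^+ 2 <= dotv p.2 p.2 -> LV p =1 (fun u => u.1 *: b p.1 p.2 + Dv p.1 p.2 u.2)).
Proof.
have HE i := @extend_ball R R0 T1 eta O (fun t x => v t x i 0) (fun t x => b t x i 0)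
  (fun t x u => Dv t x u i 0) R0_gt0 oO eta_gt0 margin (strict_v i).
have [G HG] := choice HE.
pose V t x : vec := \col_i G i t x.
suff H : forall p : R * vec, exists LV, slab T1 O p ->
    strict_diff (slab T1 O) (fun p => V p.1 p.2) p LV /\
    (R0 ^+ 2 <= dotv p.2 p.2 -> LV =1 (fun u => u.1 *: b p.1 p.2 + Dv p.1 p.2 u.2)).
  have [LV HLV] := choice H; exists V, LV; split=> // t x xN.
  apply/matrixP => i j; rewrite (ord1 j) mxE; exact: (HG i).1.
move=> [t x]; have [[/= tT Ox]|no] := pselect (slab T1 O (t, x)); last by exists (fun=> 0).
have [L' HL'] := choice (fun i => (HG i).2 t x tT Ox).
exists (fun u => \col_i L' i u) => _; split.
  apply: strict_diff_mx => i j; rewrite (ord1 j) {j}.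
  apply: (strict_diff_eqL (L := L' i)) => [|u]; last by rewrite mxE.
  rewrite (_ : (fun q => _) = (fun q => G i q.1 q.2)); first exact: (HL' i).1.
  by apply/funext => q; rewrite mxE.
move=> xN u; apply/matrixP => i j; rewrite (ord1 j) [LHS]mxE (HL' i).2//=.
by rewrite [RHS]mxE; congr (_ + _); rewrite [RHS]mxE.
Qed.

(** [U] is its own extension, whereas [V] replaces [v]. Outside the ball the derivative of [V] is
    prescribed by [b] and [Dv], so both equations reduce to algebra. *)
Lemma eulerian_sol : classical_sol GM0 R0 Om gam chi T1 (O `\` closedB0 R0) O U v.
Proof.
have [LG HLG] := strict_U_choice; have [V [LV [Vv SV]]] := extension_v.
have SU p (Kp : slab T1 O p) : strict_diff (slab T1 O) (fun p => U p.1 p.2) p (LU LG p).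
  by have [] := HLG p Kp.
have CU := C1tx_strict_diff T1_gt0 oO SU.
have CV := C1tx_strict_diff T1_gt0 oO (fun p Kp => (SV p Kp).1).
have extN x : (O `\` closedB0 R0) x -> O x /\ R0 ^+ 2 < dotv x x.
  by move=> [Ox /negP]; rewrite /closedB0/= enorm_le ?(ltW R0_gt0)// -ltNge.
have pV t x j : 0 <= t <= T1 -> O x -> R0 ^+ 2 < dotv x x ->
    pdv (V t) j x = Dv t x (ebasis R j).
  move=> tT Ox xN; have [S E] := SV (t, x) (conj tT Ox).
  rewrite (space_strict_pdv j oO tT Ox (space_strict_slab S)) E; last exact: ltW.
  by rewrite /= scale0r add0r.
exists (fun t x => U t x), (fun t x => LU LG (t, x) (1, 0)), (fun t x => V t x),
  (fun t x => LV (t, x) (1, 0)); split=> [t x tT /extN[Ox /ltW xN]||t x tT /extN[Ox xN]|t x tT /extN[Ox xN]|t x tT].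
- by split=> //; exact: Vv.
- by split.
- have [SL L1 SUx] := HLG (t, x) (conj tT Ox); rewrite /LU; move: (LG (t, x)) SL L1 SUx => L SL L1 SUx.
  have lL := proj1 (proj1 SL).
  have lL0 : linear (fun u : vec => L (0, u)) by exact: (proj1 (proj1 (space_strict_slab SL))).
  rewrite /= (Vv _ _ (ltW xN)).
  rewrite scale1r sub0r mulmxN.
  have -> : dotv (v t x) (gradv (U t) x) = L (0, invmx (F t x) *m v t x).
    rewrite {2}[v t x]vec_ebasis mulmx_sumr (bl_sum lL0) /dotv; apply: eq_bigr => i _.
    by have [_ E] := pdv_U i tT Ox SUx; rewrite mxE E -scalemxAr (blZ lL0).
  (* The spatial half is exactly the convective term with the opposite sign; only the time
     derivative along the trajectory is left. *)
  have -> : L (1, - (invmx (F t x) *m v t x)) = L (1, 0) - L (0, invmx (F t x) *m v t x).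
    rewrite -(blB lL); congr L; apply/pair_equal_spec; split=> /=; first by rewrite subr0.
    by rewrite sub0r.
  (* The Jacobian of [V] is [J *m invmx F]; cyclicity of the trace matches the order in Jacobi's
     formula. *)
  have -> : divv (V t) x = \tr (invmx (F t x) *m J t x).
    rewrite mxtrace_mulC /divv; congr (\tr _); apply/matrixP => i j.
    rewrite mxE pV// /Dv mulmxA mxE (bigD1 j)//= big1 => [|k kj].
      by rewrite !mxE !eqxx mulr1 addr0.
    by rewrite !mxE (negbTE kj) mulr0.
  by rewrite L1; ring.
- have [S E] := SV (t, x) (conj tT Ox).
  rewrite E ?ltW//= scale1r (_ : Dv t x 0 = 0); last by rewrite /Dv !mulmx0.
  rewrite addr0 (Vv _ _ (ltW xN)) bE.
  have -> : jacv (V t) x *m v t x = Dv t x (v t x).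
    apply/matrixP => i j; rewrite (ord1 j) -Dv_sum mxE; apply: eq_bigr => k _.
    by rewrite mxE pV.
  have -> : gradv (fun y => U t y + Phipot GM0 R0 Om chi y) x =
      \col_i (pdv (U t) i x + pdv Phi i x).
    apply/matrixP => i j; rewrite !mxE /pdv.
    have x0 : 0 < dotv x x by rewrite (lt_trans N_gt0).
    have [LP SP] := Phi_space t x0.
    have D2 := space_strict_is_derive (ebasis R i) open_pos tT x0 SP.
    have D1 := space_strict_is_derive (ebasis R i) oO tT Ox
      (space_strict_slab (SU (t, x) (conj tT Ox))).
    by apply: deriveD; [case: D1|case: D2].
  by rewrite -addrA addrA addrC; apply/eqP; rewrite addrC -!addrA addNr.
- move=> xR; have xN : dotv x x = R0 ^+ 2.
    by rewrite -xR sqr_sqrtr// dotv_ge0.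
  have Ox : O x by apply: (margin (x := x)); rewrite ?xN// subrr normr0.
  have [Oy xE] := psiK tT Ox; have yN := psi_sph tT Ox xN.
  split.
    by rewrite mulr_gt0//; [exact: ups_gt0|rewrite powR_gt0// det_gt0].
  by rewrite Vv ?xN// {1}xE tangent.
Qed.

End Eulerian.

(** * Choice of the constants and assembly *)

Unset Implicit Arguments.

Theorem theorem2 (R : realType) (GM0 R0 Om A gam : R) (chi : R -> R)
    (D : set (vec R)) (ups0 : vec R -> R) (T : R) (phi dphi : R -> vec R -> vec R)
    (O O0 O1 : set (vec R)) :
  0 < GM0 -> 0 < R0 -> 0 < A -> 1 < gam < 2 -> cutoff_chi chi ->
  admissible_domain R0 D -> admissible_ups R0 D ups0 -> 0 < T ->
  admissible_flow GM0 R0 Om gam chi D ups0 T phi dphi ->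
  open O -> connected O -> open O0 -> connected O0 -> open O1 -> connected O1 ->
  closedB0 R0 `<=` O0 -> cpt_sub O0 O -> cpt_sub O O1 -> cpt_sub O1 (dcover R0 D) ->
  convex_set3 O1 ->
  exists T1 : R, 0 < T1 < T /\
  exists psi : R -> vec R -> vec R,
    [/\ (forall t x, 0 <= t <= T1 -> O x -> O1 (psi t x) /\ x = phi t (psi t x)),
        (forall t, 0 <= t <= T1 -> O0 `<=` psi t @` O) &
        classical_sol GM0 R0 Om gam chi T1 (O `\` closedB0 R0) O
          (fun t x => ups0 (psi t x) * (\det (jacv (phi t) (psi t x))) `^ (- (gam - 1)))
          (fun t x => dphi t (psi t x))].
Proof.
move=> _ R0_gt0 _ _ Hchi [_ oA _ DE _] [Hups ups_gt0] T_gt0.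
move=> [[C11 C2] phi0 det_gt0 flow_eq tangent] oO _ _ _ oO1 _ B0O0 [cO0 O0O] [cO OO1] [_ O1A] convO1.
have ballE x : (dotv x x <= R0 ^+ 2) -> closedB0 R0 x by rewrite /closedB0/= enorm_le// ltW.
have sphE x : dotv x x = R0 ^+ 2 -> enorm x = R0.
  by move=> xN; rewrite /enorm xN sqrtr_sqr gtr0_norm.
have O0_O : O0 `<=` O by move=> x /subset_closure/O0O.
have O_O1 : O `<=` O1 by move=> x /subset_closure/OO1.
have {}O1A : O1 `<=` dcover R0 D by move=> x /subset_closure/O1A.
have BA x : dotv x x <= R0 ^+ 2 -> dcover R0 D x by move=> /ballE; right.
have [eta1 eta1_gt0 margin1] := compact_open_margin cO oO1 OO1.
have [eta0 eta0_gt0 margin0] := compact_open_margin cO0 oO O0O.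
have [kd kd_gt0 detF] := @det_near1 R.
(* [R0 / 48] is the displacement bound of [radial_order], and [1 / 144] becomes the Lipschitz
   constant [1 / 48] after the factor [3] of [near_id_lip]. [eta1] keeps preimages of [O] in [O1],
   [eta0] keeps images of [O0] in [O], and [kd] keeps the determinant positive. The halves make
   these last inequalities strict. *)
pose k := Num.min (Num.min (R0 / 48) (1 / 144)) (Num.min (Num.min (eta1 / 2) (eta0 / 2)) (kd / 2)).
have k_gt0 : 0 < k by rewrite !lt_min !divr_gt0.
have kR : k <= R0 / 48 by rewrite /k !ge_min lexx.
have k144 : k <= 1 / 144 by rewrite /k !ge_min lexx !orbT.
have k1 : k < eta1.
  by rewrite (@le_lt_trans _ _ (eta1 / 2))//; [rewrite /k !ge_min lexx !orbT|lra].
have k0 : k < eta0.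
  by rewrite (@le_lt_trans _ _ (eta0 / 2))//; [rewrite /k !ge_min lexx !orbT|lra].
have kkd : k < kd.
  by rewrite (@le_lt_trans _ _ (kd / 2))//; [rewrite /k !ge_min lexx !orbT|lra].
have [c1 _ _] := C11.
have [d d_gt0 near_id] := flow_near_id oA T_gt0 c1 phi0 k_gt0.
(* Halving puts [T1] strictly below both [T] and the time [d] up to which the flow is near the
   identity. *)
pose T1 := Num.min T d / 2.
have T1_gt0 : 0 < T1 by rewrite divr_gt0// lt_min T_gt0.
have TT1 : T1 < T.
  have : Num.min T d <= T by rewrite ge_min lexx.
  by rewrite /T1; lra.
have T1d : T1 < d.
  have : Num.min T d <= d by rewrite ge_min lexx orbT.
  by rewrite /T1; lra.
have T1T t : 0 <= t <= T1 -> 0 <= t <= T by move=> /andP[-> /le_trans->//]; exact: ltW.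
have small s y : 0 <= s <= T1 -> dcover R0 D y -> `|phi s y - y| <= k.
  move=> sT Ay; have [] // := near_id s y (T1T _ sT) _ Ay.
  by case/andP: sT => _ /le_lt_trans; apply.
have small' s y j : 0 <= s <= T1 -> dcover R0 D y -> `|pdv (phi s) j y - ebasis R j| <= k.
  move=> sT Ay; have [|_ H] := near_id s y (T1T _ sT) _ Ay; last exact: H.
  by case/andP: sT => _ /le_lt_trans; apply.
have det0 s y : 0 <= s <= T1 -> O1 y -> 0 < \det (Fmat phi s y).
  move=> sT /O1A Ay; apply: detF; apply: le_lt_trans kkd.
  rewrite [leLHS]mx_normrE; apply: bigmax_le => [|[i j] _ /=]; first exact: ltW.
  apply: le_trans (small' s y j sT Ay).
  have -> : (Fmat phi s y - 1%:M) i j = (pdv (phi s) j y - ebasis R j) i 0.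
    by rewrite !mxE eqxx andbT.
  exact: coord_le_norm.
have lip s y z : 0 <= s <= T1 -> O1 y -> O1 z ->
    `|phi s y - y - (phi s z - z)| <= 1 / 48 * `|y - z|.
  move=> sT Oy Oz.
  have dphis w : O1 w -> differentiable (phi s) w.
    by move=> /O1A Aw; have [_ /(_ [::]) H _] := c1.1 s (T1T _ sT); exact: H.
  have := near_id_lip (ltW k_gt0) convO1 dphis
    (fun w j Ow => small' s w j sT (O1A w Ow)) Oy Oz.
  by move=> /le_trans; apply; rewrite ler_wpM2r//; lra.
have expand s y z : 0 <= s <= T1 -> O1 y -> O1 z -> `|y - z| <= 2 * `|phi s y - phi s z|.
  move=> sT Oy Oz; have := lip s y z sT Oy Oz.
  have -> : phi s y - y - (phi s z - z) = (phi s y - phi s z) - (y - z).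
    by apply/matrixP => i j; rewrite !mxE; ring.
  rewrite distrC => /(le_trans (lerB_dist _ _)); have := normr_ge0 (phi s y - phi s z); lra.
have OO1k x y : O x -> `|y - x| <= k -> O1 y.
  by move=> Ox yx; apply: (margin1 x); [exact: subset_closure|exact: le_lt_trans yx k1].
have [psi psiK] := inverse_flow_exists k_gt0 OO1k (fun s y sT Oy => small s y sT (O1A y Oy)) lip.
have sphere_tangent t y : 0 <= t <= T -> dotv y y = R0 ^+ 2 -> dotv (phi t y) (dphi t y) = 0.
  move=> tT yN; have yR := sphE y yN.
  have Fu : Fmat phi t y \in unitmx.
    by rewrite unitmxE unitfE gt_eqF// det_gt0//; right.
  (* Moving the transpose across the product brings [F] against the [invmx F] inside [vL], so the
     condition says that [phi] and [dphi] are orthogonal. *)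
  have := tangent t y tT yR; rewrite /vL scalemxAr -scalemxAr.
  have -> (a : R) (u w : vec R) : dotv (a *: u) w = a * dotv u w.
    by rewrite /dotv mulr_sumr; apply: eq_bigr => i _; rewrite mxE mulrA.
  rewrite dotv_trmx mulKVmx// => /eqP; rewrite mulf_eq0 invr_eq0 gt_eqF//= => /eqP.
  exact.
have sphere t y : 0 <= t <= T1 -> dotv y y = R0 ^+ 2 -> dotv (phi t y) (phi t y) = R0 ^+ 2.
  move=> tT yN; have Ay : dcover R0 D y by apply: BA; rewrite yN.
  rewrite (flow_sphere oA C11 Ay (phi0 y Ay) _ (T1T _ tT))// => s sT.
  exact: sphere_tangent.
have order t := @radial_order R (phi t) O1 R0 R0_gt0
  (fun y yN => O_O1 _ (O0_O _ (B0O0 _ (ballE y yN)))).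
have radial t y : 0 <= t <= T1 -> O1 y ->
    (R0 ^+ 2 < dotv y y -> R0 ^+ 2 < dotv (phi t y) (phi t y)) /\
    (dotv y y < R0 ^+ 2 -> dotv (phi t y) (phi t y) < R0 ^+ 2).
  move=> tT; apply: order => [z Oz|z w|p]; [|exact: lip|exact: sphere].
  exact: le_trans (small t z tT (O1A z Oz)) kR.
exists T1; split; first by rewrite T1_gt0.
exists psi; split=> // [t tT y O0y|].
  (* The preimage of [y] under [psi t] is [phi t y]: it lies in [O] by the margin, and
     [psi t (phi t y) = y] because the expansion bound makes [phi t] injective on [O1]. *)
  have O1y : O1 y by exact/O_O1/O0_O.
  have Ox : O (phi t y).
    apply: (margin0 y); first exact: subset_closure.
    exact: le_lt_trans (small t y tT (O1A y O1y)) k0.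
  have [Op pE] := psiK t _ tT Ox.
  exists (phi t y) => //; apply/eqP; rewrite -subr_eq0 -normr_le0.
  by rewrite (le_trans (expand t _ _ tT Op O1y))// -pE subrr normr0 mulr0.
(* The ball lies in [O0], so the margin [eta0] of [O0] in [O] also serves around the ball for the
   reflection. *)
apply: (eulerian_sol (D := D) (T := T) (phi := phi) (O1 := O1) (eta := eta0)) => //.
- exact: ltW.
- move=> y O1y yN; have := O1A y O1y; rewrite /dcover => -[//|].
  by rewrite /closedB0/= enorm_le ?(ltW R0_gt0)// leNgt yN.
- by move=> t y tT O1y; have [] := radial t y tT O1y.
(* By trichotomy: a preimage inside the ball or on the sphere would put [x] itself inside or on the
   sphere. *)
- move=> t x tT Ox xN; have [Op pE] := psiK t x tT Ox.
  have [_ lt] := radial t _ tT Op; rewrite -pE in lt.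
  have [//|/lt|] := ltgtP (R0 ^+ 2) (dotv (psi t x) (psi t x)); first by rewrite ltNge (ltW xN).
  by move=> /esym/(sphere t _ tT); rewrite -pE => xE; rewrite xE ltxx in xN.
- move=> t x tT Ox xN; have [Op pE] := psiK t x tT Ox.
  have [gt lt] := radial t _ tT Op; rewrite -pE xN ltxx in gt lt.
  by have [/gt|/lt|] := ltgtP (R0 ^+ 2) (dotv (psi t x) (psi t x)).
- by move=> y /sphE; exact: ups_gt0.
- by move=> t y /T1T; exact: sphere_tangent.
- move=> x y xN yx; apply: (margin0 x) => //; exact/subset_closure/B0O0/ballE.
Qed.
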